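(* For any $\lambda\ge0$ and any $\phi\in C^1([-1,1])$, $$\int\phi'(x)^2(1-x^2)\,\nu_\lambda(dx)\ge\frac{2\lambda+1}{2}\iint\left(\frac{\phi(x)-\phi(y)}{x-y}\right)^2H_\lambda(x,y)\,\nu_\lambda(dx)\nu_\lambda(dy)$$ and $$\iint\left(\frac{\phi(x)-\phi(y)}{x-y}\right)^2H_\lambda(x,y)\,\nu_\lambda(dx)\nu_\lambda(dy)\ge2\,\mathrm{Var}_{\nu_\lambda}(\phi).$$
   Context: For $\lambda\ge0$, $\nu_\lambda$ is the probability measure $$\nu_\lambda(dx)=\frac{2^{2\lambda}\Gamma^2(\lambda+1)}{\pi\,\Gamma(2\lambda+1)}\mathbf{1}_{[-1,1]}(x)(1-x^2)^{\lambda-1/2}\,dx,$$ and $\mathrm{Var}_{\nu_\lambda}(\phi)=\int\phi^2d\nu_\lambda-\left(\int\phi\,d\nu_\lambda\right)^2$. For $\lambda>0$ define $f_\lambda:(0,1)\to\mathbb{R}$ by $$f_\lambda(u)=\int_1^{1/u}\frac{[(t-1)(1-ut)]^{\lambda-1}}{t^{\lambda+1}}\,dt.$$ For $|x|,|y|<1$ (with $x\neq y$, which suffices for the integrals), define $H_0(x,y)=1-xy$ and, for $\lambda>0$, $$H_\lambda(x,y)=\frac{\Gamma(2\lambda)\left(1-xy+\sqrt{(1-x^2)(1-y^2)}\right)^\lambda}{2^{3\lambda-1}\Gamma^2(\lambda)\left((1-x^2)(1-y^2)\right)^{\lambda-1/2}}\,f_\lambda\!\left(\frac{(x-y)^2}{\left(1-xy+\sqrt{(1-x^2)(1-y^2)}\right)^2}\right).$$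 In particular $H_1(x,y)=\frac12$. *)

(* Defs.v *)
(* MathComp-Analysis *)
From HB Require Import structures.
From mathcomp Require Import all_boot all_order all_algebra.
From mathcomp Require Import all_classical all_reals all_analysis.
From mathcomp Require Import measurable_realfun.

Set Implicit Arguments.
Unset Strict Implicit.
Unset Printing Implicit Defensive.

Import Order.TTheory GRing.Theory Num.Theory.
Import numFieldNormedType.Exports.

Local Open Scope classical_set_scope.
Local Open Scope ring_scope.

(* Euler's integral; convergent for 0 < s, the only case in which it is used. *)
Definition Gamma {R : realType} (s : R) : R :=
  \int[lebesgue_measure]_(t in `]0, +oo[) (t `^ (s - 1) * expR (- t)).

(* [phi] is C^1 on the closed interval [a, b]: it is continuous on [a, b],
   differentiable in the interior, and its derivative is continuous and extends
   continuously to [a, b]. The values of [phi] outside [a, b] are irrelevant. *)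
Definition C1_itv {R : realType} (a b : R) (phi : R -> R) : Prop :=
  [/\ derivable_oo_LRcontinuous phi a b,
      {in `]a, b[, continuous phi^`()%classic},
      cvg (phi^`()%classic x @[x --> a^'+]) &
      cvg (phi^`()%classic x @[x --> b^'-])].

Section ultraspherical.
Context {R : realType}.
Implicit Types (lambda u x y : R).

Definition nu_density lambda x : R :=
  2 `^ (2 * lambda) * Gamma (lambda + 1) ^+ 2
    / (pi * Gamma (2 * lambda + 1))
  * \1_(`[-1, 1]%classic : set R) x * (1 - x ^+ 2) `^ (lambda - 2^-1).

Definition nu lambda : set R -> \bar R :=
  fun A => (\int[lebesgue_measure]_(x in A) (nu_density lambda x)%:E)%E.

Lemma Gamma_ge0 (s : R) : 0 <= Gamma s.
Proof.
apply: fine_ge0; apply: integral_ge0 => t _.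
by rewrite lee_fin mulr_ge0 ?powR_ge0 ?expR_ge0.
Qed.

Lemma nu_density_ge0 lambda x : 0 <= nu_density lambda x.
Proof.
rewrite !mulr_ge0 ?powR_ge0 ?exprn_ge0 ?Gamma_ge0 ?invr_ge0 ?mulr_ge0//.
- exact: pi_ge0.
- exact: Gamma_ge0.
Qed.

Lemma measurable_nu_density lambda :
  measurable_fun [set: R] (nu_density lambda).
Proof.
apply: measurable_funM; first by apply: measurable_funM.
apply: (@measurableT_comp _ _ _ _ _ _ (@powR R ^~ _)) => //.
by apply: measurable_funB => //; exact: measurable_funX.
Qed.

Let nu0 lambda : nu lambda set0 = 0%E.
Proof. by rewrite /nu integral_set0. Qed.

Let nu_ge0 lambda A : (0 <= nu lambda A)%E.
Proof. by apply: integral_ge0 => x _; rewrite lee_fin nu_density_ge0. Qed.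

Let nu_sigma_additive lambda : semi_sigma_additive (nu lambda).
Proof.
move=> /= F mF tF mUF; rewrite /nu; apply: cvg_toP.
  apply: ereal_nondecreasing_is_cvgn => m n mn.
  apply: lee_sum_nneg_natr => // k _ _; apply: integral_ge0 => /= x _.
  by rewrite lee_fin nu_density_ge0.
rewrite ge0_integral_bigcup//=.
- apply/measurable_funTS/measurableT_comp => //.
  exact: measurable_nu_density.
- by move=> x _; rewrite lee_fin nu_density_ge0.
Qed.

HB.instance Definition _ lambda := isMeasure.Build _ _ _
  (nu lambda) (nu0 lambda) (@nu_ge0 lambda) (@nu_sigma_additive lambda).

Definition variance_nu lambda (phi : R -> R) : \bar R :=
  (\int[nu lambda]_(x in `[(-1)%R, 1%R]) (phi x ^+ 2)%:E
   - (\int[nu lambda]_(x in `[(-1)%R, 1%R]) (phi x)%:E) ^+ 2)%E.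

Definition f_ lambda u : R :=
  \int[lebesgue_measure]_(t in `[1, u^-1])
    (((t - 1) * (1 - u * t)) `^ (lambda - 1) / t `^ (lambda + 1)).

(* Meaningful for |x|, |y| < 1 and x != y (for [lambda = 0] also on the
   diagonal); the remaining points of [-1, 1]^2 are negligible for the product
   of [nu lambda] with itself. *)
Definition H_ lambda x y : R :=
  if lambda == 0 then 1 - x * y else
  let w := (1 - x ^+ 2) * (1 - y ^+ 2) in
  let s := 1 - x * y + Num.sqrt w in
  Gamma (2 * lambda) * s `^ lambda
    / (2 `^ (3 * lambda - 1) * Gamma lambda ^+ 2 * w `^ (lambda - 2^-1))
  * f_ lambda ((x - y) ^+ 2 / s ^+ 2).

(* Extended-real valued, so that no integrability is presupposed; the integrand
   is nonnegative on ]-1, 1[^2. *)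
Definition H_energy lambda (phi : R -> R) : \bar R :=
  (\int[nu lambda]_(y in `[(-1)%R, 1%R]) \int[nu lambda]_(x in `[(-1)%R, 1%R])
     (((phi x - phi y) / (x - y)) ^+ 2 * H_ lambda x y)%:E)%E.

End ultraspherical.

(* Main.v *)
Require Import Defs.
From HB Require Import structures.
From mathcomp Require Import all_boot all_order all_algebra.
From mathcomp Require Import all_classical all_reals all_analysis.
From mathcomp Require Import measurable_realfun ring lra zify.

Set Implicit Arguments.
Unset Strict Implicit.
Unset Printing Implicit Defensive.

Import Order.TTheory GRing.Theory Num.Theory.
Import numFieldNormedType.Exports.

Local Open Scope classical_set_scope.
Local Open Scope ring_scope.

(** Let C_n be the Gegenbauer polynomials for the weight (1 - x^2)^(l - 1/2),
    normalised by C_n(1) = 1. They diagonalise simultaneously the three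
    quadratic forms of the theorem: at phi = sum_n c_n C_n, and with |C_n| the
    norm in L^2(nu),
    - the Dirichlet form is the sum of n (n + 2 l) c_n^2 |C_n|^2;
    - the energy attached to H is the sum of 2 n c_n^2 |C_n|^2;
    - the variance is the sum over n >= 1 of c_n^2 |C_n|^2.
    For polynomials the two inequalities are therefore the numerical
    inequalities (2 l + 1) n <= n (n + 2 l) and 1 <= n, for n >= 1
    [polynomial_inequalities]. The first line is the self-adjoint differential
    equation of C_n [dirichlet_gegenbauer]; the substance is the second one.

    For l > 0, let K(x, y, z) be the power l - 1 of the Gram determinant
    1 - x^2 - y^2 - z^2 + 2 x y z, where this is positive. The function
    H(x, y) / (x - y)^2, multiplied by the weights in x and in y, is up to a
    constant the integral over z of K(x, y, z) (1 - z)^(-l-1): the substitution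
    z = 1 - d t turns this integral into the one defining f_l
    [integral_kern_f]. For fixed z, K is the kernel of a generalised
    translation operator. That operator does not raise degrees and it is
    symmetric, because K is; so it is diagonal in the orthogonal basis C_n, with
    eigenvalue proportional to C_n(z), the value found by evaluating at 1
    [translation_gegenbauer]. This is Gegenbauer's product formula. By Tonelli's
    theorem the energy is then a combination of the integrals of
    (1 - C_n(z)) / (1 - z) for the weight (1 - z)^(-1/2) (1 + z)^(l - 1/2), and
    these are linear in n: integration by parts and the recurrences for C_n make
    their second differences vanish [slope_int_gegenbauer].

    For l = 0 the kernel is (1 - x y) / (x - y)^2. An integration by parts in x
    replaces the squared difference quotient of p by the product of p' with a
    difference quotient, that is with a finite Hilbert transform, and the latter
    maps C_n to a multiple of its derivative [energy_chebyshev].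

    The normalising constants are Beta integrals, compared by means of the
    duplication formula; evaluating one double integral in two orders, one of
    which exhibits the Gaussian integral, gives both that formula and Gamma(1/2).

    To pass to a C^1 function phi, let p be a primitive of a polynomial that is
    uniformly within e of phi'. Then phi - p is Lipschitz with constant e, so
    each of the three forms at p and at phi agrees with the other up to a factor
    1 + e and an error O(e), the error of the energy being measured by the energy
    of the identity function, which is finite. Let e tend to 0
    [lee_of_perturb]. All comparisons are made between extended reals, so that
    infinite integrals are covered. *)

(** * Change of variables and densities *)

Section change_of_variable.
Context {R : realType}.
Local Notation mu := (@lebesgue_measure R).
Local Open Scope ereal_scope.

Lemma ge0_integral_oppr (f : R -> \bar R) :
  measurable_fun [set: R] f -> (forall r, 0 <= f r) ->
  \int[mu]_x f (- x)%R = \int[mu]_x f x.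
Proof.
move=> mf f0.
pose h : measurableTypeR R -> measurableTypeR R := -%R.
have mh : measurable_fun setT h by exact: oppr_measurable.
have := @ge0_integral_pushforward _ _ _ _ _ h mh mu setT f measurableT mf
  (fun y _ => f0 y).
rewrite preimage_setT /comp /h => <-.
by apply: eq_measure_integral => //= A mA _; exact: lebesgue_measureN.
Qed.

Lemma measurable_affine (a b : R) : measurable_fun [set: R] (fun x => a * x + b)%R.
Proof. by apply: measurable_funD => //; apply: measurable_funM. Qed.

(** Lebesgue measure is determined by its values on intervals, and these scale as required. *)
Lemma lebesgue_measure_affine (a b : R) (A : set R) : (0 < a)%R -> measurable A ->
  mu A = a%:E * mu ((fun x => a * x + b)%R @^-1` A).
Proof.
move=> a0 mA.
pose h : measurableTypeR R -> measurableTypeR R := fun x => (a * x + b)%R.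
have mh : measurable_fun setT h by exact: measurable_affine.
pose m := mscale (NngNum (ltW a0)) (pushforward mu h).
apply: (@lebesgue_measure_unique R (m mh)) => //= _ [[c d]] _ <-.
rewrite -[RHS]/(a%:E * mu (h @^-1` [set` `]c, d]])).
have hE : h @^-1` [set` `]c, d]] = `]((c - b) / a)%R, ((d - b) / a)%R]%classic.
  apply/seteqP; split => x; rewrite /= !in_itv/= /h ltr_pdivrMr// ler_pdivlMr//.
    by rewrite ltrBlDr lerBrDr mulrC.
  by rewrite ltrBlDr lerBrDr mulrC.
rewrite hE !lebesgue_measure_itv/= !lte_fin ltr_pM2r ?invr_gt0// ltrD2r.
case: ifPn => _; last by rewrite mule0.
rewrite -!EFinB -EFinM; congr EFin; field; exact: lt0r_neq0.
Qed.

Lemma ge0_integral_affine_gt0 (f : R -> \bar R) (a b : R) : (0 < a)%R ->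
  measurable_fun [set: R] f -> (forall r, 0 <= f r) ->
  \int[mu]_x f x = a%:E * \int[mu]_x f (a * x + b)%R.
Proof.
move=> a0 mf f0.
pose h : measurableTypeR R -> measurableTypeR R := fun x => (a * x + b)%R.
have mh : measurable_fun setT h by exact: measurable_affine.
have := @ge0_integral_pushforward _ _ _ _ _ h mh mu setT f measurableT mf
  (fun y _ => f0 y).
rewrite preimage_setT /comp /h => <-.
rewrite -(ge0_integral_mscale _ measurableT (NngNum (ltW a0)))//.
apply: eq_measure_integral => //= A mA _; rewrite /mscale/=.
exact: lebesgue_measure_affine.
Qed.

Lemma ge0_integral_affine (f : R -> \bar R) (a b : R) : (a != 0)%R ->
  measurable_fun [set: R] f -> (forall r, 0 <= f r) ->
  \int[mu]_x f x = `|a|%:E * \int[mu]_x f (a * x + b)%R.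
Proof.
move=> a0 mf f0; have [a_gt0|a_le0] := ltP 0%R a.
  by rewrite gtr0_norm//; exact: ge0_integral_affine_gt0.
have a_lt0 : (a < 0)%R by rewrite lt_neqAle a0.
rewrite ltr0_norm// (@ge0_integral_affine_gt0 _ (- a)%R b) ?oppr_gt0//.
congr (_ * _); rewrite -ge0_integral_oppr//.
- by apply: eq_integral => x _; rewrite mulrNN.
- by apply: measurableT_comp => //; exact: measurable_affine.
Qed.

End change_of_variable.

Section density.
Context d (T : measurableType d) {R : realType}.
Variables (mu m : {measure set T -> \bar R}) (g : T -> R).
Hypothesis g0 : forall x, 0 <= g x.
Hypothesis mg : measurable_fun setT g.
Local Open Scope ereal_scope.
Hypothesis mE : forall A, measurable A -> m A = \int[mu]_(x in A) (g x)%:E.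
Import HBNNSimple.

Let integral_density_indic A : measurable A ->
  \int[m]_x (\1_A x)%:E = \int[mu]_x ((\1_A x)%:E * (g x)%:E).
Proof.
move=> mA; rewrite integral_indic//= setIT mE// [LHS]integral_mkcond.
apply: eq_integral => x _; rewrite patchE indicE.
by case: ifPn => xA; rewrite ?mul1e ?mul0e.
Qed.

Let integral_density_nnsfun (f : {nnsfun T >-> R}) :
  \int[m]_x (f x)%:E = \int[mu]_x ((f x)%:E * (g x)%:E).
Proof.
under [LHS]eq_integral do rewrite fimfunE -fsumEFin//.
rewrite [LHS]ge0_integral_fsum//; last 2 first.
  - by move=> r; exact/measurable_EFinP/measurableT_comp.
  - by move=> n x _; rewrite nnfun_muleindic_ge0.
under [RHS]eq_integral.
  move=> x _; rewrite fimfunE -fsumEFin// ge0_mule_fsuml; last first.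
    by move=> r; rewrite nnfun_muleindic_ge0.
  over.
rewrite [RHS]ge0_integral_fsum//; last 2 first.
  - move=> r; apply: emeasurable_funM; last exact/measurable_EFinP.
    exact/measurable_EFinP/measurableT_comp.
  - by move=> n x _; rewrite mule_ge0 ?[in X in is_true X]EFinM ?nnfun_muleindic_ge0 ?lee_fin.
apply: eq_fsbigr => r /[!inE] -[t _ <-].
have ft0 : (0 <= f t)%R by [].
rewrite integralZl_indic_nnsfun// integral_density_indic//.
rewrite -ge0_integralZl//=.
- by apply: eq_integral => x _; rewrite muleA.
- by apply: emeasurable_funM; [exact/measurable_EFinP/measurable_indic|exact/measurable_EFinP].
- by move=> x _; rewrite mule_ge0 ?lee_fin.
Qed.

(** True for indicators by the choice of g, for simple functions by linearity, and in general by monotone convergence. *)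
Lemma ge0_integral_density (D : set T) (f : T -> \bar R) :
  measurable D -> measurable_fun D f -> (forall x, D x -> 0 <= f x) ->
  \int[m]_(x in D) f x = \int[mu]_(x in D) (f x * (g x)%:E).
Proof.
move=> mD mf f0.
have mfD : measurable_fun setT (f \_ D) by apply/(measurable_restrictT _ mD).
have fD0 x : 0 <= (f \_ D) x.
  by rewrite patchE; case: ifPn => // /set_mem; exact: f0.
rewrite [LHS]integral_mkcond [RHS]integral_mkcond.
transitivity (\int[mu]_x ((f \_ D) x * (g x)%:E)); last first.
  by apply: eq_integral => x _; rewrite !patchE; case: ifPn; rewrite ?mul0e.
pose f_ := nnsfun_approx measurableT mfD.
transitivity (limn (fun n => \int[m]_x (f_ n x)%:E)).
  rewrite -monotone_convergence//=.
  - apply: eq_integral => ? /[!inE] xD; apply/esym/cvg_lim => //=.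
    exact: cvg_nnsfun_approx.
  - by move=> n; exact/measurable_EFinP/measurable_funTS.
  - by move=> n ? _; rewrite lee_fin.
  - by move=> ? _ ? ? mn; rewrite lee_fin; exact/lefP/nd_nnsfun_approx.
transitivity (limn (fun n => \int[mu]_x ((f_ n x)%:E * (g x)%:E))).
  by apply: congr_lim; apply/funext => n; exact: integral_density_nnsfun.
rewrite -monotone_convergence//=.
- apply: eq_integral => x _; apply/cvg_lim => //=.
  under eq_fun do rewrite muleC; rewrite muleC.
  by apply: cvgeZl => //; exact: cvg_nnsfun_approx.
- move=> n; apply: emeasurable_funM; exact/measurable_EFinP/measurable_funTS.
- by move=> n ? _; rewrite mule_ge0 ?lee_fin.
- move=> x _ ? ? mn; rewrite lee_wpmul2r ?lee_fin//; exact/lefP/nd_nnsfun_approx.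
Qed.

End density.

(** * Euler integrals *)

(** Extending powers by zero to the left of the origin lets the supports of the weights below be carried by the weights themselves, so that all integrals range over the whole line. *)
Definition ppow {R : realType} (r t : R) : R := if 0 < t then t `^ r else 0.

Section ppow.
Context {R : realType}.
Implicit Types r s t : R.

Lemma gt0_powRD r s t : 0 < t -> t `^ (r + s) = t `^ r * t `^ s.
Proof. by move=> t0; rewrite powRD// (gt_eqF t0) implybT. Qed.

Lemma ppow_ge0 r t : 0 <= ppow r t.
Proof. by rewrite /ppow; case: ifP => // _; exact: powR_ge0. Qed.

Lemma gt0_ppow r t : 0 < t -> ppow r t = t `^ r.
Proof. by rewrite /ppow => ->. Qed.

Lemma le0_ppow r t : t <= 0 -> ppow r t = 0.
Proof. by rewrite /ppow ltNge => ->. Qed.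

Lemma measurable_ppow r : measurable_fun setT (@ppow R r).
Proof.
apply: (@measurable_fun_ifT _ _ _ _ (fun t => t `^ r) (cst 0) (fun t => 0 < t)) => //.
  exact: (measurable_fun_ltr (measurable_cst _) (@measurable_id _ R _)).
Qed.

Lemma ppowM r s t : 0 < s -> ppow r (s * t) = s `^ r * ppow r t.
Proof.
move=> s0; rewrite /ppow pmulr_rgt0//; case: ifP => t0; last by rewrite mulr0.
by rewrite powRM// ltW.
Qed.

Lemma ppowD r s t : ppow (r + s) t = ppow r t * ppow s t.
Proof.
rewrite /ppow; case: ifP => t0; last by rewrite mulr0.
exact: gt0_powRD.
Qed.

Lemma ppow1 t : 0 <= t -> ppow 1 t = t.
Proof.
by rewrite le_eqVlt /ppow => /predU1P[<-|t0]; rewrite ?ltxx// t0 powRr1// ltW.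
Qed.

End ppow.
#[global] Hint Extern 0 (is_true (0 <= ppow _ _)%R) => solve [exact: ppow_ge0] : core.

Ltac mfun := repeat first
  [ exact: measurable_id | exact: measurable_cst | exact: measurable_fst | exact: measurable_snd
  | exact: measurable_ppow | exact: (@measurable_expR _) | assumption
  | apply: measurable_funD | apply: measurable_funM
  | apply: measurable_funB | apply: measurable_funX
  | apply: (measurableT_comp (measurable_ppow _))
  | apply: (measurableT_comp (@measurable_expR _))
  | apply: (measurableT_comp (oppr_measurable (D := setT)))
  | apply: (measurableT_comp measurable_fst) | apply: (measurableT_comp measurable_snd) ].

Ltac mefun := apply/measurable_EFinP => /=; mfun.

Lemma eq_integral_off1 {R : realType} (f g : R -> \bar R) (r : R) :
  measurable_fun setT f -> measurable_fun setT g ->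
  (forall x, x != r -> f x = g x) ->
  (\int[lebesgue_measure]_x f x = \int[lebesgue_measure]_x g x)%E.
Proof.
move=> mf mg fg.
have mD : measurable ([set: R] `\ r) by exact: measurableD.
rewrite -(@integral_setD1 _ f r)//; last exact: measurable_funTS.
rewrite -(@integral_setD1 _ g r)//; last exact: measurable_funTS.
by apply: eq_integral => x /set_mem/= [_ /eqP]; exact: fg.
Qed.

Lemma gt0_powR_continuous {R : realType} (r t : R) : 0 < t ->
  {for t, continuous (fun x => x `^ r)}.
Proof.
move=> t0; apply: differentiable_continuous; apply/derivable1_diffP.
by apply: derivable_powR; rewrite in_itv/= t0.
Qed.

(** Euler's integrals are first taken in the extended reals: their product formula is then an instance of Tonelli's theorem, and finiteness is deduced from it. *)
Section euler_integrals.
Context {R : realType}.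
Local Notation mu := (@lebesgue_measure R).
Local Open Scope ereal_scope.
Implicit Types a b s : R.

Definition eGamma s := \int[mu]_t (ppow (s - 1) t * expR (- t))%:E.
Definition eBeta a b := \int[mu]_t (ppow (a - 1) t * ppow (b - 1) (1 - t))%:E.

Lemma eGamma_ge0 s : 0 <= eGamma s.
Proof. by apply: integral_ge0 => t _; rewrite lee_fin mulr_ge0// expR_ge0. Qed.

Lemma eBeta_ge0 a b : 0 <= eBeta a b.
Proof. by apply: integral_ge0 => t _; rewrite lee_fin mulr_ge0. Qed.

(** In the double integral of x^(a-1) w^(b-1) exp(-x-w), substitute v = x + w for w, exchange the integrals, and substitute v t for x. *)
Lemma eGammaM a b : eGamma a * eGamma b = eGamma (a + b) * eBeta a b.
Proof.
pose h (p : R * R) : \bar R :=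
  (ppow (a - 1) p.1 * ppow (b - 1) (p.2 - p.1) * expR (- p.2))%:E.
have mh : measurable_fun setT h by rewrite /h; mefun.
have h0 p : 0 <= h p by rewrite lee_fin !mulr_ge0// expR_ge0.
transitivity (\int[mu]_x \int[mu]_v h (x, v)).
  rewrite muleC -ge0_integralZl//=; last 3 first.
  - by mefun.
  - by move=> t _; rewrite lee_fin mulr_ge0// expR_ge0.
  - exact: eGamma_ge0.
  apply: eq_integral => x _.
  rewrite muleC -ge0_integralZl//=; last 3 first.
  - by mefun.
  - by move=> t _; rewrite lee_fin mulr_ge0// expR_ge0.
  - by rewrite lee_fin mulr_ge0// expR_ge0.
  rewrite (@ge0_integral_affine _ _ 1%R (- x)%R)//; last 2 first.
  - by mefun.
  - by move=> t; rewrite -EFinM lee_fin !mulr_ge0// expR_ge0.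
  rewrite normr1 mul1e; apply: eq_integral => v _.
  rewrite /h/= -EFinM mul1r; congr EFin.
  rewrite -(mulrA (ppow _ _)) -!mulrA; congr (_ * _)%R.
  rewrite mulrCA; congr (_ * _)%R.
  by rewrite -expRD; congr expR; ring.
rewrite fubini_tonelli// muleC -ge0_integralZl//=; last 3 first.
- by mefun.
- by move=> t _; rewrite lee_fin mulr_ge0// expR_ge0.
- exact: eBeta_ge0.
apply: eq_integral => v _.
have [v0|v0] := ltP 0%R v; last first.
  rewrite le0_ppow// mul0r mule0 integral0_eq// => x _; rewrite /h/=.
  have [x0|x0] := ltP 0%R x; last by rewrite le0_ppow// !mul0r.
  by rewrite (@le0_ppow _ (b - 1)) ?mulr0 ?mul0r//; lra.
rewrite (@ge0_integral_affine _ _ v 0%R)//; last 2 first.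
- by rewrite gt_eqF.
- by rewrite /h; mefun.
rewrite gtr0_norm// muleC -ge0_integralZr//=; last 2 first.
- by rewrite /h; mefun.
- by rewrite lee_fin ltW.
rewrite muleC -ge0_integralZl//=; last 3 first.
- by mefun.
- by move=> t _; rewrite lee_fin mulr_ge0.
- by rewrite lee_fin mulr_ge0// expR_ge0.
apply: eq_integral => t _; rewrite /h/= addr0.
have -> : (v - v * t = v * (1 - t))%R by ring.
rewrite !ppowM// -!EFinM; congr EFin.
rewrite (gt0_ppow _ v0).
have -> : (v `^ (a + b - 1) = v `^ (a - 1) * v `^ (b - 1) * v)%R.
  rewrite -[X in (_ * _ * X)%R]powRr1 ?ltW//.
  by rewrite -!gt0_powRD//; congr (_ `^ _)%R; ring.
ring.
Qed.

Lemma eGamma1 : eGamma 1 = 1.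
Proof.
rewrite -(@integral_exponential_pdf R 1%R)//.
apply: (@eq_integral_off1 _ _ _ 0%R).
- by mefun.
- by apply/measurable_EFinP; exact: measurable_exponential_pdf.
move=> t t0; rewrite /ppow subrr powRr0 /exponential_pdf patchE.
have [t_gt0|t_le0] := ltP 0%R t.
  by rewrite mem_set/= ?in_itv/= ?ltW// !mul1r mulN1r.
rewrite memNset ?mul0r//= in_itv/= andbT; apply/negP.
by rewrite -ltNge lt_neqAle t0.
Qed.

(** Monotone convergence from the intervals [1/(n+2), 1], on which t^a / a is a differentiable primitive. *)
Lemma eBeta1r a : (0 < a)%R -> eBeta a 1 = a^-1%:E.
Proof.
move=> a0; rewrite /eBeta.
pose F n := `[(n.+2%:R^-1 : R)%R, 1%R]%classic.
have FE : \bigcup_n F n = `]0%R, 1%R]%classic.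
  apply/seteqP; split => [x [n _]|x].
    rewrite /F/= !in_itv/= => /andP[nx ->]; rewrite andbT.
    by apply: lt_le_trans nx; rewrite invr_gt0.
  rewrite /= in_itv/= => /andP[x0 x1].
  have [n nx] : exists n, (n.+2%:R^-1 <= x)%R.
    exists (Num.truncn x^-1); rewrite -[leRHS]invrK lef_pV2 ?posrE ?invr_gt0//.
    by apply/ltW/(lt_le_trans (Num.Theory.truncnS_gt _)); rewrite ler_nat.
  by exists n => //; rewrite /F/= in_itv/= nx.
pose f t : R := (t `^ (a - 1))%R.
transitivity (\int[mu]_(x in `]0%R, 1%R]) (f x)%:E).
  rewrite [RHS]integral_mkcond; apply: (@eq_integral_off1 _ _ _ 1%R).
  - by mefun.
  - apply/(measurable_restrictT (EFin \o f)) => //.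
    by apply/measurable_EFinP/measurable_funTS; exact: measurable_powR.
  move=> t t1; rewrite patchE /ppow subr_gt0 subrr powRr0.
  case: ifPn => [t0|t0]; last first.
    rewrite memNset ?mul0r//= in_itv/=; apply/negP.
    by rewrite negb_and t0.
  case: ifPn => t1'; first by rewrite mem_set ?mulr1//= in_itv/= t0 ltW.
  rewrite memNset ?mulr0//= in_itv/= t0/=; apply/negP.
  by rewrite -ltNge lt_neqAle eq_sym t1 leNgt.
have mf : measurable_fun setT f by exact: measurable_powR.
have mF n : measurable (F n) by exact: measurable_itv.
have Fnd : nondecreasing_seq F.
  move=> m n mn; rewrite subsetEset => x /=; rewrite /F/= !in_itv/= => /andP[mx ->].
  by rewrite andbT (le_trans _ mx)// lef_pV2 ?posrE// ler_nat.
have := @ge0_nondecreasing_set_cvg_integral _ (measurableTypeR R) R F (EFin \o f) mu Fnd mF.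
rewrite FE => /(_ _ _)/cvg_lim <-//; last 2 first.
- by move=> i; apply/measurable_EFinP/measurable_funTS.
- by move=> i x _; rewrite lee_fin powR_ge0.
apply/cvg_lim => //.
have -> : (fun i => \int[mu]_(x in F i) (EFin \o f) x) =
          (fun i => (a^-1 * (1 - (i.+2%:R^-1) `^ a))%:E).
  apply/funext => n; rewrite /F.
  have n1 : (n.+2%:R^-1 < 1 :> R)%R by rewrite invf_lt1// ltr1n.
  have n0 : (0 < n.+2%:R^-1 :> R)%R by rewrite invr_gt0.
  rewrite (@continuous_FTC2 _ f (fun t => a^-1 * t `^ a)%R)//.
  - by rewrite powR1 -EFinB mulrBr.
  - apply: continuous_in_subspaceT => x; rewrite inE/= in_itv/= => /andP[nx _].
    exact/gt0_powR_continuous/(lt_le_trans n0).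
  - split.
    + move=> x; rewrite in_itv/= => /andP[nx _].
      apply: derivableM; first exact: derivable_cst.
      by apply: derivable_powR; rewrite in_itv/= (lt_trans n0).
    + apply: cvgM; first exact: cvg_cst.
      by apply/cvg_at_right_filter/gt0_powR_continuous.
    + apply: cvgM; first exact: cvg_cst.
      by apply/cvg_at_left_filter/gt0_powR_continuous.
  - move=> x; rewrite in_itv/= => /andP[nx _].
    have x0 : (0 < x)%R by exact: lt_trans nx.
    rewrite derive1Ml; last by apply: derivable_powR; rewrite in_itv/= x0.
    by rewrite powR_derive1 ?in_itv/= ?x0// mulrA mulVf ?mul1r// gt_eqF.
apply: cvg_EFin; first by near=> n.
suff : (a^-1 * (1 - n.+2%:R^-1 `^ a) : R)%R @[n --> \oo] --> (a^-1 * (1 - 0))%R.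
  by rewrite subr0 mulr1.
apply: cvgM; first exact: cvg_cst.
apply: cvgB; first exact: cvg_cst.
apply: (cvg_at_rightP (fun x => x `^ a)%R 0%R 0%R).1 => //; first exact: powR_cvg0.
split => [n|]; first by rewrite invr_gt0.
have := @cvg_harmonic R; rewrite -(@cvg_shiftS _ (@harmonic R)) /=; exact.
Unshelve. all: by end_near. Qed.

Lemma eGammaS a : (0 < a)%R -> eGamma (a + 1) = a%:E * eGamma a.
Proof.
move=> a0; have := eGammaM a 1; rewrite eGamma1 mule1 => ->.
rewrite eBeta1r// muleC -muleA -EFinM mulVf ?mule1// gt_eqF//.
Qed.

(** The functional equation gives the positive integers and, at the end, the descent from a + 1 to a; in between, t^(b-1) is at most 1 + t^(n+1) for b <= n + 2. *)
Lemma eGamma_fin a : (0 < a)%R -> eGamma a \is a fin_num.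
Proof.
have nat_fin n : eGamma n.+1%:R \is a fin_num.
  elim: n => [|n ih]; first by rewrite eGamma1.
  by rewrite -addn1 natrD eGammaS// fin_numM.
have ge1_fin b : (1 <= b)%R -> eGamma b \is a fin_num.
  move=> b1; rewrite ge0_fin_numE ?eGamma_ge0//.
  pose n := Num.truncn b.
  apply: (@le_lt_trans _ _ (eGamma 1 + eGamma n.+2%:R)).
    rewrite -ge0_integralD//=; last 4 first.
    - by move=> t _; rewrite lee_fin mulr_ge0// expR_ge0.
    - by mefun.
    - by move=> t _; rewrite lee_fin mulr_ge0// expR_ge0.
    - by mefun.
    apply: ge0_le_integral => //=.
    - by move=> t _; rewrite lee_fin mulr_ge0// expR_ge0.
    - by mefun.
    - by apply: emeasurable_funD; mefun.
    move=> t _; rewrite -EFinD lee_fin -mulrDl ler_wpM2r ?expR_ge0//.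
    rewrite /ppow; case: ifPn => [t0|_]; last by rewrite addr0.
    rewrite subrr powRr0; have [t1|t1] := leP t 1%R.
      rewrite (@le_trans _ _ 1%R)//; last by rewrite lerDl powR_ge0.
      by rewrite -[leRHS](powRr0 t); apply: ger_powR; rewrite ?t0 ?t1// subr_ge0.
    rewrite (@le_trans _ _ (t `^ (n.+2%:R - 1))%R) ?lerDr//.
    apply: ler_powR; first exact: ltW.
    rewrite lerD2r; apply: ltW; apply: lt_trans (Num.Theory.truncnS_gt b) _.
    by rewrite ltr_nat.
  by rewrite lte_add_pinfty// -ge0_fin_numE ?eGamma_ge0// -[1%R]/(1%:R)%R.
move=> a0; have := ge1_fin (a + 1)%R; rewrite lerDr ltW// => /(_ isT).
rewrite eGammaS// !ge0_fin_numE ?eGamma_ge0//; last first.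
  by rewrite mule_ge0 ?eGamma_ge0 ?lee_fin ?ltW.
by apply: contraTT; rewrite -!leNgt !leye_eq => /eqP ->; rewrite gt0_muley ?lte_fin.
Qed.

End euler_integrals.

(** * Jacobi weights *)

(** The Jacobi weight on ]-1, 1[, with the exponents shifted by 1 so that a and b are the parameters of the Beta integral it reduces to. *)
Definition wgt {R : realType} (a b x : R) : R :=
  ppow (a - 1) (1 - x) * ppow (b - 1) (1 + x).

Ltac mpos := move=> *; rewrite ?lee_fin; repeat first
  [ exact: ppow_ge0 | exact: expR_ge0 | exact: powR_ge0 | exact: gauss_fun_ge0 | exact: sqr_ge0
  | exact: eGamma_ge0 | exact: eBeta_ge0 | assumption | (by []) | (by apply: ltW)
  | apply: mulr_ge0 | (apply: integral_ge0 => * /=; rewrite ?lee_fin) ].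

Section real_integrands.
Context {R : realType}.
Local Notation mu := (@lebesgue_measure R).

Lemma ge0_integralZ_fin (c : R) (f : R -> R) : 0 <= c -> measurable_fun setT f ->
  (forall x, 0 <= f x) ->
  (c%:E * \int[mu]_x (f x)%:E = \int[mu]_x (c * f x)%:E)%E.
Proof.
move=> c0 mf f0; rewrite -ge0_integralZl//=.
- exact/measurable_EFinP.
- by move=> x _; rewrite lee_fin.
Qed.

Lemma ge0_integral_affine_fin (f : R -> R) (a b : R) : a != 0 ->
  measurable_fun setT f -> (forall x, 0 <= f x) ->
  (\int[mu]_x (f x)%:E = \int[mu]_x (`|a| * f (a * x + b))%:E)%E.
Proof.
move=> a0 mf f0; rewrite -ge0_integralZ_fin//.
- by rewrite (@ge0_integral_affine _ (EFin \o f) a b)//; apply/measurable_EFinP.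
- by apply: measurableT_comp mf _; exact: measurable_affine.
Qed.

End real_integrands.

Section gamma_beta.
Context {R : realType}.
Local Notation mu := (@lebesgue_measure R).
Implicit Types a b s x : R.

Lemma GammaE s : 0 < s -> (Gamma s)%:E = eGamma s.
Proof.
move=> s0; rewrite -(fineK (eGamma_fin s0)) /Gamma /Rintegral; congr (fine _)%:E.
rewrite integral_mkcond; apply: eq_integral => t _; rewrite patchE /ppow.
case: ifPn; first by rewrite inE/= in_itv/= andbT => ->.
by rewrite notin_setE/= in_itv/= andbT => /negP/negbTE ->; rewrite mul0r.
Qed.

Lemma Gamma_gt0 s : 0 < s -> 0 < Gamma s.
Proof.
move=> s0; rewrite -lte_fin GammaE//.
pose c : R := 2^-1 * expR (- 2).
have c0 : 0 < c by rewrite mulr_gt0 ?expR_gt0.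
apply: (@lt_le_trans _ _ (\int[mu]_(x in `[1%R, 2%R]) c%:E)%E).
  rewrite integral_cst//= lebesgue_measure_itv/= lte_fin ltr1n/= -EFinB -EFinM lte_fin.
  by rewrite mulr_gt0//; lra.
rewrite integral_mkcond; apply: ge0_le_integral => //=.
- by move=> x _; rewrite patchE; case: ifPn => // _; rewrite lee_fin ltW.
- by apply/(measurable_restrictT (cst c%:E)).
- by mefun.
move=> x _; rewrite patchE; case: ifPn => [|_]; last first.
  by rewrite lee_fin mulr_ge0// expR_ge0.
rewrite inE/= in_itv/= => /andP[x1 x2]; rewrite lee_fin.
have x0 : 0 < x by lra.
apply: ler_pM => //; rewrite ?expR_ge0 ?ler_expR ?lerN2//.
rewrite gt0_ppow// gt0_powRD// powR_inv1; last exact: ltW.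
rewrite -[leLHS]mul1r; apply: ler_pM => //; last by rewrite lef_pV2 ?posrE.
by rewrite -[leLHS](powRr0 x); apply: ler_powR => //; exact: ltW.
Qed.

Lemma GammaS a : 0 < a -> Gamma (a + 1) = a * Gamma a.
Proof.
by move=> a0; apply: EFin_inj; rewrite EFinM !GammaE ?eGammaS// addr_gt0.
Qed.

Lemma Gamma1 : Gamma 1 = 1 :> R.
Proof. by apply: EFin_inj; rewrite GammaE ?eGamma1. Qed.

Lemma eBetaE a b : 0 < a -> 0 < b ->
  eBeta a b = (Gamma a * Gamma b / Gamma (a + b))%:E.
Proof.
move=> a0 b0; have ab0 : 0 < a + b by exact: addr_gt0.
have := eGammaM a b; rewrite -!GammaE// -EFinM => e.
rewrite mulrC EFinM e muleA -EFinM mulVf ?mul1e// gt_eqF//.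
exact: Gamma_gt0.
Qed.

Lemma wgt_ge0 a b x : 0 <= wgt a b x.
Proof. by rewrite mulr_ge0. Qed.

Lemma measurable_wgt a b : measurable_fun setT (@wgt R a b).
Proof. by rewrite /wgt; mfun. Qed.

Lemma integral_wgt a b : 0 < a -> 0 < b ->
  (\int[mu]_x (wgt a b x)%:E)%E =
  (2 `^ (a + b - 1) * (Gamma a * Gamma b / Gamma (a + b)))%:E.
Proof.
move=> a0 b0; rewrite EFinM -eBetaE//.
(* x = 1 - 2 t maps [0, 1] onto [-1, 1] *)
rewrite (@ge0_integral_affine_fin _ (wgt a b) (- 2) 1)//; last 2 first.
- exact: measurable_wgt.
- exact: wgt_ge0.
transitivity (\int[mu]_t (2 `^ (a + b - 1) * (ppow (a - 1) t * ppow (b - 1) (1 - t)))%:E)%E;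
  last first.
  apply/esym/(@ge0_integralZ_fin R) => [||x]; first exact: powR_ge0.
    by mfun.
  by rewrite mulr_ge0.
apply: eq_integral => t _; rewrite /wgt; congr EFin.
have -> : 1 - (- 2 * t + 1) = 2 * t by ring.
have -> : 1 + (- 2 * t + 1) = 2 * (1 - t) by ring.
rewrite !ppowM// normrN ger0_norm//.
have -> : (2 : R) `^ (a + b - 1) = 2 * 2 `^ (a - 1) * 2 `^ (b - 1).
  rewrite -[X in X * _ * _]powRr1// -!gt0_powRD//; congr (_ `^ _); ring.
ring.
Qed.

Lemma ppow_wgt a x : ppow (a - 1) (1 - x ^+ 2) = wgt a a x.
Proof.
have e : 1 - x ^+ 2 = (1 - x) * (1 + x) by ring.
rewrite /wgt e; have [x1|x1] := ltP 0 (1 - x).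
  by rewrite ppowM// [in RHS]gt0_ppow.
rewrite [in RHS]le0_ppow// mul0r le0_ppow//.
by rewrite mulr_le0_ge0//; lra.
Qed.

(** Integrate (v - y^2)^(a-1) exp(-v) over the region v > y^2 in both orders. With v = y^2 + t the y-integral is Gaussian; with y = sqrt(v) x the inner integral is that of the weight. *)
Lemma integral_wgt_gauss a : 0 < a ->
  ((\int[mu]_x (wgt a a x)%:E) * (Gamma (a + 2^-1))%:E)%E =
  (Gamma a * Num.sqrt pi)%:E.
Proof.
move=> a0; rewrite EFinM !GammaE ?addr_gt0//.
pose h (p : R * R) : R := ppow (a - 1) (p.2 - p.1 ^+ 2) * expR (- p.2).
have mh : measurable_fun setT h by rewrite /h; mfun.
have h0 p : 0 <= h p by rewrite mulr_ge0// expR_ge0.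
transitivity (\int[mu]_y \int[mu]_v (h (y, v))%:E)%E; last first.
  rewrite -integralT_gauss -ge0_integralZl//=; last 3 first.
  - by apply/measurable_EFinP; exact: measurable_gauss_fun.
  - by move=> x _; rewrite lee_fin gauss_fun_ge0.
  - exact: eGamma_ge0.
  apply: eq_integral => y _.
  have mhy : measurable_fun setT (fun v => h (y, v)).
    by apply: measurableT_comp mh _; exact: measurable_pair1.
  rewrite (@ge0_integral_affine_fin _ (fun v => h (y, v)) 1 (y ^+ 2))//.
  rewrite muleC.
  transitivity (\int[mu]_t (gauss_fun y * (ppow (a - 1) t * expR (- t)))%:E)%E;
    last first.
    apply/esym/(@ge0_integralZ_fin R) => [||x]; first exact: gauss_fun_ge0.
      by mfun.
    by rewrite mulr_ge0// expR_ge0.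
  apply: eq_integral => t _; rewrite normr1 mul1r /h/= mul1r addrK; congr EFin.
  by rewrite mulrCA opprD expRD; congr (_ * _); rewrite mulrC.
rewrite (@fubini_tonelli _ _ _ _ _ mu mu (fun p => (h p)%:E))//; last exact/measurable_EFinP.
rewrite /eGamma -ge0_integralZl//=; last 3 first.
- by mefun.
- by move=> t _; rewrite lee_fin mulr_ge0// expR_ge0.
- by apply: integral_ge0 => x _; rewrite lee_fin wgt_ge0.
apply: eq_integral => v _.
have [v0|v0] := ltP 0 v; last first.
  rewrite le0_ppow// mul0r mule0 integral0_eq// => y _; rewrite /h/=.
  by rewrite le0_ppow ?mul0r// (le_trans _ v0)// gerBl sqr_ge0.
have s0 : 0 < v `^ 2^-1 by exact: powR_gt0.
have mhv : measurable_fun setT (fun y => h (y, v)).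
  by apply: measurableT_comp mh _; exact: measurable_pair2.
rewrite (@ge0_integral_affine_fin _ (fun y => h (y, v)) (v `^ 2^-1) 0) ?gt_eqF//.
rewrite muleC ge0_integralZ_fin; last 3 first.
- by rewrite mulr_ge0// expR_ge0.
- exact: measurable_wgt.
- exact: wgt_ge0.
apply: eq_integral => x _; rewrite gtr0_norm// /h/= addr0; congr EFin.
rewrite exprMn -powR_mulrn ?powR_ge0// -powRrM mulVf// powRr1; last exact: ltW.
have -> : v - v * x ^+ 2 = v * (1 - x ^+ 2) by ring.
rewrite ppowM// ppow_wgt gt0_ppow//.
have -> : v `^ (a + 2^-1 - 1) = v `^ (a - 1) * v `^ 2^-1.
  by rewrite -!gt0_powRD//; congr (_ `^ _); ring.
ring.
Qed.

(** The weight with a = 1/2 has mass Gamma(1/2)^2, by [integral_wgt]. *)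
Lemma Gamma_half : Gamma (2^-1 : R) = Num.sqrt pi.
Proof.
have h0 : 0 < 2^-1 :> R by [].
have := integral_wgt_gauss h0; rewrite integral_wgt//.
have -> : 2^-1 + 2^-1 = 1 :> R by lra.
rewrite subrr powRr0 Gamma1 !divr1 -!EFinM => -[]; rewrite mul1r mulr1.
by apply: mulfI; rewrite gt_eqF// Gamma_gt0.
Qed.

Lemma integral_wgt_sym a : 0 < a ->
  (\int[mu]_x (wgt a a x)%:E)%E = (Gamma a * Num.sqrt pi / Gamma (a + 2^-1))%:E.
Proof.
move=> a0; have := integral_wgt_gauss a0.
have g0 : 0 < Gamma (a + 2^-1) by rewrite Gamma_gt0// addr_gt0.
move=> e; rewrite EFinM -e -muleA -EFinM divff ?mule1// gt_eqF//.
Qed.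

(** The mass of the symmetric weight is known both as a Beta integral and from [integral_wgt_gauss]. *)
Lemma Gamma_duplication a : 0 < a ->
  Gamma (2 * a) * Num.sqrt pi = 2 `^ (2 * a - 1) * (Gamma a * Gamma (a + 2^-1)).
Proof.
move=> a0; have := integral_wgt_sym a0; rewrite integral_wgt// => -[].
have -> : a + a = 2 * a by ring.
have g0 : Gamma (a + 2^-1) != 0 by rewrite gt_eqF// Gamma_gt0// addr_gt0.
have g1 : Gamma a != 0 by rewrite gt_eqF// Gamma_gt0.
have g2 : Gamma (2 * a) != 0 by rewrite gt_eqF// Gamma_gt0// mulr_gt0.
move: g0 g1 g2; set v := Gamma (a + _); set w := Gamma (2 * a); set u := Gamma a.
clearbody u v w => v0 u0 w0 /(congr1 (fun t => t * (w * v / u))) e.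
have -> : w * Num.sqrt pi = u * Num.sqrt pi / v * (w * v / u).
  by field; rewrite ?u0 ?v0 ?w0.
by rewrite -e; field; rewrite ?u0 ?v0 ?w0.
Qed.

End gamma_beta.
#[global] Hint Extern 0 (is_true (0 <= wgt _ _ _)%R) => solve [exact: wgt_ge0] : core.

(** * Normalising constants *)

Definition nu_const {R : realType} (l : R) : R :=
  2 `^ (2 * l) * Gamma (l + 1) ^+ 2 / (pi * Gamma (2 * l + 1)).

Definition H_const {R : realType} (l : R) : R :=
  Gamma (2 * l) / (2 `^ (3 * l - 1) * Gamma l ^+ 2).

Section constants.
Context {R : realType}.
Local Notation mu := (@lebesgue_measure R).
Implicit Types l x : R.

Lemma nu_const_gt0 l : 0 <= l -> 0 < nu_const l.
Proof.
move=> l0; rewrite divr_gt0// ?mulr_gt0 ?exprn_gt0 ?powR_gt0 ?pi_gt0 ?Gamma_gt0//;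
  by rewrite ltr_wpDl ?mulr_ge0.
Qed.

(** Duplication at l + 1/2 gives the constant of nu the form in which the mass of the symmetric weight appears. *)
Lemma nu_constV l : 0 <= l ->
  (nu_const l)^-1 = Gamma (l + 2^-1) * Num.sqrt pi / Gamma (l + 1).
Proof.
move=> l0; rewrite /nu_const.
have h0 : 0 < l + 2^-1 by rewrite ltr_wpDl.
have := Gamma_duplication h0.
have -> : 2 * (l + 2^-1) = 2 * l + 1 by lra.
have -> : l + 2^-1 + 2^-1 = l + 1 by lra.
rewrite addrK => e.
have : Gamma (l + 1) != 0 by rewrite gt_eqF// Gamma_gt0// ltr_wpDl.
have : (2 : R) `^ (2 * l) != 0 by rewrite gt_eqF// powR_gt0.
have : Gamma (2 * l + 1) != 0 by rewrite gt_eqF// Gamma_gt0// ltr_wpDl// mulr_ge0.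
have : Num.sqrt pi != 0 :> R by rewrite gt_eqF// sqrtr_gt0 pi_gt0.
move: e; rewrite -[X in (_ / (X * _))^-1](@sqr_sqrtr R pi) ?pi_ge0//.
set v := Gamma (l + 2^-1); set w := Gamma (2 * l + 1); set u := Gamma (l + 1).
set s := Num.sqrt pi; set p := _ `^ _.
clearbody u v w s p => e s0 w0 p0 u0.
have -> : v = w * s / (p * u) by rewrite e; field; rewrite p0 ?u0.
by field; rewrite ?s0 ?w0 ?p0 ?u0.
Qed.

Lemma integral_wgt_nu l : 0 <= l ->
  (\int[mu]_x (wgt (l + 2^-1) (l + 2^-1) x)%:E)%E = (nu_const l)^-1%:E.
Proof.
move=> l0; have h0 : 0 < l + 2^-1 by lra.
rewrite (integral_wgt_sym h0) (nu_constV l0).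
by have -> : l + 2^-1 + 2^-1 = l + 1 by lra.
Qed.

Lemma integral_wgt_half l : 0 <= l ->
  (\int[mu]_x (wgt 2^-1 (l + 2^-1) x)%:E)%E = (2 `^ l / nu_const l)%:E.
Proof.
move=> l0; have h0 : 0 < l + 2^-1 by lra.
rewrite (integral_wgt _ h0)// Gamma_half (nu_constV l0); congr EFin.
have -> : 2^-1 + (l + 2^-1) = l + 1 by lra.
by rewrite addrK [Num.sqrt _ * _]mulrC.
Qed.

(** The constant of H is, up to a power of 2, the inverse of the mass of the measure (1 - s^2)^(l-1) ds over which generalised translations average. *)
Lemma H_const_integral l : 0 < l ->
  (\int[mu]_x (wgt l l x)%:E)%E = (2 `^ (- l) / H_const l)%:E.
Proof.
move=> l0; rewrite integral_wgt// /H_const; congr EFin.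
have -> : l + l = 2 * l by ring.
have g1 : Gamma l != 0 by rewrite gt_eqF// Gamma_gt0.
have g2 : Gamma (2 * l) != 0 by rewrite gt_eqF// Gamma_gt0// mulr_gt0.
have -> : 2 `^ (2 * l - 1) = 2 `^ (- l) * 2 `^ (3 * l - 1) :> R.
  by rewrite -gt0_powRD//; congr (_ `^ _); ring.
have : 2 `^ (3 * l - 1) != 0 :> R by rewrite gt_eqF// powR_gt0.
move: g1 g2; set u := Gamma l; set v := Gamma _; set p := _ `^ _; set q := _ `^ _.
clearbody u v p q => u0 v0 q0.
by field; rewrite ?u0 ?v0 ?q0.
Qed.

Lemma H_const_gt0 l : 0 < l -> 0 < H_const l.
Proof.
by move=> l0; rewrite divr_gt0 ?mulr_gt0 ?exprn_gt0 ?powR_gt0 ?Gamma_gt0 ?mulr_gt0.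
Qed.

Lemma nu_densityE l x : `|x| < 1 ->
  nu_density l x = nu_const l * wgt (l + 2^-1) (l + 2^-1) x.
Proof.
move=> x1; rewrite /nu_density /nu_const -ppow_wgt gt0_ppow; last first.
  by move: x1; rewrite ltr_norml => /andP[? ?]; nra.
rewrite indicE mem_set ?mulr1; last first.
  by move: x1; rewrite /= in_itv/= ltr_norml => /andP[/ltW -> /ltW ->].
by congr (_ * _ `^ _); lra.
Qed.

Lemma wgt_out a b x : 1 <= `|x| -> wgt a b x = 0 :> R.
Proof.
move=> x1; rewrite /wgt; have [x0|x0] := leP 0 x.
  by rewrite le0_ppow ?mul0r// -(ger0_norm x0); lra.
by rewrite [X in _ * X]le0_ppow ?mulr0//; rewrite ltr0_norm// in x1; lra.
Qed.

(** The endpoints are negligible, and inside the interval the density of nu is the weight: integrals against nu become integrals over the whole line. *)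
Lemma integral_nu l (f : R -> \bar R) :
  measurable_fun (`](-1), 1[%classic : set R) f ->
  (forall x, -1 <= x <= 1 -> (0 <= f x)%E) ->
  (\int[nu l]_(x in `[(-1)%R, 1%R]) f x)%E =
  (\int[mu]_x ((f \_ `](-1)%R, 1%R[%classic) x *
     (nu_const l * wgt (l + 2^-1) (l + 2^-1) x)%:E))%E.
Proof.
move=> mf f0.
have mfc : measurable_fun (`[(-1), 1]%classic : set R) f.
  exact/emeasurable_fun_itv_bndo_bndcP/emeasurable_fun_itv_obnd_cbndP.
(* Lebesgue measure and nu live on two presentations of the Borel line; the identity map carries one to the other. *)
pose h : measurableTypeR R -> R := id.
have mh : measurable_fun setT h by move=> _ Y mY; rewrite setTI.
pose mu' : measure R R := pushforward mu h.
have mu'E D (g : R -> \bar R) : measurable D -> measurable_fun D g ->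
    (forall x, D x -> 0 <= g x)%E ->
    (\int[mu' mh]_(x in D) g x = \int[mu]_(x in D) g x)%E.
  move=> mD mg g0; rewrite ge0_integral_pushforward//.
  by move=> x; rewrite inE; exact: g0.
have mdens D : measurable_fun D (EFin \o nu_density l).
  by apply/measurable_EFinP/measurable_funTS; exact: measurable_nu_density.
rewrite (@ge0_integral_density _ _ _ (mu' mh) (nu l) (nu_density l)); first last.
- by move=> x; rewrite /= in_itv/=; exact: f0.
- exact: mfc.
- exact: measurable_itv.
- by move=> A mA; rewrite mu'E// => x _; rewrite lee_fin nu_density_ge0.
- exact: measurable_nu_density.
- exact: nu_density_ge0.
rewrite mu'E//; last 2 first.
- exact: emeasurable_funM.
- by move=> x /=; rewrite in_itv/= => /f0 ?; rewrite mule_ge0 ?lee_fin ?nu_density_ge0.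
rewrite integral_itv_bndoo; last exact: emeasurable_funM.
rewrite integral_mkcond; apply: eq_integral => x _; rewrite !patchE.
case: ifPn => [|_]; last by rewrite mul0e.
rewrite inE/= in_itv/= -ltr_norml => x1.
by rewrite nu_densityE.
Qed.

End constants.

(** * Integrals of polynomials against Jacobi weights *)

Definition jint {R : realType} (a b : R) (p : {poly R}) : R :=
  \int[lebesgue_measure]_x (p.[x] * wgt a b x).

Section jint.
Context {R : realType}.
Local Notation mu := (@lebesgue_measure R).
Implicit Types (a b c x : R) (p q : {poly R}).

Lemma horner_bounded p : exists2 M, 0 <= M & forall x, `|x| <= 1 -> `|p.[x]| <= M.
Proof.
exists (\sum_(i < size p) `|p`_i|) => [|x x1]; first exact: sumr_ge0.
rewrite horner_coef (le_trans (ler_norm_sum _ _ _))//; apply: ler_sum => i _.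
by rewrite normrM normrX ler_piMr// exprn_ile1.
Qed.

Lemma measurable_horner p : measurable_fun setT (horner p).
Proof. by apply: continuous_measurable_fun => x; exact: continuous_horner. Qed.

Section fixed_weight.
Variables a b : R.
Hypotheses (a0 : 0 < a) (b0 : 0 < b).

Lemma integrable_wgt : mu.-integrable setT (EFin \o wgt a b).
Proof.
apply/integrableP; split; first by apply/measurable_EFinP; exact: measurable_wgt.
under eq_integral do rewrite /= ger0_norm//.
by rewrite integral_wgt// ltry.
Qed.

Lemma integrable_horner_wgt p :
  mu.-integrable setT (fun x => (p.[x] * wgt a b x)%:E).
Proof.
have [M M0 pM] := horner_bounded p.
apply: (le_integrable measurableT _ _ (integrableZl measurableT M integrable_wgt)).
- by apply/measurable_EFinP/measurable_funM;
    [exact: measurable_horner|exact: measurable_wgt].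
- move=> x _; rewrite -EFinM !abse_EFin lee_fin (normrM p.[x]) (normrM M) (ger0_norm (wgt_ge0 a b x)).
  have [x1|x1] := ltP `|x| 1; last by rewrite wgt_out// !mulr0.
  by rewrite ler_wpM2r// (ger0_norm M0) pM// ltW.
Qed.

Lemma EFin_jint p : (jint a b p)%:E = (\int[mu]_x (p.[x] * wgt a b x)%:E)%E.
Proof. by rewrite /jint /Rintegral fineK//; exact: integrable_fin_num (integrable_horner_wgt p). Qed.

Lemma jintD p q : jint a b (p + q) = jint a b p + jint a b q.
Proof.
rewrite /jint -RintegralD//; [|exact: integrable_horner_wgt..].
by apply: eq_Rintegral => x _; rewrite hornerD mulrDl.
Qed.

Lemma jintZ c p : jint a b (c *: p) = c * jint a b p.
Proof.
rewrite /jint -RintegralZl//; last exact: integrable_horner_wgt.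
by apply: eq_Rintegral => x _; rewrite hornerZ -mulrA.
Qed.

Lemma jint0 : jint a b 0 = 0.
Proof. by rewrite -(scale0r 0) jintZ mul0r. Qed.

Lemma jintN p : jint a b (- p) = - jint a b p.
Proof. by rewrite -scaleN1r jintZ mulN1r. Qed.

Lemma jintB p q : jint a b (p - q) = jint a b p - jint a b q.
Proof. by rewrite jintD jintN. Qed.

Lemma jint_sum (I : Type) (r : seq I) (P : pred I) (F : I -> {poly R}) :
  jint a b (\sum_(i <- r | P i) F i) = \sum_(i <- r | P i) jint a b (F i).
Proof. exact: (big_morph _ jintD jint0). Qed.

Lemma jint_ge0 p : (forall x, `|x| < 1 -> 0 <= p.[x]) -> 0 <= jint a b p.
Proof.
move=> p0; apply: Rintegral_ge0 => x _.
have [x1|x1] := ltP `|x| 1; last by rewrite wgt_out// mulr0.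
by rewrite mulr_ge0// p0.
Qed.

Lemma jint1 : jint a b 1 = 2 `^ (a + b - 1) * (Gamma a * Gamma b / Gamma (a + b)).
Proof.
apply: EFin_inj; rewrite EFin_jint -integral_wgt//.
by apply: eq_integral => x _; rewrite hornerC mul1r.
Qed.

End fixed_weight.

Lemma wgtS_l a b x : (1 - x) * wgt a b x = wgt (a + 1) b x.
Proof.
rewrite /wgt mulrA; congr (_ * _); have [x1|x1] := ltP 0 (1 - x); last first.
  by rewrite !le0_ppow// mulr0.
by rewrite addrAC [in RHS]ppowD mulrC ppow1// ltW.
Qed.

Lemma wgtS_r a b x : (1 + x) * wgt a b x = wgt a (b + 1) x.
Proof.
rewrite /wgt mulrCA; congr (_ * _); have [x1|x1] := ltP 0 (1 + x); last first.
  by rewrite !le0_ppow// mulr0.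
by rewrite addrAC [in RHS]ppowD mulrC ppow1// ltW.
Qed.

Lemma jintS_l a b p : jint a b ((1 - 'X) * p) = jint (a + 1) b p.
Proof.
apply: eq_Rintegral => x _.
by rewrite hornerM mulrAC hornerD hornerC hornerN hornerX wgtS_l mulrC.
Qed.

Lemma jintS_r a b p : jint a b ((1 + 'X) * p) = jint a (b + 1) p.
Proof.
apply: eq_Rintegral => x _.
by rewrite hornerM mulrAC hornerD hornerC hornerX wgtS_r mulrC.
Qed.

Lemma jintX_l a b k p : jint a b ((1 - 'X) ^+ k * p) = jint (a + k%:R) b p.
Proof.
elim: k a => [|k ih] a; first by rewrite expr0 mul1r addr0.
by rewrite exprS -mulrA jintS_l ih -addrA -natr1 [1 + _]addrC.
Qed.

Lemma jint_recursion a b : 0 < a -> 0 < b -> b * jint (a + 1) b 1 = a * jint a (b + 1) 1.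
Proof.
move=> a0 b0; have a10 : 0 < a + 1 by rewrite addr_gt0.
have b10 : 0 < b + 1 by rewrite addr_gt0.
rewrite (jint1 a10 b0) (jint1 a0 b10) (GammaS a0) (GammaS b0).
have -> : a + 1 + b = a + (b + 1) by ring.
move: (_ `^ _) (Gamma _) (Gamma _) (Gamma _) => p u v w; ring.
Qed.

(** The integral of the derivative of (1 - x)^a (1 + x)^b q(x), which vanishes at both ends. By linearity it suffices to take for q a power of 1 - X, and then the identity is the recursion of the Beta function. *)
Lemma jint_by_parts a b q : 0 < a -> 0 < b ->
  jint a b ((1 - 'X ^+ 2) * q^`() + (b *: (1 - 'X) - a *: (1 + 'X)) * q) = 0.
Proof.
move=> a0 b0.
have pow k : jint a b ((1 - 'X ^+ 2) * ((1 - 'X) ^+ k)^`()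
    + (b *: (1 - 'X) - a *: (1 + 'X)) * (1 - 'X) ^+ k) = 0.
  have -> : (1 - 'X ^+ 2) * ((1 - 'X) ^+ k)^`()
    + (b *: (1 - 'X) - a *: (1 + 'X)) * (1 - 'X) ^+ k =
    b *: ((1 - 'X) ^+ k * ((1 - 'X) * 1)) - (a + k%:R) *: ((1 - 'X) ^+ k * ((1 + 'X) * 1)) :> {poly R}.
    rewrite deriv_exp derivB derivC derivX sub0r.
    rewrite -!mul_polyC polyCD polyC_natr.
    case: k => [|k]; first by rewrite mulr0n expr0; ring.
    rewrite -mulr_natl !(exprS (1 - 'X)) /=; set u := _ ^+ k; set v := k.+1%:R; ring.
  rewrite jintB// !jintZ// !jintX_l jintS_l jintS_r.
  by rewrite jint_recursion ?subrr// ltr_wpDr.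
have -> : q = \sum_(i < size (q \Po (1 - 'X))) (q \Po (1 - 'X))`_i *: (1 - 'X) ^+ i.
  rewrite -comp_polyE -comp_polyA comp_polyB comp_polyC comp_polyX.
  by rewrite opprB addrC subrK comp_polyXr.
rewrite (raddf_sum (@deriv R)) !mulr_sumr -big_split jint_sum// big1// => i _ /=.
by rewrite derivZ -!scalerAr -scalerDr jintZ// pow mulr0.
Qed.

End jint.

(** * Gegenbauer polynomials *)

(** Gegenbauer polynomials through their three-term recurrence, two consecutive ones at a time. With the value 1 at 1 the case l = 0 is that of the Chebyshev polynomials, whereas the classical normalisation degenerates there. *)
Fixpoint gegenbauer_pair {R : realType} (l : R) (n : nat) : {poly R} * {poly R} :=
  if n isn't m.+1 then (1, 'X) else
  let pq := gegenbauer_pair l m in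
  (pq.2, (m.+1%:R + 2 * l)^-1 *:
    ((2 * (m.+1%:R + l)) *: ('X * pq.2) - m.+1%:R *: pq.1)).

Definition gegenbauer {R : realType} (l : R) (n : nat) : {poly R} :=
  (gegenbauer_pair l n).1.

(** The generator whose Dirichlet form is the integral of (1 - x^2) p'(x)^2 against nu. *)
Definition gegenbauer_op {R : realType} (l : R) (p : {poly R}) : {poly R} :=
  (1 - 'X ^+ 2) * p^`()^`() - (2 * l + 1) *: ('X * p^`()).

Section gegenbauer.
Context {R : realType}.
Variable l : R.
Hypothesis l0 : 0 <= l.
Implicit Types (n m : nat) (p q f g : {poly R}).
Local Notation C n := (gegenbauer l n).

Let den_gt0 n : 0 < n.+1%:R + 2 * l.
Proof. by rewrite ltr_pwDl// mulr_ge0. Qed.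

Lemma gegenbauerS n : (n.+1%:R + 2 * l) *: C n.+2 =
  (2 * (n.+1%:R + l)) *: ('X * C n.+1) - n.+1%:R *: C n.
Proof.
by rewrite /gegenbauer /= scalerA divff ?scale1r// gt_eqF.
Qed.

Let gegenbauerSP n : (n.+1%:R + 2 * l%:P) * C n.+2 =
  2 * (n.+1%:R + l%:P) * ('X * C n.+1) - n.+1%:R * C n.
Proof.
by have := gegenbauerS n; rewrite -!mul_polyC !(polyCD, polyCM) !polyC_natr.
Qed.

Let Pden_neq0 n : n.+1%:R + 2 * l%:P != 0 :> {poly R}.
Proof.
by rewrite -(polyC_natr R 2) -(polyC_natr R n.+1) -polyCM -polyCD polyC_eq0 gt_eqF.
Qed.

Let nat_pred n : n.+1%:R = n%:R + 1 :> {poly R}.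
Proof. by rewrite natr1. Qed.

Let gegenbauer_rec_deriv n p q f :
  (n.+1%:R + 2 * l) *: p = (2 * (n.+1%:R + l)) *: ('X * q) - n.+1%:R *: f ->
  (n.+1%:R + 2 * l%:P) * p^`() =
  2 * (n.+1%:R + l%:P) * (q + 'X * q^`()) - n.+1%:R * f^`().
Proof.
move=> /(congr1 (@deriv R)).
rewrite derivZ derivB !derivZ derivM derivX mul1r -!mul_polyC !(polyCD, polyCM).
by rewrite !polyC_natr.
Qed.

(** Each relation at n + 1 follows from both at n by differentiating the recurrence, hence the joint induction. *)
Lemma gegenbauer_deriv n :
  (1 - 'X ^+ 2) * (C n)^`() = (n%:R + 2 * l%:P) * ('X * C n - C n.+1) /\
  (1 - 'X ^+ 2) * (C n.+1)^`() = n.+1%:R * (C n - 'X * C n.+1).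
Proof.
elim: n => [|n [ih1 ih2]].
  rewrite /gegenbauer /= derivX derivC; split; ring.
have e1 : (1 - 'X ^+ 2) * (C n.+1)^`() =
    (n.+1%:R + 2 * l%:P) * ('X * C n.+1 - C n.+2).
  by rewrite mulrBr gegenbauerSP ih2; ring.
split => //; apply: (mulfI (Pden_neq0 n)).
have -> : (n.+1%:R + 2 * l%:P) * ((1 - 'X^2) * (C n.+2)^`()) =
  2 * (n.+1%:R + l%:P) * ((1 - 'X^2) * C n.+1 + 'X * ((1 - 'X^2) * (C n.+1)^`()))
  - n.+1%:R * ((1 - 'X^2) * (C n)^`()).
  by rewrite mulrCA (gegenbauer_rec_deriv (gegenbauerS n)); ring.
rewrite ih1 ih2.
have -> : (n.+1%:R + 2 * l%:P) * (n.+2%:R * (C n.+1 - 'X * C n.+2)) =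
  n.+2%:R * ((n.+1%:R + 2 * l%:P) * C n.+1 -
     'X * ((n.+1%:R + 2 * l%:P) * C n.+2)) by ring.
rewrite gegenbauerSP !nat_pred; ring.
Qed.

Let gegenbauer_lower_deriv n p q :
  (1 - 'X ^+ 2) * p^`() = n%:R * (q - 'X * p) ->
  (1 - 'X ^+ 2) * p^`()^`() =
  2 * 'X * p^`() + n%:R * (q^`() - (p + 'X * p^`())).
Proof.
have dX2 : (1 - 'X ^+ 2 : {poly R})^`() = - ('X *+ 2).
  by rewrite derivB derivXn derivC sub0r expr1.
move=> /(congr1 (@deriv R)); rewrite -polyC_natr (derivM (1 - 'X ^+ 2)) dX2.
rewrite (derivM n%:R%:P) derivC derivB derivM derivX polyC_natr => e.
have -> : (1 - 'X ^+ 2) * p^`()^`() =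
   (- ('X *+ 2) * p^`() + (1 - 'X ^+ 2) * p^`()^`()) + 2 * 'X * p^`() by ring.
by rewrite e; ring.
Qed.

(** Differentiate the second relation of [gegenbauer_deriv] and eliminate the lower polynomial by the first; the identity holds after multiplication by 1 - X^2. *)
Lemma gegenbauer_eigen n : gegenbauer_op l (C n) = - (n%:R * (n%:R + 2 * l)) *: C n.
Proof.
case: n => [|n].
  rewrite mulr0n mul0r oppr0 scale0r /gegenbauer_op /gegenbauer /=.
  by rewrite derivC deriv0 !mulr0 scaler0 subr0.
have [e1 _] := gegenbauer_deriv n; have [_ e2] := gegenbauer_deriv n.
have X2 : 1 - 'X^2 != 0 :> {poly R}.
  by rewrite -oppr_eq0 opprB -size_poly_eq0 size_XnsubC.
apply: (mulfI X2).
have e3 : (1 - 'X^2) * ((1 - 'X^2) * (C n.+1)^`()^`()) =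
   2 * 'X * ((1 - 'X^2) * (C n.+1)^`()) +
   n.+1%:R * ((1 - 'X^2) * (C n)^`() - (1 - 'X^2) * C n.+1 - 'X * ((1 - 'X^2) * (C n.+1)^`())).
  by rewrite (gegenbauer_lower_deriv e2); ring.
rewrite /gegenbauer_op mulrBr e3 -!mul_polyC.
rewrite !(polyCD, polyCM, polyCN, polyC_natr).
have -> : (1 - 'X^2) * ((2 * l%:P + 1) * ('X * (C n.+1)^`())) =
   (2 * l%:P + 1) * 'X * ((1 - 'X^2) * (C n.+1)^`()) by ring.
rewrite e1 e2 !nat_pred; ring.
Qed.

Lemma gegenbauer_at1 n : (C n).[1] = 1.
Proof.
suff : (C n).[1] = 1 /\ (C n.+1).[1] = 1 by case.
elim: n => [|n [ih1 ih2]]; first by rewrite /gegenbauer /= hornerC hornerX.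
split => //; apply: (mulfI (lt0r_neq0 (den_gt0 n))).
rewrite -hornerZ gegenbauerS hornerD hornerN !hornerZ hornerM hornerX ih1 ih2; ring.
Qed.

Lemma size_gegenbauer n : size (C n) = n.+1.
Proof.
suff : size (C n) = n.+1 /\ size (C n.+1) = n.+2 by case.
elim: n => [|n [ih1 ih2]]; first by rewrite /gegenbauer /= size_poly1 size_polyX.
split => //.
rewrite -(@size_scale _ (n.+1%:R + 2 * l)) ?gt_eqF// gegenbauerS.
have c0 : 2 * (n.+1%:R + l) != 0 by rewrite gt_eqF// mulr_gt0// ltr_pwDl.
have s2 : size ((2 * (n.+1%:R + l)) *: ('X * C n.+1)) = n.+3.
  rewrite size_scale// mulrC size_mulX ?ih2//.
  by rewrite -size_poly_eq0 ih2.
by rewrite size_polyDl// s2 size_polyN size_scale ?ih1 ?pnatr_eq0.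
Qed.

Lemma gegenbauer_expansion n p : (size p <= n)%N ->
  exists c : nat -> R, p = \sum_(i < n) c i *: C i.
Proof.
elim: n p => [|n ih] p.
  by rewrite leqn0 size_poly_eq0 => /eqP ->; exists (fun=> 0); rewrite big_ord0.
move=> sp; pose c := p`_n / lead_coef (C n).
have C0 : lead_coef (C n) != 0 by rewrite lead_coef_eq0 -size_poly_eq0 size_gegenbauer.
have [|d dE] := ih (p - c *: C n).
  apply/leq_sizeP => j; rewrite leq_eqVlt => /predU1P[<-|nj].
    rewrite coefB coefZ /c lead_coefE size_gegenbauer/= mulfVK ?subrr//.
    by move: C0; rewrite lead_coefE size_gegenbauer.
  by rewrite coefB coefZ !nth_default ?mulr0 ?subrr// ?size_gegenbauer// (leq_trans sp).
exists (fun i => if (i < n)%N then d i else c).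
rewrite big_ord_recr/= ltnn -[LHS](subrK (c *: C n)) dE; congr (_ + _).
by apply: eq_bigr => i _; rewrite ltn_ord.
Qed.

Local Notation h := (l + 2^-1).
Let h0 : 0 < h. Proof. by rewrite ltr_wpDl. Qed.

Let double_h : 2 * l + 1 = 2 * h.
Proof. by rewrite mulrDr mulfV. Qed.

(** By parts, for the polynomial f' g; the right-hand side is symmetric in f and g, whence the orthogonality of eigenvectors. *)
Lemma jint_gegenbauer_op f g :
  jint h h (g * gegenbauer_op l f) = - jint h h ((1 - 'X ^+ 2) * f^`() * g^`()).
Proof.
apply/eqP; rewrite -addr_eq0 -(jintD h0 h0); apply/eqP.
rewrite -[RHS](jint_by_parts (f^`() * g) h0 h0); congr jint.
rewrite /gegenbauer_op derivM double_h; move: h => k.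
by rewrite -!mul_polyC polyCM polyC_natr; ring.
Qed.

Lemma dirichlet_gegenbauer n p :
  jint h h ((1 - 'X ^+ 2) * (C n)^`() * p^`()) =
  n%:R * (n%:R + 2 * l) * jint h h (C n * p).
Proof.
apply: oppr_inj; rewrite -jint_gegenbauer_op gegenbauer_eigen.
by rewrite -scalerAr (jintZ h0 h0) mulNr [p * _]mulrC.
Qed.

(** The eigenvalues n (n + 2 l) are distinct since l >= 0. *)
Lemma gegenbauer_orthogonal n m : n != m -> jint h h (C n * C m) = 0.
Proof.
move=> nm; have := dirichlet_gegenbauer n (C m).
rewrite mulrAC dirichlet_gegenbauer [C m * _]mulrC => /eqP.
rewrite -subr_eq0 -mulrBl mulf_eq0 => /orP[|/eqP//]; rewrite subr_eq0.
wlog nm' : n m {nm} / (n < m)%N.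
  move=> H; move: nm; rewrite neq_ltn => /orP[nm|mn]; first exact: H.
  by rewrite eq_sym [C n * _]mulrC; exact: H.
have nmR : n%:R < m%:R :> R by rewrite ltr_nat.
have n0 : 0 <= n%:R :> R by [].
move=> /eqP e; exfalso.
have : 0 < (m%:R - n%:R) * (m%:R + n%:R + 2 * l).
  apply: mulr_gt0; first by rewrite subr_gt0.
  by rewrite ltr_pwDl ?mulr_ge0// ltr_pwDl// (le_lt_trans n0).
have -> : (m%:R - n%:R) * (m%:R + n%:R + 2 * l) =
  m%:R * (m%:R + 2 * l) - n%:R * (n%:R + 2 * l) by ring.
by rewrite e subrr ltxx.
Qed.

Lemma gegenbauer_norm_ge0 n : 0 <= jint h h (C n * C n).
Proof. by apply: jint_ge0 => x _; rewrite hornerM -expr2 sqr_ge0. Qed.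

Lemma jint_gegenbauer_sum k m (c : nat -> R) :
  jint h h (C k * \sum_(i < m) c i *: C i) =
  if (k < m)%N then c k * jint h h (C k * C k) else 0.
Proof.
rewrite mulr_sumr (jint_sum h0 h0); case: ifPn => [km|].
  rewrite (bigD1 (Ordinal km))//= big1 ?addr0 => [|i ik].
    by rewrite -scalerAr (jintZ h0 h0).
  by rewrite -scalerAr (jintZ h0 h0) gegenbauer_orthogonal ?mulr0 1?eq_sym.
rewrite -leqNgt => mk; rewrite big1// => i _.
rewrite -scalerAr (jintZ h0 h0) gegenbauer_orthogonal ?mulr0//.
by rewrite gtn_eqF// (leq_trans (ltn_ord i)).
Qed.

(** Multiplication by X is symmetric: expanding X C_(n+1) C_(n+2) by the recurrence in either factor relates consecutive norms. *)
Lemma gegenbauer_norm_gt0 n : 0 < jint h h (C n * C n).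
Proof.
have hpos k : 0 < 2 * (k.+1%:R + l) by rewrite mulr_gt0// ltr_pwDl.
have eX k : 'X * C k.+1 = (2 * (k.+1%:R + l))^-1 *:
    ((k.+1%:R + 2 * l) *: C k.+2 + k.+1%:R *: C k).
  by rewrite gegenbauerS subrK scalerA mulVf ?scale1r// gt_eqF.
have C0 : C 0 = 1 by [].
have C1 : C 1 = 'X by [].
have X_l k i : jint h h (('X * C k.+1) * C i) = (2 * (k.+1%:R + l))^-1 *
    ((k.+1%:R + 2 * l) * jint h h (C k.+2 * C i) + k.+1%:R * jint h h (C k * C i)).
  by rewrite eX -scalerAl (jintZ h0 h0) [(_ + _) * C i]mulrDl (jintD h0 h0) -!scalerAl !(jintZ h0 h0).
suff : 0 < jint h h (C n * C n) /\ 0 < jint h h (C n.+1 * C n.+1) by case.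
elim: n => [|n [ih1 ih2]].
  have p0 : 0 < jint h h (C 0 * C 0).
    rewrite C0 mulr1 (jint1 h0 h0); apply: mulr_gt0; first exact: powR_gt0.
    apply: divr_gt0; first by apply: mulr_gt0; exact: Gamma_gt0.
    by apply: Gamma_gt0; exact: addr_gt0.
  split => //.
  have -> : C 1 * C 1 = ('X * C 1) * C 0 by rewrite {1}C1 C0 mulr1.
  rewrite X_l gegenbauer_orthogonal// mulr0 add0r.
  by rewrite mulr_gt0 ?invr_gt0// mulr_gt0.
split => //.
have := X_l n n.+2; rewrite (@gegenbauer_orthogonal n n.+2) ?mulr0 ?addr0; last first.
  by rewrite ltn_eqF// ltnW.
have -> : 'X * C n.+1 * C n.+2 = ('X * C n.+2) * C n.+1 by ring.
rewrite X_l (@gegenbauer_orthogonal n.+3 n.+1) ?mulr0 ?add0r; last first.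
  by rewrite gtn_eqF// ltnW.
move=> e; have : 0 < (2 * (n.+1%:R + l))^-1 * ((n.+1%:R + 2 * l) * jint h h (C n.+2 * C n.+2)).
  by rewrite -e mulr_gt0 ?invr_gt0// mulr_gt0.
by rewrite pmulr_rgt0 ?invr_gt0// pmulr_rgt0.
Qed.

(** * A functional linear in the degree *)

Definition slope1 p : {poly R} := (p.[1]%:P - p) %/ (1 - 'X).

Let X1 : 1 - 'X != 0 :> {poly R}.
Proof. by rewrite -oppr_eq0 opprB polyXsubC_eq0. Qed.

Lemma slope1E p : slope1 p * (1 - 'X) = p.[1]%:P - p.
Proof.
rewrite divpK// -dvdpNl opprB -[1]/(1%:P) dvdp_XsubCl /root.
by rewrite hornerD hornerN hornerC subrr.
Qed.

Lemma slope1_unique p q : q * (1 - 'X) = p.[1]%:P - p -> slope1 p = q.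
Proof. by move=> e; apply: (mulIf X1); rewrite slope1E. Qed.

(** The integral of (p(1) - p(z)) (1 - z)^(-3/2) (1 + z)^(l - 1/2): the exponent -3/2 is integrable only because of the subtraction. *)
Definition slope_int p : R := jint 2^-1 h (slope1 p).

Let half0 : 0 < 2^-1 :> R. Proof. by []. Qed.

Lemma slope_intD p q : slope_int (p + q) = slope_int p + slope_int q.
Proof.
rewrite /slope_int -(jintD half0 h0); congr jint; apply: slope1_unique.
by rewrite mulrDl !slope1E hornerD polyCD; ring.
Qed.

Lemma slope_intZ c p : slope_int (c *: p) = c * slope_int p.
Proof.
rewrite /slope_int -(jintZ half0 h0); congr jint; apply: slope1_unique.
by rewrite -scalerAl slope1E hornerZ scalerBr polyCM mul_polyC.
Qed.

Lemma slope_int_factor p : slope_int ((1 - 'X) * p) = - jint 2^-1 h p.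
Proof.
rewrite /slope_int -(jintN half0 h0); congr jint; apply: slope1_unique.
by rewrite hornerM !hornerE subrr mul0r sub0r mulNr mulrC.
Qed.

(** By parts for the exponents -1/2 and l - 1/2, for which the operator is not self-adjoint: the left-hand side is the defect. *)
Lemma slope_int_op p :
  l * slope_int ((1 - 'X ^+ 2) * p^`()) = - slope_int ((1 - 'X) * gegenbauer_op l p).
Proof.
have -> : (1 - 'X ^+ 2) * p^`() = (1 - 'X) * ((1 + 'X) * p^`()) by ring.
rewrite !slope_int_factor opprK mulrN -(jintZ half0 h0) -(jintN half0 h0).
apply/eqP; rewrite eq_sym -subr_eq0 -(jintB half0 h0); apply/eqP.
rewrite -[RHS](jint_by_parts p^`() half0 h0); congr jint.
rewrite /gegenbauer_op double_h; have -> : l *: ((1 + 'X) * p^`()) =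
  (h - 2^-1) *: ((1 + 'X) * p^`()) by rewrite addrK.
move: h 2^-1 => k c.
by rewrite -!mul_polyC polyCB polyCM polyC_natr; ring.
Qed.

(** The recurrences turn [slope_int_op] into a relation between three consecutive values, namely the vanishing of their second difference. *)
Let slope_int_step n p q f J (N := n.+1%:R : R) :
  2 * (N + l) != 0 -> N + 2 * l != 0 -> N != 0 ->
  'X * q = (2 * (N + l))^-1 *: ((N + 2 * l) *: f + N *: p) ->
  slope_int p = n%:R * J -> slope_int q = n.+1%:R * J ->
  l * slope_int (n.+1%:R * (p - 'X * q)) =
    - slope_int ((1 - 'X) * (- (N * (N + 2 * l)) *: q)) ->
  slope_int f = n.+2%:R * J.
Proof.
move=> d0 d1 d2 eX eP eQ.
have eN c r : slope_int (c *: r) = c * slope_int r by exact: slope_intZ.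
have eD r s : slope_int (r + s) = slope_int r + slope_int s by exact: slope_intD.
have eB r s : slope_int (r - s) = slope_int r - slope_int s.
  by rewrite eD -scaleN1r eN mulN1r.
rewrite -(polyC_natr R n.+1) (mul_polyC n.+1%:R) eN -(scalerAr _ (1 - 'X) q) eN mulrBl mul1r !eB eX eN eD !eN eP eQ.
have -> : n%:R = N - 1 by rewrite /N -natr1 addrK.
have -> : n.+2%:R = N + 1 by rewrite /N natr1.
rewrite -/N; move: (slope_int f) => b.
clearbody N => e; apply/eqP; rewrite -subr_eq0.
have d3 : N + l != 0 by move: d0; rewrite mulf_eq0 negb_or => /andP[].
have : N * (N + 2 * l) * (N + l) * (b - (N + 1) * J) = 0.
  move: e => /eqP; rewrite -subr_eq0 => /eqP/(congr1 (fun t => 2 * (N + l) * t)).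
  rewrite mulr0 => <-; field.
  by rewrite d3.
by move/eqP; rewrite !mulf_eq0 (negbTE d2) (negbTE d1) (negbTE d3).
Qed.

Lemma slope_int_gegenbauer n : slope_int (C n) = n%:R * jint 2^-1 h 1.
Proof.
suff : slope_int (C n) = n%:R * jint 2^-1 h 1 /\
       slope_int (C n.+1) = n.+1%:R * jint 2^-1 h 1 by case.
elim: n => [|n [ih1 ih2]].
  rewrite /slope_int (@slope1_unique (C 0) 0) ?(@slope1_unique (C 1) 1).
  + by rewrite mul0r (jint0 half0 h0) mul1r.
  + by rewrite /gegenbauer/= hornerX mul1r.
  + by rewrite /gegenbauer/= hornerC mul0r subrr.
split => //.
have := slope_int_op (C n.+1); rewrite gegenbauer_eigen.
have [_ ->] := gegenbauer_deriv n.
have d0 : 2 * (n.+1%:R + l) != 0 by rewrite gt_eqF// mulr_gt0// ltr_pwDl.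
have eX : 'X * C n.+1 = (2 * (n.+1%:R + l))^-1 *:
    ((n.+1%:R + 2 * l) *: C n.+2 + n.+1%:R *: C n).
  by rewrite gegenbauerS subrK scalerA mulVf ?scale1r.
have d1 := lt0r_neq0 (den_gt0 n).
have d2 : n.+1%:R != 0 :> R by rewrite pnatr_eq0.
exact: (slope_int_step d0 d1 d2 eX ih1 ih2).
Qed.

End gegenbauer.

(** * The kernel of the product formula *)

(** The factors ppow 0 are indicators: the kernel is carried by the triples in the cube that are the mutual inner products of three independent unit vectors. *)
Definition kern {R : realType} (l x y z : R) : R :=
  ppow 0 (1 - x ^+ 2) * ppow 0 (1 - y ^+ 2) * ppow 0 (1 - z ^+ 2) *
  ppow (l - 1) (1 - x ^+ 2 - y ^+ 2 - z ^+ 2 + 2 * x * y * z).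

Section kern.
Context {R : realType}.
Local Notation mu := (@lebesgue_measure R).
Implicit Types (l x y z : R) (p q u v : {poly R}).

Lemma kernC12 l x y z : kern l x y z = kern l y x z.
Proof.
rewrite /kern; have -> : 1 - x ^+ 2 - y ^+ 2 - z ^+ 2 + 2 * x * y * z =
  1 - y ^+ 2 - x ^+ 2 - z ^+ 2 + 2 * y * x * z by ring.
by rewrite [ppow 0 (1 - x ^+ 2) * _]mulrC.
Qed.

Lemma kernC23 l x y z : kern l x y z = kern l x z y.
Proof.
rewrite /kern; have -> : 1 - x ^+ 2 - y ^+ 2 - z ^+ 2 + 2 * x * y * z =
  1 - x ^+ 2 - z ^+ 2 - y ^+ 2 + 2 * x * z * y by ring.
by rewrite [_ * _ * ppow 0 (1 - z ^+ 2)]mulrAC.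
Qed.

Lemma kern_ge0 l x y z : 0 <= kern l x y z.
Proof. by rewrite !mulr_ge0. Qed.

Lemma sqr_lt1 x : (0 < 1 - x ^+ 2) = (`|x| < 1).
Proof. by rewrite subr_gt0 -real_normK ?num_real// expr_lt1. Qed.

Lemma kern_out l x y z : 1 <= `|x| -> kern l x y z = 0.
Proof.
by move=> x1; rewrite /kern [ppow 0 (1 - x ^+ 2)]le0_ppow ?mul0r// leNgt sqr_lt1 -leNgt.
Qed.

Lemma measurable_kern l d (T : measurableType d) (f g h : T -> R) :
  measurable_fun setT f -> measurable_fun setT g -> measurable_fun setT h ->
  measurable_fun setT (fun t => kern l (f t) (g t) (h t)).
Proof. by move=> mf mg mh; rewrite /kern; mfun. Qed.

(** If two variables are in ]-1, 1[ and the Gram determinant is positive, then the third variable is in ]-1, 1[. *)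
Lemma kernE l x y z : `|x| < 1 -> `|z| < 1 ->
  kern l x y z = ppow (l - 1) ((1 - x ^+ 2) * (1 - z ^+ 2) - (y - x * z) ^+ 2).
Proof.
rewrite -!sqr_lt1 => x1 z1; rewrite /kern.
have -> : 1 - x ^+ 2 - y ^+ 2 - z ^+ 2 + 2 * x * y * z =
  (1 - x ^+ 2) * (1 - z ^+ 2) - (y - x * z) ^+ 2 by ring.
set D := _ - (y - _) ^+ 2; have [D0|D0] := ltP 0 D; last by rewrite (le0_ppow _ D0) mulr0.
have y1 : 0 < 1 - y ^+ 2.
  rewrite -(pmulr_rgt0 _ x1); apply: (lt_le_trans D0).
  have -> : D = (1 - x ^+ 2) * (1 - y ^+ 2) - (z - x * y) ^+ 2 by rewrite /D; ring.
  by rewrite gerBl sqr_ge0.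
by rewrite !(@gt0_ppow _ 0)// !powRr0 !mul1r.
Qed.

Lemma wgt_half l x : `|x| < 1 ->
  wgt (l + 2^-1) (l + 2^-1) x = (1 - x ^+ 2) `^ (l - 2^-1).
Proof.
by rewrite -sqr_lt1 => x1; rewrite -ppow_wgt gt0_ppow//; congr (_ `^ _); lra.
Qed.

(** Substituting y = x z + sqrt((1 - x^2) (1 - z^2)) s turns the Gram determinant into the product of 1 - x^2, 1 - z^2 and 1 - s^2. *)
Lemma integral_kern l x z (g : R -> R) : `|x| < 1 -> `|z| < 1 ->
  measurable_fun setT g -> (forall y, `|y| < 1 -> 0 <= g y) ->
  (\int[mu]_y (kern l x y z * g y)%:E)%E =
  (\int[mu]_s ((wgt (l + 2^-1) (l + 2^-1) x * wgt (l + 2^-1) (l + 2^-1) z) *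
     (wgt l l s * g (x * z + Num.sqrt ((1 - x ^+ 2) * (1 - z ^+ 2)) * s)))%:E)%E.
Proof.
move=> x1 z1 mg g0; rewrite !wgt_half//.
set w := (1 - x ^+ 2) * (1 - z ^+ 2); set r := Num.sqrt w.
have w0 : 0 < w by rewrite mulr_gt0// sqr_lt1.
have r0 : 0 < r by rewrite sqrtr_gt0.
have F0 y : 0 <= kern l x y z * g y.
  have [y1|y1] := ltP `|y| 1; first by rewrite mulr_ge0 ?kern_ge0// g0.
  by rewrite kernC12 kern_out// mul0r.
have mF : measurable_fun setT (fun y => kern l x y z * g y).
  apply: measurable_funM => //.
  by apply: measurable_kern; [exact: measurable_cst|exact: measurable_id|exact: measurable_cst].
rewrite (@ge0_integral_affine_fin _ _ r (x * z) (lt0r_neq0 r0) mF F0).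
apply: eq_integral => s _; congr EFin.
rewrite kernE// gtr0_norm// addrK exprMn sqr_sqrtr ?ltW// -/w.
have -> : w - w * s ^+ 2 = w * (1 - s ^+ 2) by ring.
rewrite ppowM// ppow_wgt [r * s + _]addrC.
have -> : (1 - x ^+ 2) `^ (l - 2^-1) * (1 - z ^+ 2) `^ (l - 2^-1) = r * w `^ (l - 1).
  rewrite -powRM ?ltW ?sqr_lt1// -/w /r -powR12_sqrt ?ltW// -gt0_powRD//.
  by congr (_ `^ _); lra.
ring.
Qed.

End kern.

(** * Generalised translation *)

Section translation.
Context {R : realType}.
Local Notation mu := (@lebesgue_measure R).
Variable l : R.
Hypothesis l0 : 0 < l.
Implicit Types (x y z : R) (p q u v : {poly R}).

Let l0' : 0 <= l. Proof. exact: ltW. Qed.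

Lemma jint_odd n : jint l l 'X^(n.*2.+1) = 0.
Proof.
elim: n => [|n ih].
  have := jint_by_parts 1 l0 l0; rewrite derivC mulr0 add0r mulr1.
  have -> : l *: (1 - 'X) - l *: (1 + 'X) = - (2 * l) *: 'X :> {poly R}.
    by rewrite -!mul_polyC polyCN polyCM polyC_natr; ring.
  rewrite jintZ// expr1 => /eqP; rewrite mulf_eq0 oppr_eq0 mulf_eq0 => /orP[|/eqP//].
  by rewrite pnatr_eq0/= gt_eqF.
have := jint_by_parts 'X^(n.*2.+2) l0 l0.
have -> : (1 - 'X ^+ 2) * ('X^(n.*2.+2))^`() + (l *: (1 - 'X) - l *: (1 + 'X)) * 'X^(n.*2.+2) =
  n.*2.+2%:R *: 'X^(n.*2.+1) - (n.*2.+2%:R + 2 * l) *: 'X^(n.+1.*2.+1) :> {poly R}.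
  rewrite derivXn /= -scaler_nat -!mul_polyC; set c := n.*2.+2%:R.
  rewrite (polyCD c) polyCM polyC_natr doubleS !(exprS 'X); ring.
rewrite jintB// !jintZ// ih mulr0 sub0r => /eqP.
rewrite oppr_eq0 mulf_eq0 => /orP[|/eqP//].
by rewrite gt_eqF// ltr_wpDl// mulr_gt0.
Qed.

(** The average of (x z + r s)^k for the weight (1 - s^2)^(l-1), with r^2 = (1 - x^2) (1 - z^2), as a polynomial in x: odd powers of s average to 0, so that r enters only through its square. *)
Definition translationXn z k : {poly R} :=
  \sum_(j < k.+1 | ~~ odd j) ('C(k, j)%:R * jint l l 'X^j) *:
    ((z *: 'X) ^+ (k - j) * ((1 - z ^+ 2) *: (1 - 'X ^+ 2)) ^+ j./2).

Definition translation z q : {poly R} :=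
  \sum_(k < size q) q`_k *: translationXn z k.

Lemma translation_widen n z q : (size q <= n)%N ->
  translation z q = \sum_(k < n) q`_k *: translationXn z k.
Proof.
move=> qn; rewrite /translation (big_ord_widen n (fun k => q`_k *: translationXn z k))//.
rewrite [RHS](bigID (fun k : 'I_n => k < size q)%N)/= -[LHS]addr0; congr (_ + _).
apply/esym/big1 => k; rewrite -leqNgt => qk.
by rewrite nth_default// scale0r.
Qed.

Lemma translationD z p q : translation z (p + q) = translation z p + translation z q.
Proof.
rewrite !(@translation_widen (maxn (size p) (size q))) ?leq_maxl ?leq_maxr ?size_polyD//.
by rewrite -big_split; apply: eq_bigr => k _; rewrite coefD scalerDl.
Qed.

Lemma size_translation z q : (size (translation z q) <= size q)%N.
Proof.
apply: (leq_trans (size_sum _ _ _)); apply/bigmax_leqP => k _.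
apply: (leq_trans (size_scale_leq _ _)).
apply: (leq_trans (size_sum _ _ _)); apply/bigmax_leqP => j /negPf j_even.
apply: (leq_trans (size_scale_leq _ _)).
apply: (leq_trans (size_polyMleq _ _)).
have s1 : (size ((z *: 'X : {poly R}) ^+ (k - j)) <= (k - j).+1)%N.
  rewrite exprZn; apply: (leq_trans (size_scale_leq _ _)); by rewrite size_polyXn.
have s3 : size (1 - 'X ^+ 2 : {poly R}) = 3 by rewrite -size_polyN opprB size_XnsubC.
have s2 : (size (((1 - z ^+ 2) *: (1 - 'X ^+ 2 : {poly R})) ^+ j./2) <= (j./2 * 2).+1)%N.
  rewrite exprZn; apply: (leq_trans (size_scale_leq _ _)).
  apply: (leq_trans (size_poly_exp_leq _ _)); rewrite ltnS mulnC leq_mul2l.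
  by rewrite s3 orbT.
have ej : (j./2 * 2)%N = j by rewrite muln2 -[RHS]odd_double_half j_even.
have jk : (j <= k)%N by rewrite -ltnS.
rewrite ej in s2; apply: leq_trans (ltn_ord k).
rewrite -subn1 leq_subLR; apply: (leq_trans (leq_add s1 s2)).
by rewrite addSn addnS subnK.
Qed.

Lemma horner_translation z q x r : r ^+ 2 = (1 - x ^+ 2) * (1 - z ^+ 2) ->
  (translation z q).[x] = jint l l (q \Po ((x * z)%:P + r *: 'X)).
Proof.
move=> r2; rewrite comp_polyE (jint_sum l0 l0) /translation horner_sum.
apply: eq_bigr => k _; rewrite hornerZ (jintZ l0 l0); congr (_ * _).
have mono j : (x * z)%:P ^+ (k - j) * (r *: 'X) ^+ j *+ 'C(k, j) =
    ('C(k, j)%:R * ((x * z) ^+ (k - j) * r ^+ j)) *: 'X^j.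
  by rewrite -polyC_exp (exprZn r 'X) mul_polyC scalerA -scaler_nat scalerA.
rewrite exprDn (jint_sum l0 l0) horner_sum.
rewrite [RHS](bigID (fun j : 'I_k.+1 => ~~ odd j))/= -[LHS]addr0; congr (_ + _); last first.
  apply/esym/big1 => j /=; rewrite ?negbK => oj.
  rewrite mono (jintZ l0 l0).
  by rewrite -[X in 'X^X]odd_double_half oj add1n jint_odd mulr0.
apply: eq_bigr => j /negPf ej.
rewrite mono (jintZ l0 l0).
rewrite hornerZ hornerM !horner_exp !hornerZ hornerX hornerD hornerN hornerC horner_exp hornerX.
rewrite [(1 - z ^+ 2) * _]mulrC -r2 -exprM mul2n.
have -> : (j./2).*2 = j by rewrite -[RHS]odd_double_half ej.
by rewrite [z * x]mulrC; ring.
Qed.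

Lemma translation_at1 z q : (translation z q).[1] = jint l l 1 * q.[z].
Proof.
rewrite (@horner_translation z q 1 0) ?expr1n ?subrr ?mul0r ?expr0n//.
by rewrite scale0r addr0 mul1r comp_polyCr -[_%:P]mulr1 mul_polyC (jintZ l0 l0) mulrC.
Qed.

Local Notation h := (l + 2^-1).
Let h0 : 0 < h. Proof. by rewrite ltr_wpDl. Qed.

(** By [integral_kern] the integral over y is an average of v, and that average is the translate of v at x. *)
Lemma integral2_kern z u v : `|z| < 1 -> (forall y, `|y| < 1 -> 0 <= u.[y]) ->
  (forall y, `|y| < 1 -> 0 <= v.[y]) ->
  (\int[mu]_x \int[mu]_y (kern l x y z * (u.[x] * v.[y]))%:E)%E =
  (wgt h h z * jint h h (u * translation z v))%:E.
Proof.
move=> z1 u0 v0.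
rewrite -jintZ// EFin_jint//; apply: eq_integral => x _.
have [x1|x1] := ltP `|x| 1; last first.
  rewrite (wgt_out h h x1) mulr0 integral0_eq// => y _.
  by rewrite (kern_out _ _ _ x1) mul0r.
rewrite (@integral_kern _ l x z (fun y => u.[x] * v.[y]))//; first last.
- by move=> y y1; rewrite mulr_ge0 ?u0 ?v0.
- by apply: measurable_funM => //; exact: measurable_horner.
set r := Num.sqrt _.
have r2 : r ^+ 2 = (1 - x ^+ 2) * (1 - z ^+ 2).
  by rewrite sqr_sqrtr// mulr_ge0// ltW// sqr_lt1.
rewrite hornerZ hornerM (horner_translation _ r2).
have -> : wgt h h z * (u.[x] * jint l l (v \Po ((x * z)%:P + r *: 'X))) * wgt h h x =
    jint l l ((wgt h h x * wgt h h z * u.[x]) *: (v \Po ((x * z)%:P + r *: 'X))).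
  by rewrite (jintZ l0 l0); ring.
rewrite (EFin_jint l0 l0); apply: eq_integral => s _; congr EFin.
rewrite hornerZ horner_comp hornerD hornerC hornerZ hornerX; ring.
Qed.

(** Tonelli's theorem and the symmetry of the kernel, for polynomials that are nonnegative on the interval; a polynomial becomes so when a constant is added, and both sides are bilinear. *)
Lemma translation_sym z u v : `|z| < 1 ->
  jint h h (u * translation z v) = jint h h (v * translation z u).
Proof.
move=> z1.
have pos p q : (forall y, `|y| < 1 -> 0 <= p.[y]) -> (forall y, `|y| < 1 -> 0 <= q.[y]) ->
    jint h h (p * translation z q) = jint h h (q * translation z p).
  move=> p0 q0.
  have w0 : wgt h h z != 0 by rewrite wgt_half// gt_eqF// powR_gt0// sqr_lt1.
  apply: (mulfI w0); apply: EFin_inj; rewrite -!integral2_kern//.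
  have mF : measurable_fun [set: R * R] (fun t => (kern l t.1 t.2 z * (p.[t.1] * q.[t.2]))%:E).
    apply/measurable_EFinP/measurable_funM.
      by apply: measurable_kern; [exact: measurable_fst|exact: measurable_snd|exact: measurable_cst].
    apply: measurable_funM.
      by apply: (measurableT_comp (measurable_horner p)).
    by apply: (measurableT_comp (measurable_horner q)).
  rewrite (@fubini_tonelli _ _ _ _ _ mu mu
    (fun t => (kern l t.1 t.2 z * (p.[t.1] * q.[t.2]))%:E))//; last first.
    move=> [x y]/=; rewrite lee_fin.
    have [x1|x1] := ltP `|x| 1; last by rewrite (kern_out _ _ _ x1) mul0r.
    have [y1|y1] := ltP `|y| 1; last by rewrite kernC12 (kern_out _ _ _ y1) mul0r.
    by rewrite !mulr_ge0 ?kern_ge0 ?p0 ?q0.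
  apply: eq_integral => y _; apply: eq_integral => x _ /=.
  by rewrite kernC12 [p.[x] * _]mulrC.
have [M M0 uM] := horner_bounded u; have [N N0 vN] := horner_bounded v.
have c0 (c : R) : 0 <= c -> forall y, `|y| < 1 -> 0 <= c%:P.[y].
  by move=> ? ? _; rewrite hornerC.
have uM0 y : `|y| < 1 -> 0 <= (u + M%:P).[y].
  by move=> /ltW/uM; rewrite hornerD hornerC ler_norml; lra.
have vN0 y : `|y| < 1 -> 0 <= (v + N%:P).[y].
  by move=> /ltW/vN; rewrite hornerD hornerC ler_norml; lra.
have := pos _ _ uM0 vN0; have := pos _ _ uM0 (c0 _ N0); have := pos _ _ (c0 _ M0) vN0.
have := pos _ _ (c0 _ M0) (c0 _ N0).
rewrite !translationD !mulrDl !mulrDr !(jintD h0 h0); lra.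
Qed.

Local Notation C n := (gegenbauer l n).
Local Notation m0 := (jint l l 1).

(** A symmetric operator that does not raise degrees is diagonal in a graded orthogonal basis; the eigenvalue is read off at x = 1. *)
Lemma translation_gegenbauer z n : `|z| < 1 ->
  translation z (C n) = (m0 * (C n).[z]) *: C n.
Proof.
move=> z1.
have [c cE] : exists c : nat -> R, translation z (C n) = \sum_(i < n.+1) c i *: C i.
  by apply: (gegenbauer_expansion l0'); rewrite -[X in (_ <= X)%N](size_gegenbauer l0') size_translation.
have c0 (k : 'I_n) : c k = 0.
  have := translation_sym (C k) (C n) z1.
  rewrite cE (jint_gegenbauer_sum l0') ltnS ltnW//.
  have [d ->] : exists d : nat -> R, translation z (C k) = \sum_(i < k.+1) d i *: C i.
    by apply: (gegenbauer_expansion l0'); rewrite -[X in (_ <= X)%N](size_gegenbauer l0') size_translation.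
  rewrite (jint_gegenbauer_sum l0') ltnS leqNgt ltn_ord/= => /eqP.
  by rewrite mulf_eq0 (gt_eqF (gegenbauer_norm_gt0 l0' _)) orbF => /eqP.
have {}cE : translation z (C n) = c n *: C n.
  rewrite cE big_ord_recr/= big1 ?add0r// => k _.
  by rewrite c0 scale0r.
have := translation_at1 z (C n).
by rewrite cE hornerZ (gegenbauer_at1 l0') mulr1 => ->.
Qed.

(** Expand the square. The terms in p(x)^2 and p(y)^2 contribute equally, by the symmetry of translation and the fact that it maps 1 to the constant m0. *)
Lemma integral2_kern_sqr z p : `|z| < 1 ->
  (\int[mu]_x \int[mu]_y (kern l x y z * (p.[x] - p.[y]) ^+ 2)%:E)%E =
  (2 * wgt h h z * (m0 * jint h h (p ^+ 2) - jint h h (p * translation z p)))%:E.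
Proof.
move=> z1.
have T1 : jint h h (translation z (p ^+ 2)) = m0 * jint h h (p ^+ 2).
  rewrite -[translation z _]mul1r (translation_sym 1 _ z1).
  rewrite (_ : translation z 1 = m0%:P) ?[_ * m0%:P]mulrC ?mul_polyC ?(jintZ h0 h0)//.
  have := translation_gegenbauer 0 z1; rewrite /gegenbauer/= hornerC mulr1 => ->.
  by rewrite -mul_polyC mulr1.
have -> : 2 * wgt h h z * (m0 * jint h h (p ^+ 2) - jint h h (p * translation z p)) =
    jint h h (wgt h h z *: (m0 *: p ^+ 2 - 2 *: (p * translation z p) + translation z (p ^+ 2))).
  rewrite (jintZ h0 h0) (jintD h0 h0) (jintB h0 h0) !(jintZ h0 h0) T1; ring.
rewrite (EFin_jint h0 h0); apply: eq_integral => x _.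
have [x1|x1] := ltP `|x| 1; last first.
  rewrite (wgt_out h h x1) mulr0 integral0_eq// => y _.
  by rewrite (kern_out _ _ _ x1) mul0r.
rewrite (@integral_kern _ l x z (fun y => (p.[x] - p.[y]) ^+ 2))//; first last.
- by move=> y y1; rewrite sqr_ge0.
- apply: measurable_funX; apply: measurable_funB => //; exact: measurable_horner.
set r := Num.sqrt _.
have r2 : r ^+ 2 = (1 - x ^+ 2) * (1 - z ^+ 2).
  by rewrite sqr_sqrtr// mulr_ge0// ltW// sqr_lt1.
set A := (x * z)%:P + r *: 'X.
have -> : (wgt h h z *: (m0 *: p ^+ 2 - 2 *: (p * translation z p) + translation z (p ^+ 2))).[x] * wgt h h x =
    jint l l ((wgt h h x * wgt h h z) *: (p.[x] ^+ 2 *: 1 - (2 * p.[x]) *: (p \Po A) + ((p ^+ 2) \Po A))).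
  rewrite (jintZ l0 l0) (jintD l0 l0) (jintB l0 l0) !(jintZ l0 l0).
  rewrite -!(horner_translation _ r2) hornerZ hornerD hornerD hornerN !hornerZ (hornerM p (translation z p)) horner_exp.
  ring.
rewrite (EFin_jint l0 l0); apply: eq_integral => s _; congr EFin.
rewrite hornerZ hornerD hornerD hornerN !hornerZ hornerC !horner_comp horner_exp.
rewrite /A hornerD hornerC hornerZ hornerX; ring.
Qed.

End translation.

(** * H as a superposition of kernels *)

Section H_kern.
Context {R : realType}.
Local Notation mu := (@lebesgue_measure R).
Variable l : R.
Hypothesis l0 : 0 < l.
Implicit Types (x y z t u : R).

Let ffun u t := ppow (l - 1) ((t - 1) * (1 - u * t)) * ppow (- l - 1) t.

Let ffun_ge0 u t : 0 <= ffun u t. Proof. by rewrite mulr_ge0. Qed.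

Let measurable_ffun u : measurable_fun setT (ffun u).
Proof. by rewrite /ffun; mfun. Qed.

Let ffun_dom u t : 0 < u -> u < 1 -> 0 < (t - 1) * (1 - u * t) -> 1 < t /\ u * t < 1.
Proof.
move=> u0 u1 p0; have [t1|t1] := ltP 1 t.
  by split=> //; move: p0; rewrite pmulr_rgt0 ?subr_gt0.
by have : u * t < 1; nra.
Qed.

(** On the support t >= 1, so that the factor t^(-l-1) is at most 1 and a Beta integral remains. *)
Let ffun_lty u : 0 < u < 1 -> (\int[mu]_t (ffun u t)%:E < +oo)%E.
Proof.
move=> /andP[u0 u1].
pose g t := ppow (l - 1) ((t - 1) * (1 - u * t)).
have mg : measurable_fun setT g by rewrite /g; mfun.
have ui1 : 1 < u^-1 by rewrite invf_gt1.
apply: (@le_lt_trans _ _ (\int[mu]_t (g t)%:E)%E).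
  apply: ge0_le_integral => //=.
  - by move=> t _; rewrite lee_fin.
  - by apply/measurable_EFinP; exact: measurable_ffun.
  - exact/measurable_EFinP.
  - move=> t _; rewrite lee_fin /ffun -/(g t).
    have [p0|p0] := ltP 0 ((t - 1) * (1 - u * t)); last by rewrite /g (le0_ppow _ p0) mul0r.
    rewrite ler_piMr ?ppow_ge0//; have [t1 _] := ffun_dom u0 u1 p0.
    rewrite gt0_ppow ?(lt_trans _ t1)// -[leRHS](powRr0 t).
    apply: ler_powR; first exact: ltW. have := l0; lra.
(* half-length and midpoint of [1, 1/u] *)
pose r := (u^-1 - 1) / 2; pose m := (u^-1 + 1) / 2.
have r0 : 0 < r by rewrite divr_gt0// subr_gt0.
have c0 : 0 < u * r ^+ 2 by rewrite mulr_gt0// exprn_gt0.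
rewrite (@ge0_integral_affine_fin _ g r m (lt0r_neq0 r0) mg); last by move=> t; exact: ppow_ge0.
rewrite (_ : (fun t => _) = (fun t => (`|r| * (u * r ^+ 2) `^ (l - 1) * wgt l l t)%:E)); last first.
  apply/funext => t; congr EFin; rewrite /g -ppow_wgt -mulrA -ppowM//; congr (_ * ppow _ _).
  rewrite /r /m; field; exact: lt0r_neq0.
rewrite -(@ge0_integralZ_fin _ (`|r| * (u * r ^+ 2) `^ (l - 1)) (wgt l l)).
- by rewrite (integral_wgt l0 l0) -EFinM ltry.
- by rewrite mulr_ge0 ?powR_ge0.
- exact: measurable_wgt.
- exact: wgt_ge0.
Qed.

Let f_E u : 0 < u < 1 -> (f_ l u)%:E = (\int[mu]_t (ffun u t)%:E)%E.
Proof.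
move=> u01; have /andP[u0 u1] := u01.
pose F t := ((t - 1) * (1 - u * t)) `^ (l - 1) / t `^ (l + 1).
have FE t : `]1, u^-1[%classic t -> F t = ffun u t.
  rewrite /= in_itv/= => /andP[t1 tu].
  have t0 : 0 < t by exact: lt_trans t1.
  rewrite /F /ffun !gt0_ppow//; last first.
    rewrite mulr_gt0 ?subr_gt0// mulrC -ltr_pdivlMr// div1r//.
  by rewrite -powRN; congr (_ * _ `^ _); ring.
have mF : measurable_fun `]1, u^-1[ (EFin \o F).
  apply: (@eq_measurable_fun _ _ _ _ _ (EFin \o ffun u)).
    by move=> t; rewrite inE => /FE /= ->.
  by apply/measurable_EFinP/measurable_funTS; exact: measurable_ffun.
have e : (\int[mu]_(t in `[1%R, u^-1%R]) (F t)%:E = \int[mu]_t (ffun u t)%:E)%E.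
  rewrite (@integral_itv_bndoo _ 1 u^-1 (EFin \o F))// integral_mkcond.
  apply: eq_integral => t _; rewrite patchE; case: ifPn => [|nt].
    by rewrite inE => /FE /= ->.
  congr EFin; rewrite /ffun le0_ppow ?mul0r// leNgt; apply/negP => /(ffun_dom u0 u1) [t1 ut].
  move: nt; rewrite notin_setE/= in_itv/= t1/=; apply.
  by rewrite -div1r ltr_pdivlMr// mulrC.
rewrite -e /f_ /Rintegral fineK// ge0_fin_numE; first by rewrite e; exact: ffun_lty.
by apply: integral_ge0 => t _; rewrite lee_fin divr_ge0 ?powR_ge0.
Qed.

(** On the support of the kernel 1 - z runs from d to s, where d s = (x - y)^2; the substitution 1 - z = d t gives the integral that defines f at d / s. *)
Lemma integral_kern_f x y (s := 1 - x * y + Num.sqrt ((1 - x ^+ 2) * (1 - y ^+ 2))) :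
  `|x| < 1 -> `|y| < 1 -> x != y ->
  (\int[mu]_z (kern l x y z * ppow (- l - 1) (1 - z))%:E)%E =
  (s `^ l / (x - y) ^+ 2 * f_ l ((x - y) ^+ 2 / s ^+ 2))%:E.
Proof.
move=> x1 y1 xy.
have w0 : 0 < (1 - x ^+ 2) * (1 - y ^+ 2) by rewrite mulr_gt0// sqr_lt1.
set w := (1 - x ^+ 2) * _ in s w0 *; pose r := Num.sqrt w.
have r0 : 0 < r by rewrite sqrtr_gt0.
have r2 : r ^+ 2 = w by rewrite sqr_sqrtr// ltW.
have xy1 : 0 < 1 - x * y.
  have : `|x * y| < 1 by rewrite normrM mulr_ilt1.
  by rewrite ltr_norml subr_gt0 => /andP[].
have s0 : 0 < s by rewrite addr_gt0.
pose d := 1 - x * y - r.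
have ds : d * s = (x - y) ^+ 2.
  have -> : d * s = (1 - x * y) ^+ 2 - r ^+ 2 by rewrite /d /s -/r; ring.
  by rewrite r2 /w; ring.
have xy0 : 0 < (x - y) ^+ 2 by rewrite exprn_even_gt0//= subr_eq0.
have d0 : 0 < d by rewrite -(pmulr_lgt0 _ s0) ds.
have -> : (x - y) ^+ 2 / s ^+ 2 = d / s by rewrite -ds; field; exact: lt0r_neq0.
set u := d / s.
have u01 : 0 < u < 1.
  rewrite divr_gt0//= ltr_pdivrMr// mul1r /d /s -/r; lra.
rewrite EFinM f_E// ge0_integralZ_fin//; last first.
  by rewrite divr_ge0 ?powR_ge0// ltW.
pose F z := kern l x y z * ppow (- l - 1) (1 - z).
have mF : measurable_fun setT F.
  apply: measurable_funM; last by mfun.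
  by apply: measurable_kern; [exact: measurable_cst|exact: measurable_cst|exact: measurable_id].
have F0 z : 0 <= F z by rewrite mulr_ge0 ?kern_ge0.
have nd0 : - d != 0 by rewrite oppr_eq0 gt_eqF.
rewrite (@ge0_integral_affine_fin _ F (- d) 1 nd0 mF F0).
apply: eq_integral => t _; congr EFin.
rewrite normrN gtr0_norm// /F kernC23 kernE// -/w -r2.
have -> : r ^+ 2 - (- d * t + 1 - x * y) ^+ 2 = (d * s) * ((t - 1) * (1 - u * t)).
  rewrite /u; have -> : d * s * ((t - 1) * (1 - d / s * t)) = (d * (t - 1)) * (s - d * t).
    by field; exact: lt0r_neq0.
  rewrite /d /s -/r; ring.
have -> : 1 - (- d * t + 1) = d * t by ring.
rewrite (ppowM _ _ (mulr_gt0 d0 s0)) (ppowM _ _ d0) -ds /ffun.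
have -> : s `^ l / (d * s) = d * ((d * s) `^ (l - 1) * d `^ (- l - 1)).
  rewrite powRM ?ltW// invfM -(powR_inv1 (ltW d0)) -(powR_inv1 (ltW s0)).
  rewrite [X in _ = X * _](esym (powRr1 (ltW d0))).
  have -> : s `^ l * (d `^ (-1) * s `^ (-1)) = (s `^ l * s `^ (-1)) * d `^ (-1) by ring.
  have -> : d `^ 1 * (d `^ (l - 1) * s `^ (l - 1) * d `^ (- l - 1)) =
    s `^ (l - 1) * ((d `^ 1 * d `^ (l - 1)) * d `^ (- l - 1)) by ring.
  rewrite -!gt0_powRD//; congr (_ `^ _ * _ `^ _); ring.
ring.
Qed.

End H_kern.

(** * The energy as a Lebesgue integral *)

Definition nu_wgt {R : realType} (l x : R) : R :=
  nu_const l * wgt (l + 2^-1) (l + 2^-1) x.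

(** H is specified only inside the square and off the diagonal, and its joint measurability is not evident from the definition of f. A measurable kernel on the plane that agrees with it there makes Tonelli's theorem available. *)
Definition energy_kernel {R : realType} (l : R) (V : R * R -> R) : Prop :=
  [/\ measurable_fun setT V, forall t, 0 <= V t,
      forall x y, 1 <= `|x| -> V (x, y) = 0,
      forall x y, 1 <= `|y| -> V (x, y) = 0 &
      forall x y, `|x| < 1 -> `|y| < 1 -> x != y ->
        V (x, y) = nu_wgt l x * nu_wgt l y * (H_ l x y / (x - y) ^+ 2)].

Definition energy {R : realType} (V : R * R -> R) (f : R -> R) : \bar R :=
  (\int[lebesgue_measure]_y \int[lebesgue_measure]_x
     ((f x - f y) ^+ 2 * V (x, y))%:E)%E.

Section energy.
Context {R : realType}.
Local Notation mu := (@lebesgue_measure R).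
Variable l : R.
Hypothesis l0 : 0 <= l.
Local Notation D := (`](-1), 1[%classic : set R).
Implicit Types (x y : R).

Let inD x : (x \in D) = (`|x| < 1).
Proof. by apply/idP/idP; rewrite inE /= in_itv/= -ltr_norml. Qed.

Lemma H_ge0 x y : -1 <= x <= 1 -> -1 <= y <= 1 -> 0 <= H_ l x y.
Proof.
move=> /andP[x0 x1] /andP[y0 y1].
have xy : 0 <= 1 - x * y by nra.
rewrite /H_; case: ifPn => // _.
rewrite mulr_ge0//; last first.
  by apply: fine_ge0; apply: integral_ge0 => t _; rewrite lee_fin divr_ge0 ?powR_ge0.
rewrite divr_ge0 ?mulr_ge0 ?powR_ge0 ?Gamma_ge0 ?exprn_ge0 ?Gamma_ge0//.
Qed.

Lemma nu_wgt_ge0 x : 0 <= nu_wgt l x.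
Proof. by rewrite mulr_ge0// ltW// nu_const_gt0. Qed.

Lemma measurable_nu_wgt : measurable_fun setT (nu_wgt l).
Proof. by apply: measurable_funM => //; exact: measurable_wgt. Qed.

Let inv_wgt x := (nu_const l)^-1 * ppow (2^-1 - l) (1 - x ^+ 2).

Let inv_wgtE x : `|x| < 1 -> inv_wgt x * nu_wgt l x = 1.
Proof.
move=> x1; rewrite /inv_wgt /nu_wgt wgt_half// gt0_ppow ?sqr_lt1//.
rewrite mulrACA mulVf ?gt_eqF ?nu_const_gt0// mul1r -gt0_powRD ?sqr_lt1//.
by rewrite addrA subrK subrr powRr0.
Qed.

Let inv_wgt_ge0 x : 0 <= inv_wgt x.
Proof. by rewrite mulr_ge0// invr_ge0 ltW// nu_const_gt0. Qed.

Let measurable_inv_wgt : measurable_fun setT inv_wgt.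
Proof. by rewrite /inv_wgt; mfun. Qed.

Lemma measurable_energy_integrand (V : R * R -> R) (f : R -> R) :
  measurable_fun setT V -> measurable_fun setT f ->
  measurable_fun [set: R * R] (fun t => (f t.1 - f t.2) ^+ 2 * V t).
Proof.
move=> mV mf; apply: measurable_funM => //; apply: measurable_funX.
by apply: measurable_funB; apply: measurableT_comp.
Qed.

(** Inside the square each factor nu_wgt is invertible, with measurable inverse, so that the integrand of the iterated integral is a measurable function of the pair. *)
Lemma H_energyE V phi : energy_kernel l V -> measurable_fun D phi ->
  H_energy l phi = energy V (phi \_ D).
Proof.
move=> [mV V0 Vx Vy VE] mphi; set psi := phi \_ D.
have mpsi : measurable_fun setT psi by apply/(measurable_restrictT phi).
have psiE x : `|x| < 1 -> psi x = phi x by move=> x1; rewrite /psi patchE inD x1.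
pose F t : R := (psi t.1 - psi t.2) ^+ 2 * V t.
have mF : measurable_fun setT F by exact: measurable_energy_integrand.
have F0 t : 0 <= F t by rewrite mulr_ge0// sqr_ge0.
pose f y x := ((phi x - phi y) / (x - y)) ^+ 2 * H_ l x y.
have fE x y : `|x| < 1 -> `|y| < 1 -> f y x = inv_wgt x * inv_wgt y * F (x, y).
  move=> x1 y1; rewrite /f /F /= !psiE//.
  have [->|xy] := eqVneq x y; first by rewrite !subrr !mul0r expr0n/= !mul0r mulr0.
  rewrite VE// expr_div_n.
  have := inv_wgtE x1; have := inv_wgtE y1.
  set a := inv_wgt x; set b := inv_wgt y; move=> eb ea.
  transitivity ((phi x - phi y) ^+ 2 * ((a * nu_wgt l x) * (b * nu_wgt l y)) * (H_ l x y / (x - y) ^+ 2)).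
    by rewrite ea eb !mulr1; ring.
  ring.
have inner y : `|y| < 1 ->
    (\int[nu l]_(x in `[(-1)%R, 1%R]) (f y x)%:E)%E = ((inv_wgt y)%:E * \int[mu]_x (F (x, y))%:E)%E.
  move=> y1.
  have mFy : measurable_fun setT (fun x => F (x, y)).
    by apply: measurableT_comp mF _; exact: measurable_pair2.
  rewrite (@integral_nu _ l (EFin \o f y)); first last.
  - move=> x xb; rewrite lee_fin mulr_ge0 ?sqr_ge0// H_ge0//.
    by move: y1; rewrite ltr_norml => /andP[/ltW -> /ltW ->].
  - apply: (@eq_measurable_fun _ _ _ _ _ (fun x => (inv_wgt x * inv_wgt y * F (x, y))%:E)).
      by move=> x; rewrite inD => x1 /=; rewrite fE.
    by apply/measurable_EFinP/measurable_funTS; apply: measurable_funM => //; apply: measurable_funM.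
  rewrite ge0_integralZ_fin//.
  apply: eq_integral => x _; rewrite patchE inD; have [x1|x1] := ltP `|x| 1.
    rewrite /= -EFinM fE//; congr EFin; rewrite -/(nu_wgt l x).
    rewrite -[RHS]mul1r -(inv_wgtE x1); ring.
  by rewrite mul0e /F Vx// mulr0 mulr0.
pose G y := (\int[nu l]_(x in `[(-1)%R, 1%R]) (f y x)%:E)%E.
have G0 y : -1 <= y <= 1 -> (0 <= G y)%E.
  move=> yb; apply: integral_ge0 => x; rewrite /= in_itv/= => xb.
  by rewrite lee_fin mulr_ge0 ?sqr_ge0// H_ge0.
have mG : measurable_fun D G.
  apply: (@eq_measurable_fun _ _ _ _ _ (fun y => ((inv_wgt y)%:E * \int[mu]_x (F (x, y))%:E)%E)).
    by move=> y; rewrite inD => y1; rewrite /G inner.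
  apply: measurable_funTS; apply: emeasurable_funM; first exact/measurable_EFinP.
  apply: (@measurable_fun_fubini_tonelli_G _ _ _ _ _ mu (EFin \o F)) => //.
  exact/measurable_EFinP.
rewrite /H_energy /energy -[LHS]/(\int[nu l]_(y in `[(-1)%R, 1%R]) G y)%E (@integral_nu R l G mG G0).
apply: eq_integral => y _; rewrite patchE inD; have [y1|y1] := ltP `|y| 1.
  by rewrite /G inner// muleAC -EFinM inv_wgtE// mul1e.
rewrite mul0e integral0_eq// => x _.
by rewrite Vy// mulr0.
Qed.

End energy.

(** * The energy in Gegenbauer coordinates, positive parameter *)

Section gegenbauer_coordinates.
Context {R : realType}.
Variables (l : R) (n : nat) (c : nat -> R).
Hypothesis l0 : 0 <= l.
Local Notation h := (l + 2^-1).
Local Notation C n := (gegenbauer l n).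
Local Notation p := (\sum_(i < n) c i *: C i).
Let h0 : 0 < h. Proof. by rewrite ltr_wpDl. Qed.

Lemma jint_gegenbauer_mul (d : nat -> R) :
  jint h h (p * \sum_(i < n) d i *: C i) =
  \sum_(i < n) c i * d i * jint h h (C i * C i).
Proof.
rewrite mulr_suml (jint_sum h0 h0); apply: eq_bigr => i _.
by rewrite -scalerAl (jintZ h0 h0) jint_gegenbauer_sum// ltn_ord mulrA.
Qed.

Lemma dirichlet_gegenbauer_sum :
  jint h h ((1 - 'X ^+ 2) * p^`() ^+ 2) =
  \sum_(i < n) i%:R * (i%:R + 2 * l) * c i ^+ 2 * jint h h (C i * C i).
Proof.
rewrite (expr2 p^`()) mulrA {1}(raddf_sum (@deriv R)) mulr_sumr mulr_suml (jint_sum h0 h0).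
apply: eq_bigr => i _ /=.
rewrite derivZ -scalerAr -scalerAl (jintZ h0 h0) (dirichlet_gegenbauer l0).
by rewrite jint_gegenbauer_sum// ltn_ord; ring.
Qed.

End gegenbauer_coordinates.

Section positive_parameter.
Context {R : realType}.
Local Notation mu := (@lebesgue_measure R).
Variable l : R.
Hypothesis l0 : 0 < l.
Implicit Types (x y z : R) (p : {poly R}).
Local Notation h := (l + 2^-1).
Local Notation C n := (gegenbauer l n).
Local Notation m0 := (jint l l 1).
Let l0' : 0 <= l. Proof. exact: ltW. Qed.
Let h0 : 0 < h. Proof. by rewrite ltr_wpDl. Qed.
Let half0 : 0 < 2^-1 :> R. Proof. by []. Qed.

Let K x y z := kern l x y z * ppow (- l - 1) (1 - z).

Let K_ge0 x y z : 0 <= K x y z. Proof. by rewrite mulr_ge0 ?kern_ge0. Qed.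

Let measurable_K d (T : measurableType d) (f g k : T -> R) :
  measurable_fun setT f -> measurable_fun setT g -> measurable_fun setT k ->
  measurable_fun setT (fun t => K (f t) (g t) (k t)).
Proof.
by move=> mf mg mk; apply: measurable_funM; [exact: measurable_kern|mfun].
Qed.

Definition H_kernel (t : R * R) : R :=
  nu_const l ^+ 2 * H_const l * fine (\int[mu]_z (K t.1 t.2 z)%:E)%E.

Let intK_ge0 x y : (0 <= \int[mu]_z (K x y z)%:E)%E.
Proof. by apply: integral_ge0 => z _; rewrite lee_fin. Qed.

Let measurable_intK : measurable_fun setT (fun t : R * R => \int[mu]_z (K t.1 t.2 z)%:E)%E.
Proof.
apply: (@measurable_fun_fubini_tonelli_F _ _ (R * R)%type _ _ mu
  (fun t : (R * R) * R => (K t.1.1 t.1.2 t.2)%:E)).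
- apply/measurable_EFinP; apply: measurable_K; last exact: measurable_snd.
  + exact: measurableT_comp measurable_fst measurable_fst.
  + exact: measurableT_comp measurable_snd measurable_fst.
- by move=> t; rewrite lee_fin.
Qed.

Lemma H_kernelP : energy_kernel l H_kernel.
Proof.
have c0 : 0 <= nu_const l ^+ 2 * H_const l.
  by rewrite mulr_ge0 ?exprn_ge0// ltW// ?H_const_gt0// nu_const_gt0.
split.
- apply: measurable_funM => //; apply: measurableT_comp measurable_intK => //.
- by move=> t; rewrite mulr_ge0// fine_ge0.
- move=> x y x1; rewrite /H_kernel integral0_eq ?mulr0// => z _.
  by rewrite /K/= (kern_out _ _ _ x1) mul0r.
- move=> x y y1; rewrite /H_kernel integral0_eq ?mulr0// => z _.
  by rewrite /K/= kernC12 (kern_out _ _ _ y1) mul0r.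
move=> x y x1 y1 xy; rewrite /H_kernel integral_kern_f//= /H_ (gt_eqF l0).
have w0 : 0 < (1 - x ^+ 2) * (1 - y ^+ 2) by rewrite mulr_gt0// sqr_lt1.
set s := 1 - x * y + _; set f := f_ _ _; rewrite /nu_wgt !wgt_half//.
rewrite [(_ * _) `^ (l - 2^-1)]powRM; try by rewrite ltW ?sqr_lt1.
have : (1 - x ^+ 2) `^ (l - 2^-1) != 0 by rewrite gt_eqF// powR_gt0 ?sqr_lt1.
have : (1 - y ^+ 2) `^ (l - 2^-1) != 0 by rewrite gt_eqF// powR_gt0 ?sqr_lt1.
have : Gamma l != 0 by rewrite gt_eqF// Gamma_gt0.
have : 2 `^ (3 * l - 1) != 0 :> R by rewrite gt_eqF// powR_gt0.
have : x - y != 0 by rewrite subr_eq0.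
rewrite /H_const; move: (nu_const l) (Gamma (2 * l)) (Gamma l) (s `^ l) f => a b g sl f.
move: (_ `^ (l - 2^-1)) (_ `^ (l - 2^-1)) (_ `^ (3 * l - 1)) (x - y) => A B P e e0 P0 g0 B0 A0.
by field; rewrite ?e0 ?P0 ?g0 ?B0 ?A0.
Qed.

Let translation_sum z n (c : nat -> R) : `|z| < 1 ->
  translation l z (\sum_(i < n) c i *: C i) =
  \sum_(i < n) (c i * (m0 * (C i).[z])) *: C i.
Proof.
move=> z1; rewrite (big_morph _ (translationD l z) (id1 := 0)); last first.
  by rewrite /translation size_poly0 big_ord0.
apply: eq_bigr => i _; rewrite -scalerA -translation_gegenbauer//.
rewrite (translation_widen _ _ (size_scale_leq _ _)) /translation scaler_sumr.
by apply: eq_bigr => k _; rewrite coefZ scalerA.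
Qed.

(** Integrate in z last. For fixed z, [integral2_kern_sqr] and the diagonal form of translation give a multiple of the sum of c_i^2 (1 - C_i(z)) times the squared norms; the factor 1 - z of 1 - C_i(z) tames (1 - z)^(-l-1), and what remains is [slope_int_gegenbauer]. *)
Lemma energy_gegenbauer n (c : nat -> R) :
  energy H_kernel (horner (\sum_(i < n) c i *: C i)) =
  (2 * nu_const l * \sum_(i < n) i%:R * c i ^+ 2 * jint h h (C i * C i))%:E.
Proof.
set p := \sum_(i < n) _.
have mp := measurable_horner p.
pose F x y z := (p.[x] - p.[y]) ^+ 2 * K x y z.
have F0 x y z : 0 <= F x y z by rewrite mulr_ge0// sqr_ge0.
have mF d (T : measurableType d) (f g k : T -> R) :
    measurable_fun setT f -> measurable_fun setT g -> measurable_fun setT k ->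
    measurable_fun setT (fun t => F (f t) (g t) (k t)).
  move=> mf mg mk; apply: measurable_funM; last exact: measurable_K.
  by apply: measurable_funX; apply: measurable_funB; apply: (measurableT_comp mp).
pose a := nu_const l ^+ 2 * H_const l.
have a0 : 0 <= a by rewrite mulr_ge0 ?exprn_ge0// ltW// ?H_const_gt0// nu_const_gt0.
transitivity (a%:E * \int[mu]_y \int[mu]_x \int[mu]_z (F x y z)%:E)%E.
  have mFyx : measurable_fun setT (fun t : R * R => \int[mu]_z (F t.2 t.1 z)%:E)%E.
    apply: (@measurable_fun_fubini_tonelli_F _ _ (R * R)%type _ _ mu
      (fun t : (R * R) * R => (F t.1.2 t.1.1 t.2)%:E)).
    - apply/measurable_EFinP; apply: mF; last exact: measurable_snd.
      + exact: measurableT_comp measurable_snd measurable_fst.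
      + exact: measurableT_comp measurable_fst measurable_fst.
    - by move=> t; rewrite lee_fin.
  have F0' x y : (0 <= \int[mu]_z (F x y z)%:E)%E.
    by apply: integral_ge0 => z _; rewrite lee_fin.
  rewrite -ge0_integralZl//=; last 2 first.
  - exact: (@measurable_fun_fubini_tonelli_F _ _ _ _ _ mu (fun t : R * R => \int[mu]_z (F t.2 t.1 z)%:E)%E).
  - by move=> y _; apply: integral_ge0.
  apply: eq_integral => y _; rewrite -ge0_integralZl//=; last first.
    exact: measurableT_comp mFyx (measurable_pair1 y).
  apply: eq_integral => x _.
  have [->|xy] := eqVneq x y.
    rewrite subrr expr0n mul0r integral0_eq ?mule0// => z _.
    by rewrite /F subrr expr0n mul0r.
  rewrite /H_kernel/= -/a mulrCA EFinM; congr (_ * _)%E.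
  rewrite /F -ge0_integralZ_fin ?sqr_ge0//; last first.
    by apply: measurable_K => //; exact: measurable_cst.
  rewrite EFinM; congr (_ * _)%E; rewrite fineK//.
  have [x1|x1] := ltP `|x| 1; last first.
    by rewrite integral0_eq// => z _; rewrite /K (kern_out _ _ _ x1) mul0r.
  have [y1|y1] := ltP `|y| 1; last first.
    by rewrite integral0_eq// => z _; rewrite /K kernC12 (kern_out _ _ _ y1) mul0r.
  by rewrite integral_kern_f.
pose w i := c i ^+ 2 * jint h h (C i * C i).
pose S : {poly R} := \sum_(i < n) w i *: slope1 (C i).
transitivity (a%:E * \int[mu]_z (2 * m0 * (S.[z] * wgt 2^-1 h z))%:E)%E.
  congr (_ * _)%E.
  transitivity (\int[mu]_y \int[mu]_z \int[mu]_x (F x y z)%:E)%E.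
    apply: eq_integral => y _.
    apply: (@fubini_tonelli _ _ _ _ _ mu mu (fun t : R * R => (F t.1 y t.2)%:E)).
    - by apply/measurable_EFinP; apply: mF => //; exact: measurable_cst.
    - by move=> t; rewrite lee_fin.
  rewrite (@fubini_tonelli _ _ _ _ _ mu mu (fun t : R * R => \int[mu]_x (F x t.1 t.2)%:E)%E); last 2 first.
  - apply: (@measurable_fun_fubini_tonelli_F _ _ (R * R)%type _ _ mu
      (fun t : (R * R) * R => (F t.2 t.1.1 t.1.2)%:E)).
    + apply/measurable_EFinP; apply: mF; first exact: measurable_snd.
      * exact: measurableT_comp measurable_fst measurable_fst.
      * exact: measurableT_comp measurable_snd measurable_fst.
    + by move=> t; rewrite lee_fin.
  - by move=> t; apply: integral_ge0 => x _; rewrite lee_fin.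
  apply: eq_integral => z _ /=.
  have [z1|z1] := ltP `|z| 1; last first.
    rewrite (wgt_out 2^-1 h z1) !mulr0 integral0_eq// => y _.
    rewrite integral0_eq// => x _.
    by rewrite /F /K kernC23 kernC12 (kern_out _ _ _ z1) mul0r mulr0.
  transitivity ((ppow (- l - 1) (1 - z))%:E *
     \int[mu]_y \int[mu]_x (kern l y x z * (p.[y] - p.[x]) ^+ 2)%:E)%E.
    have mk : measurable_fun [set: R * R] (fun t : R * R => kern l t.1 t.2 z * (p.[t.1] - p.[t.2]) ^+ 2).
      apply: measurable_funM.
        by apply: measurable_kern => //; exact: measurable_cst.
      by apply: measurable_funX; apply: measurable_funB; apply: (measurableT_comp mp).
    have k0 x y : 0 <= kern l x y z * (p.[x] - p.[y]) ^+ 2.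
      by rewrite mulr_ge0 ?kern_ge0 ?sqr_ge0.
    rewrite -ge0_integralZl//=; last 3 first.
    - pose k (t : R * R) := (kern l t.1 t.2 z * (p.[t.1] - p.[t.2]) ^+ 2)%:E.
      have mk' : measurable_fun setT k by exact/measurable_EFinP.
      have k0' t : (0 <= k t)%E by rewrite lee_fin.
      exact: (@measurable_fun_fubini_tonelli_F _ _ _ _ _ mu k mk' k0').
    - by move=> y _; apply: integral_ge0 => x _; rewrite lee_fin.
    - by rewrite lee_fin.
    apply: eq_integral => y _; rewrite ge0_integralZ_fin//; last first.
      exact: measurableT_comp mk (measurable_pair1 y).
    apply: eq_integral => x _; congr EFin.
    rewrite /F /K kernC12; ring.
  rewrite (integral2_kern_sqr l0)// -EFinM; congr EFin.
  have z0 : 0 < 1 - z by move: z1; rewrite ltr_norml subr_gt0 => /andP[].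
  have -> : m0 * jint h h (p ^+ 2) - jint h h (p * translation l z p) = m0 * ((1 - z) * S.[z]).
    rewrite translation_sum// expr2 (@jint_gegenbauer_mul R l n c l0' c) (@jint_gegenbauer_mul R l n c l0' (fun i => c i * (m0 * (C i).[z]))).
    rewrite mulr_sumr -sumrB /S horner_sum !mulr_sumr; apply: eq_bigr => i _.
    have := congr1 (horner^~ z) (slope1E (C i)).
    rewrite hornerM !hornerD !hornerN !hornerC hornerX (gegenbauer_at1 l0') => e.
    rewrite hornerZ /w; transitivity (m0 * (c i ^+ 2 * jint h h (C i * C i)) * ((slope1 (C i)).[z] * (1 - z))).
      by rewrite e; ring.
    ring.
  have -> : wgt 2^-1 h z = ppow (- l - 1) (1 - z) * (1 - z) * wgt h h z.
    rewrite /wgt mulrA; congr (_ * _).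
    rewrite -[X in _ * X * _](ppow1 (ltW z0)) -!ppowD; congr (ppow _ _); lra.
  ring.
have mS : measurable_fun setT (fun z => S.[z] * wgt 2^-1 h z).
  by apply: measurable_funM; [exact: measurable_horner|exact: measurable_wgt].
have -> : (\int[mu]_z (2 * m0 * (S.[z] * wgt 2^-1 h z))%:E)%E =
    (2 * m0 * jint 2^-1 h S)%:E.
  rewrite mulrC mulrC -(jintZ half0 h0) (EFin_jint half0 h0).
  by apply: eq_integral => z _; rewrite hornerZ mulrA.
rewrite -EFinM; congr EFin.
have -> : jint 2^-1 h S = \sum_(i < n) i%:R * w i * jint 2^-1 h 1.
  rewrite /S (jint_sum half0 h0); apply: eq_bigr => i _.
  rewrite (jintZ half0 h0) -/(slope_int l (C i)) (slope_int_gegenbauer l0').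
  by rewrite mulrCA mulrA.
have -> : jint 2^-1 h 1 = 2 `^ l / nu_const l.
  apply: EFin_inj; rewrite (EFin_jint half0 h0) -(integral_wgt_half l0').
  by apply: eq_integral => z _; rewrite hornerC mul1r.
have -> : m0 = 2 `^ (- l) / H_const l.
  apply: EFin_inj; rewrite (EFin_jint l0 l0) -(H_const_integral l0).
  by apply: eq_integral => z _; rewrite hornerC mul1r.
rewrite -mulr_suml /a powRN.
have -> : \sum_(i < n) i%:R * w i = \sum_(i < n) i%:R * c i ^+ 2 * jint h h (C i * C i).
  by apply: eq_bigr => i _; rewrite /w mulrA.
move: (\sum_(i < n) _) => s.
have : nu_const l != 0 by rewrite gt_eqF// nu_const_gt0.
have : H_const l != 0 by rewrite gt_eqF// H_const_gt0.
have : 2 `^ l != 0 :> R by rewrite gt_eqF// powR_gt0.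
move: (nu_const l) (H_const l) (_ `^ _) => A B P P0 B0 A0.
by field; rewrite ?P0 ?B0 ?A0.
Qed.

End positive_parameter.

(** * The energy in Chebyshev coordinates, parameter zero *)

Lemma horner_inj {R : realType} (p q : {poly R}) : (forall x, p.[x] = q.[x]) -> p = q.
Proof.
move=> pq; apply/eqP; rewrite -subr_eq0; apply/eqP.
pose rs : seq R := [seq i%:R | i <- iota 0 (size (p - q))].
apply: (@roots_geq_poly_eq0 _ _ rs).
- by apply/allP => x _; rewrite /root hornerD hornerN pq subrr.
- by rewrite map_inj_uniq ?iota_uniq// => i j /eqP; rewrite eqr_nat => /eqP.
- by rewrite size_map size_iota.
Qed.

Section chebyshev.
Context {R : realType}.
Local Notation mu := (@lebesgue_measure R).
Implicit Types (x y : R) (p q f g : {poly R}).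
Local Notation h := (0 + 2^-1 : R).
Local Notation C n := (gegenbauer (0 : R) n).
Local Notation J := (jint h h).
Let h0 : 0 < h. Proof. by rewrite add0r. Qed.
Let l0 : 0 <= 0 :> R. Proof. by []. Qed.

Definition divided_difference y p : {poly R} :=
  \sum_(k < size p) p`_k *: \sum_(j < k) y ^+ (k.-1 - j) *: 'X^j.

Lemma divided_differenceE y p :
  divided_difference y p * ('X - y%:P) = p - p.[y]%:P.
Proof.
have -> : p - p.[y]%:P = \sum_(k < size p) p`_k *: ('X^k - y%:P ^+ k).
  rewrite -{1}[p]coefK poly_def horner_coef rmorph_sum -sumrB /=.
  by apply: eq_bigr => k _; rewrite scalerBr polyCM polyC_exp mul_polyC.
rewrite mulr_suml; apply: eq_bigr => k _; rewrite -scalerAl; congr (_ *: _).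
rewrite -opprB mulrN -[RHS]opprB subrXX mulrC; congr (- (_ * _)).
by apply: eq_bigr => j _; rewrite -mul_polyC polyC_exp.
Qed.

Let Xy0 y : 'X - y%:P != 0 :> {poly R}. Proof. by rewrite polyXsubC_eq0. Qed.

Lemma divided_difference_unique y p f :
  f * ('X - y%:P) = p - p.[y]%:P -> divided_difference y p = f.
Proof. by move=> e; apply: (mulIf (Xy0 y)); rewrite divided_differenceE. Qed.

(** The integral over x of g(x) (p(x) - p(y)) / (x - y), written with coefficients so that it is visibly a polynomial in y; for g = 1 it is the finite Hilbert transform of p. *)
Definition dd_transform g p : {poly R} :=
  \sum_(k < size p) p`_k *: \sum_(j < k) J ('X^j * g) *: 'X^(k.-1 - j).

Lemma horner_dd_transform g p y :
  (dd_transform g p).[y] = J (divided_difference y p * g).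
Proof.
rewrite horner_sum mulr_suml (jint_sum h0 h0); apply: eq_bigr => k _.
rewrite hornerZ -scalerAl (jintZ h0 h0); congr (_ * _).
rewrite horner_sum mulr_suml (jint_sum h0 h0); apply: eq_bigr => j _.
by rewrite hornerZ hornerXn -scalerAl (jintZ h0 h0) mulrC.
Qed.

(** Both sides are the double integral of f(y) g(x) (p(x) - p(y)) / (x - y). *)
Lemma dd_transform_sym f g p : J (f * dd_transform g p) = J (g * dd_transform f p).
Proof.
have expand f' g' : J (f' * dd_transform g' p) =
    \sum_(k < size p) p`_k * \sum_(j < k) J ('X^j * g') * J ('X^(k.-1 - j) * f').
  rewrite /dd_transform mulr_sumr (jint_sum h0 h0); apply: eq_bigr => k _.
  rewrite -(scalerAr p`_k f') (jintZ h0 h0); congr (_ * _).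
  rewrite mulr_sumr (jint_sum h0 h0); apply: eq_bigr => j _.
  by rewrite -(scalerAr (J ('X^j * g')) f') (jintZ h0 h0) (mulrC f').
rewrite !expand; apply: eq_bigr => k _; congr (_ * _).
rewrite (reindex_inj rev_ord_inj); apply: eq_bigr => j _ /=.
have jk := ltn_ord j.
have -> : (k - j.+1 = k.-1 - j)%N by lia.
have -> : (k.-1 - (k.-1 - j) = j)%N by lia.
by rewrite mulrC.
Qed.

(** By parts, for the polynomial q^2 (y - X) with q the divided difference; p' enters as the derivative of q (X - y). *)
Lemma jint_divided_difference y p :
  J ((1 - y *: 'X) * divided_difference y p ^+ 2) =
  2 * J ((1 - 'X ^+ 2) * (divided_difference y p * p^`())).
Proof.
set q := divided_difference y p.
have eq1 : q * ('X - y%:P) = p - p.[y]%:P by exact: divided_differenceE.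
have dq : q^`() * ('X - y%:P) + q = p^`().
  have := congr1 (@deriv R) eq1.
  by rewrite derivM !derivB !derivC derivX !subr0 mulr1.
apply/eqP; rewrite -subr_eq0 -(jintZ h0 h0) -(jintB h0 h0); apply/eqP.
rewrite -[RHS](jint_by_parts (q * q * (y%:P - 'X)) h0 h0); congr jint.
rewrite !derivM derivB derivC derivX -dq.
have -> : h *: (1 - 'X) - h *: (1 + 'X) = - 'X :> {poly R}.
  have hh : h%:P + h%:P = 1 :> {poly R} by rewrite -polyCD; congr polyC; lra.
  rewrite -!mul_polyC; transitivity (- ((h%:P + h%:P) * 'X) : {poly R}); first by ring.
  by rewrite hh mul1r.
by rewrite -!mul_polyC polyC_natr; ring.
Qed.

Let C_rec n : C n.+2 = 2 *: ('X * C n.+1) - C n.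
Proof.
have n0 : n.+1%:R != 0 :> R by rewrite pnatr_eq0.
apply: (scalerI n0); rewrite scalerBr (scalerA _ 2) [_ * 2]mulrC.
by have := gegenbauerS l0 n; rewrite mulr0 !addr0.
Qed.

Let dd_rec y p q : divided_difference y (2 *: ('X * p) - q) =
  2 *: (p + y *: divided_difference y p) - divided_difference y q.
Proof.
apply: divided_difference_unique.
have ep := divided_differenceE y p; have eq1 := divided_differenceE y q.
rewrite mulrBl eq1 -scalerAl mulrDl -scalerAl ep !hornerE.
rewrite -!mul_polyC polyCB !polyCM polyC_natr; ring.
Qed.

(** By [gegenbauer_deriv] the right-hand side is (1 - X^2) C_n' up to the factor J 1 / n, so the transform of C_n is a multiple of its derivative. Divided differences obey the recurrence of the C_n up to the term 2 C_(n+1), whose integral vanishes. *)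
Let dd_transform_gegenbauer n :
  (1 - 'X ^+ 2) * dd_transform 1 (C n) = J 1 *: ('X * C n - C n.+1).
Proof.
suff : (1 - 'X ^+ 2) * dd_transform 1 (C n) = J 1 *: ('X * C n - C n.+1) /\
  (1 - 'X ^+ 2) * dd_transform 1 (C n.+1) = J 1 *: ('X * C n.+1 - C n.+2) by case.
elim: n => [|n [ih1 ih2]].
  split.
    rewrite /dd_transform /gegenbauer /= size_poly1 big_ord_recl !big_ord0.
    by rewrite addr0 scaler0 mulr0 mulr1 subrr scaler0.
  rewrite C_rec /dd_transform /gegenbauer/= size_polyX !big_ord_recl !big_ord0.
  rewrite coefX/= scale0r coefX/= scale1r add0r !addr0 expr0 !mul1r.
  rewrite -!mul_polyC polyC_natr ?expr0 ?expr1; ring.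
split => //.
have -> : dd_transform 1 (C n.+2) = 2 *: ('X * dd_transform 1 (C n.+1)) - dd_transform 1 (C n).
  apply: horner_inj => y; rewrite hornerD hornerN hornerZ hornerM hornerX !horner_dd_transform !mulr1.
  rewrite C_rec dd_rec (jintB h0 h0) (jintZ h0 h0) (jintD h0 h0) (jintZ h0 h0).
  have := gegenbauer_orthogonal l0 (isT : n.+1 != 0%N).
  by rewrite {2}/gegenbauer/= mulr1 => ->; rewrite add0r.
rewrite mulrBr ih1 -scalerAr mulrCA ih2 (C_rec n.+1) (C_rec n) -!mul_polyC polyC_natr; ring.
Qed.

Let J_dd_transform n f :
  J ((1 - 'X ^+ 2) * f^`() * dd_transform 1 (C n)) = J 1 * (n%:R * J (C n * f)).
Proof.
have [->|n0] := eqVneq n 0%N.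
  rewrite mul0r mulr0 /dd_transform /gegenbauer /= size_poly1 big_ord_recl !big_ord0.
  by rewrite addr0 scaler0 mulr0 (jint0 h0 h0).
have nR : n%:R != 0 :> R by rewrite pnatr_eq0.
have dn := dirichlet_gegenbauer l0 n f; rewrite mulr0 addr0 in dn.
have e := dd_transform_gegenbauer n; have [e' _] := gegenbauer_deriv l0 n.
have {}e' : (1 - 'X ^+ 2) * (C n)^`() = n%:R *: ('X * C n - C n.+1).
  by rewrite e' polyC0 mulr0 addr0 -mul_polyC polyC_natr.
have {}e : n%:R *: ((1 - 'X ^+ 2) * f^`() * dd_transform 1 (C n)) =
    J 1 *: ((1 - 'X ^+ 2) * (C n)^`() * f^`()).
  transitivity ((n%:R *: ((1 - 'X ^+ 2) * dd_transform 1 (C n))) * f^`()).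
    by rewrite -scalerAl mulrAC.
  by rewrite e e' scalerA [n%:R * _]mulrC -scalerA -!scalerAl.
apply: (mulfI nR); rewrite -[LHS](jintZ h0 h0) e (jintZ h0 h0) dn; ring.
Qed.

Definition H_kernel0 (t : R * R) : R :=
  nu_wgt 0 t.1 * nu_wgt 0 t.2 * ((1 - t.1 * t.2) * ppow (- 1) ((t.1 - t.2) ^+ 2)).

Lemma H_kernel0P : energy_kernel 0 H_kernel0.
Proof.
split.
- have mw := @measurable_nu_wgt R 0.
  apply: measurable_funM; last by mfun.
  by apply: measurable_funM; apply: (measurableT_comp mw).
- move=> [x y]; rewrite /H_kernel0/=.
  have [x1|x1] := ltP `|x| 1; last by rewrite /nu_wgt (wgt_out h h x1) mulr0 !mul0r.
  have [y1|y1] := ltP `|y| 1; last by rewrite /nu_wgt (wgt_out h h y1) !(mulr0, mul0r).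
  apply: mulr_ge0; first by apply: mulr_ge0; exact: nu_wgt_ge0.
  apply: mulr_ge0 => //; have : `|x * y| < 1 by rewrite normrM mulr_ilt1.
  by rewrite ltr_norml subr_ge0 => /andP[_ /ltW].
- by move=> x y x1; rewrite /H_kernel0/= /nu_wgt (wgt_out h h x1) mulr0 !mul0r.
- by move=> x y y1; rewrite /H_kernel0/= /nu_wgt (wgt_out h h y1) !(mulr0, mul0r).
move=> x y _ _ xy; rewrite /H_kernel0/= /H_ eqxx gt0_ppow ?powR_inv1 ?sqr_ge0//.
by rewrite exprn_even_gt0//= subr_eq0.
Qed.

(** [jint_divided_difference] in x, then [dd_transform_sym], leave p' against the transform of p, which is known on each C_i. *)
Lemma energy_chebyshev n (c : nat -> R) :
  energy H_kernel0 (horner (\sum_(i < n) c i *: C i)) =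
  (2 * nu_const 0 * \sum_(i < n) i%:R * c i ^+ 2 * J (C i * C i))%:E.
Proof.
set p := \sum_(i < n) _; set a := nu_const 0.
have a0 : 0 < a by exact: nu_const_gt0.
transitivity (\int[mu]_y (2 * a ^+ 2 * ((dd_transform ((1 - 'X ^+ 2) * p^`()) p).[y] * wgt h h y))%:E)%E.
  apply: eq_integral => y _.
  rewrite horner_dd_transform mulrC.
  have -> : J (divided_difference y p * ((1 - 'X ^+ 2) * p^`())) =
     2^-1 * J ((1 - y *: 'X) * divided_difference y p ^+ 2).
    rewrite jint_divided_difference [RHS]mulrA mulVf// mul1r; congr jint; ring.
  have -> : 2^-1 * J ((1 - y *: 'X) * divided_difference y p ^+ 2) * wgt h h y * (2 * a ^+ 2) =
     J ((a ^+ 2 * wgt h h y) *: ((1 - y *: 'X) * divided_difference y p ^+ 2)).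
    by rewrite (jintZ h0 h0); field.
  rewrite (EFin_jint h0 h0); apply: (@eq_integral_off1 _ _ _ y).
  - apply/measurable_EFinP.
    have := measurable_energy_integrand (let: And5 m _ _ _ _ := H_kernel0P in m) (measurable_horner p).
    move=> mF; exact: measurableT_comp mF (measurable_pair2 y).
  - apply/measurable_EFinP/measurable_funM; [exact: measurable_horner|exact: measurable_wgt].
  move=> x xy; congr EFin.
  rewrite /H_kernel0/= /nu_wgt -/a gt0_ppow; last by rewrite exprn_even_gt0//= subr_eq0.
  rewrite powR_inv1 ?sqr_ge0// hornerZ hornerM hornerD hornerN hornerZ hornerX hornerC horner_exp.
  have := congr1 (horner^~ x) (divided_differenceE y p).
  rewrite hornerM !hornerD !hornerN !hornerC hornerX => <-.
  by field; rewrite subr_eq0.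
have mf g : measurable_fun setT (fun y => g.[y] * wgt h h y).
  by apply: measurable_funM; [exact: measurable_horner|exact: measurable_wgt].
set g := dd_transform _ _.
transitivity (J ((2 * a ^+ 2) *: g))%:E.
  by rewrite (EFin_jint h0 h0); apply: eq_integral => y _; rewrite hornerZ mulrA.
rewrite (jintZ h0 h0); congr EFin.
rewrite -[g]mul1r dd_transform_sym.
have -> : dd_transform 1 p = \sum_(i < n) c i *: dd_transform 1 (C i).
  apply: horner_inj => y; rewrite horner_dd_transform mulr1 horner_sum.
  have -> : divided_difference y p = \sum_(i < n) c i *: divided_difference y (C i).
    apply: divided_difference_unique; rewrite mulr_suml.
    rewrite /p horner_sum rmorph_sum -sumrB; apply: eq_bigr => i _ /=.
    by rewrite -scalerAl divided_differenceE hornerZ scalerBr polyCM mul_polyC.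
  rewrite (jint_sum h0 h0); apply: eq_bigr => i _.
  by rewrite (jintZ h0 h0) hornerZ horner_dd_transform mulr1.
rewrite mulr_sumr (jint_sum h0 h0).
have J1 : J 1 = a^-1.
  apply: EFin_inj; rewrite (EFin_jint h0 h0) -(integral_wgt_nu l0).
  by apply: eq_integral => z _; rewrite hornerC mul1r.
rewrite mulr_sumr [RHS]mulr_sumr; apply: eq_bigr => i _.
rewrite -(scalerAr (c i)) (jintZ h0 h0) J_dd_transform J1.
rewrite (jint_gegenbauer_sum l0) ltn_ord.
move: (J _) => t; field; exact: lt0r_neq0.
Qed.

End chebyshev.

(** * Uniform approximation by polynomials *)

Section bernstein.
Context {R : realType}.
Implicit Types (x t : R) (g : R -> R).

(** The pairs at which g varies by at least e form a compact set that avoids the diagonal; K is the maximum over it of the quotient of |g x - g t| by (x - t)^2. A modulus quadratic in x - t is what variance estimates can use. *)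
Lemma quadratic_modulus g (e : R) : continuous g -> 0 < e ->
  exists2 K, 0 <= K & forall x t, `|x| <= 1 -> `|t| <= 1 ->
    `|g x - g t| <= e + K * (x - t) ^+ 2.
Proof.
move=> cg e0.
pose d (p : R * R) := `|g p.1 - g p.2|.
have cd : continuous d.
  move=> p; apply: cvg_norm; apply: cvgB.
    apply: (@cvg_comp _ _ _ (fst : R * R -> R) g); [exact: cvg_fst|exact: cg].
  apply: (@cvg_comp _ _ _ (snd : R * R -> R) g); [exact: cvg_snd|exact: cg].
pose A : set (R * R) := (`[(-1)%R, 1%R]%classic `*` `[(-1)%R, 1%R]%classic) `&` [set p : R * R | e <= d p].
have cA : compact A.
  rewrite /A; apply: compact_closedI.
    by apply: compact_setX; exact: segment_compact.
  rewrite (_ : [set p | _] = d @^-1` [set r | e <= r])//.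
  by apply: closed_comp => [p _|]; [exact: cd|exact: closed_ge].
have [A0|/set0P A0] := eqVneq A set0.
  exists 0 => // x t x1 t1; rewrite mul0r addr0 leNgt; apply/negP => h.
  have : A (x, t) by split; [split; rewrite /= in_itv/= -ler_norml|exact: ltW].
  by rewrite A0.
pose f p := d p / (p.1 - p.2) ^+ 2.
have [p0 _ fmax] : exists2 c, c \in A & forall q, q \in A -> f q <= f c.
  apply: compact_EVT_max => //; apply: continuous_in_subspaceT => p.
  rewrite inE => -[_ /= ep]; apply: cvgM; first exact: cd.
  have p12 : p.1 - p.2 != 0.
    by apply: contraTneq ep => /subr0_eq e12; rewrite /d e12 subrr normr0 -ltNge.
  apply: cvgV; first by rewrite expf_neq0.
  apply: (@cvg_comp _ _ _ (fun p : R * R => p.1 - p.2) (fun r => r ^+ 2)); last exact: exprn_continuous.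
  by apply: cvgB; [exact: cvg_fst|exact: cvg_snd].
exists (f p0); first by rewrite /f /d divr_ge0 ?normr_ge0 ?sqr_ge0.
move=> x t x1 t1.
have fp0 : 0 <= f p0 by rewrite /f /d divr_ge0 ?normr_ge0 ?sqr_ge0.
have [h|h] := ltP (d (x, t)) e.
  by rewrite (le_trans (ltW h))// lerDl mulr_ge0// sqr_ge0.
have xt : x - t != 0.
  by apply: contraTneq h => /subr0_eq e12; rewrite /d/= e12 subrr normr0 -ltNge.
have : f (x, t) <= f p0.
  by apply: fmax; rewrite inE; split => //; split; rewrite /= in_itv/= -ler_norml.
rewrite /f/= ler_pdivrMr; last by rewrite exprn_even_gt0.
by move=> /le_trans; apply; rewrite lerDr ltW.
Qed.

Definition bernstein_basis n k : {poly R} := 'C(n, k)%:R *: ((1 - 'X) ^+ (n - k) * 'X^k).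

Lemma bernstein_sum n x : \sum_(k < n.+1) (bernstein_basis n k).[x] = 1.
Proof.
transitivity (((1 - x) + x) ^+ n); last by rewrite subrK expr1n.
rewrite exprDn; apply: eq_bigr => k _.
by rewrite /bernstein_basis hornerZ hornerM horner_exp hornerXn hornerD hornerN hornerC hornerX mulr_natl.
Qed.

(** The first two moments come from applying the operator X d/dX once and twice to ((1 - x) + X)^n, then setting X = x. *)
Lemma bernstein_variance n x :
  \sum_(k < n.+1) (bernstein_basis n k).[x] * (k%:R - n%:R * x) ^+ 2 =
  n%:R * x * (1 - x).
Proof.
pose P : {poly R} := ((1 - x)%:P + 'X) ^+ n.
pose b k := 'C(n, k)%:R * (1 - x) ^+ (n - k).
have PE : P = \sum_(k < n.+1) b k *: 'X^k.
  rewrite /P exprDn; apply: eq_bigr => k _.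
  by rewrite -polyC_exp mul_polyC -scaler_nat scalerA.
have euler (a : nat -> R) : 'X * (\sum_(k < n.+1) a k *: 'X^k)^`() =
    \sum_(k < n.+1) (k%:R * a k) *: 'X^k.
  rewrite (raddf_sum (@deriv R)) mulr_sumr; apply: eq_bigr => k _ /=.
  rewrite derivZ derivXn -scalerAr -scaler_nat -scalerAr scalerA [_ * a k]mulrC.
  case: (nat_of_ord k) => [|m]; first by rewrite mulr0n mulr0 !scale0r.
  by rewrite -exprS.
have bE (k : 'I_n.+1) : (bernstein_basis n k).[x] = b k * x ^+ k.
  by rewrite /bernstein_basis /b hornerZ hornerM horner_exp hornerXn hornerD hornerN hornerC hornerX mulrA.
have s0 : \sum_(k < n.+1) b k * x ^+ k = 1.
  by rewrite -(bernstein_sum n x); apply: eq_bigr => k _; rewrite bE.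
have val (a : nat -> R) : (\sum_(k < n.+1) a k *: 'X^k).[x] = \sum_(k < n.+1) a k * x ^+ k.
  by rewrite horner_sum; apply: eq_bigr => k _; rewrite hornerZ hornerXn.
have one : ((1 - x)%:P + 'X).[x] = 1 by rewrite hornerD hornerC hornerX subrK.
have dP : P^`() = n%:R *: ((1 - x)%:P + 'X) ^+ n.-1.
  by rewrite /P deriv_exp derivD derivC derivX add0r mul1r scaler_nat.
have s1 : \sum_(k < n.+1) k%:R * b k * x ^+ k = n%:R * x.
  rewrite -(val (fun k => k%:R * b k)) -euler -PE dP.
  by rewrite hornerM hornerX hornerZ horner_exp one expr1n mulr1 mulrC.
have s2 : \sum_(k < n.+1) k%:R * (k%:R * b k) * x ^+ k = n%:R * x + n%:R * (n%:R - 1) * x ^+ 2.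
  rewrite -(val (fun k => k%:R * (k%:R * b k))) -(euler (fun k => k%:R * b k)) -euler -PE dP.
  rewrite derivM derivX mul1r derivZ deriv_exp derivD derivC derivX add0r mul1r.
  rewrite hornerM hornerX hornerD hornerM hornerX !hornerZ hornerMn !horner_exp one !expr1n.
  case: (n) => [|m]; first by rewrite !(mulr0n, mul0r, mulr0, addr0).
  by rewrite -mulr_natl -natr1 /=; ring.
transitivity (\sum_(k < n.+1) (k%:R * (k%:R * b k) * x ^+ k
    + (- (2 * n%:R * x)) * (k%:R * b k * x ^+ k) + (n%:R * x) ^+ 2 * (b k * x ^+ k))).
  by apply: eq_bigr => k _; rewrite bE; ring.
rewrite !big_split /= -!mulr_sumr s0 s1 s2; ring.
Qed.

Lemma bernstein_basis_ge0 n k x : 0 <= x <= 1 -> 0 <= (bernstein_basis n k).[x].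
Proof.
move=> /andP[x0 x1].
rewrite /bernstein_basis hornerZ hornerM horner_exp hornerXn hornerD hornerN hornerC hornerX.
by rewrite !mulr_ge0 ?exprn_ge0// subr_ge0.
Qed.

(** Bernstein's argument: g x minus its Bernstein polynomial is an average of the differences of g, which [quadratic_modulus] bounds by e / 2 plus K times a variance of order 1 / n. *)
Lemma weierstrass g (e : R) : continuous g -> 0 < e ->
  exists p : {poly R}, forall x, `|x| <= 1 -> `|g x - p.[x]| <= e.
Proof.
move=> cg e0; have e20 : 0 < e / 2 by rewrite divr_gt0.
have [K K0 gK] := quadratic_modulus cg e20.
pose n := (Num.truncn (8 * K / e)).+1.
have n0 : 0 < n%:R :> R by [].
have nK : K * (4 / n%:R) <= e / 2.
  have : 8 * K / e < n%:R by exact: Num.Theory.truncnS_gt.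
  by rewrite ltr_pdivrMr// mulrA ler_pdivrMr// => ?; lra.
pose node k : R := 2 * (k%:R / n%:R) - 1.
pose q : {poly R} := \sum_(k < n.+1) g (node k) *: bernstein_basis n k.
exists (q \Po (2^-1 *: ('X + 1))) => x x1.
pose y := (x + 1) / 2; have xE : x = 2 * y - 1 by rewrite /y; field.
have y01 : 0 <= y <= 1.
  by move: x1; rewrite ler_norml /y => /andP[? ?]; rewrite divr_ge0 ?ler_pdivrMr//=; lra.
rewrite horner_comp hornerZ hornerD hornerX hornerC mulrC -/y /q horner_sum.
rewrite -[g x]mulr1 -(bernstein_sum n y) mulr_sumr -sumrB.
rewrite (le_trans (ler_norm_sum _ _ _))//.
apply: (@le_trans _ _ (\sum_(k < n.+1) ((e / 2) * (bernstein_basis n k).[y] +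
   K * (4 / n%:R ^+ 2) * ((bernstein_basis n k).[y] * (k%:R - n%:R * y) ^+ 2)))).
  apply: ler_sum => k _; have b0 := bernstein_basis_ge0 n k y01.
  rewrite (hornerZ (g (node k))) -mulrBl normrM (ger0_norm b0).
  have node1 : `|node k| <= 1.
    rewrite ler_norml /node; have : 0 <= (k%:R / n%:R : R) <= 1.
      by rewrite divr_ge0//= ler_pdivrMr// mul1r ler_nat -ltnS.
    by move=> /andP[? ?]; lra.
  have := gK x (node k) x1 node1; move/(ler_wpM2r b0)/le_trans; apply.
  rewrite le_eqVlt; apply/orP; left; apply/eqP; rewrite xE /node; field.
  exact: lt0r_neq0.
rewrite big_split /= -!mulr_sumr bernstein_sum bernstein_variance mulr1.
have -> : K * (4 / n%:R ^+ 2) * (n%:R * y * (1 - y)) = K * (4 / n%:R) * (y * (1 - y)).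
  by field; exact: lt0r_neq0.
have yy : 0 <= y * (1 - y) <= 1 by move/andP: y01 => [? ?]; nra.
have : K * (4 / n%:R) * (y * (1 - y)) <= e / 2.
  case/andP: yy => yy0 yy1; apply: le_trans nK.
  by rewrite ler_piMr// mulr_ge0// divr_ge0.
lra.
Qed.

End bernstein.

(** * Approximation of C^1 functions *)

Section C1_approximation.
Context {R : realType}.
Implicit Types (x y : R) (p q : {poly R}).

Definition antideriv q : {poly R} := \sum_(i < size q) (q`_i / i.+1%:R) *: 'X^(i.+1).

Lemma antiderivK q : (antideriv q)^`() = q.
Proof.
rewrite /antideriv (raddf_sum (@deriv R)) -[RHS]coefK poly_def; apply: eq_bigr => i _ /=.
rewrite derivZ derivXn /= -(scaler_nat i.+1 'X^i) scalerA divfK//.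
Qed.

Variable phi : R -> R.
Hypothesis phi_C1 : C1_itv (-1) 1 phi.

Lemma C1_derive_extension : exists2 g : R -> R, continuous g &
  forall x, `|x| < 1 -> phi^`()%classic x = g x.
Proof.
have [_ dcont /cvg_ex[/= La cLa] /cvg_ex[/= Lb cLb]] := phi_C1.
pose g x := if x <= -1 then La else if 1 <= x then Lb else phi^`()%classic x.
exists g => [x|x]; last first.
  by rewrite ltr_norml /g => /andP[x1 x2]; rewrite leNgt x1/= leNgt x2.
have gin x0 : -1 < x0 < 1 -> g x0 = phi^`()%classic x0.
  by move=> /andP[x1 x2]; rewrite /g leNgt x1/= leNgt x2.
have gl x0 : x0 <= -1 -> g x0 = La by rewrite /g => ->.
have gr x0 : 1 <= x0 -> g x0 = Lb by move=> x01; rewrite /g x01 leNgt (lt_le_trans _ x01).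
have [x1|x1|->] := ltgtP x (-1).
- rewrite /continuous_at (gl x (ltW x1)).
  apply: cvg_near_cst; near=> t.
  by apply/eqP; rewrite gl//; apply: ltW; near: t; exact: lt_nbhsl.
- have [x2|x2|->] := ltgtP x 1.
  + rewrite /continuous_at gin ?x1//.
    have xin : x \in `](-1), 1[ by rewrite in_itv/= x1.
    apply: (cvg_trans _ (dcont x xin)).
    apply: near_eq_cvg; near=> t; rewrite gin//; apply/andP; split; near: t.
      exact: lt_nbhsr.
    exact: lt_nbhsl.
  + rewrite /continuous_at (gr x (ltW x2)).
    apply: cvg_near_cst; near=> t.
    by apply/eqP; rewrite gr//; apply: ltW; near: t; exact: lt_nbhsr.
  + apply/left_right_continuousP; rewrite gr//; split.
      apply: (cvg_trans _ cLb); apply: near_eq_cvg; near=> t; rewrite gin//.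
      apply/andP; split; near: t; first exact: nbhs_left_gt.
      exact: nbhs_left_lt.
    apply: cvg_near_cst; near=> t.
    by apply/eqP; rewrite gr//; apply: ltW; near: t; exact: nbhs_right_gt.
- apply/left_right_continuousP; rewrite gl//; split.
    apply: cvg_near_cst; near=> t.
    by apply/eqP; rewrite gl//; apply: ltW; near: t; exact: nbhs_left_lt.
  apply: (cvg_trans _ cLa); apply: near_eq_cvg; near=> t; rewrite gin//.
  apply/andP; split; near: t; first exact: nbhs_right_gt.
  exact: nbhs_right_lt.
Unshelve. all: by end_near. Qed.

(** Take for p a primitive of a uniform approximation of the derivative, with p(-1) = phi(-1); the mean value theorem then bounds phi - p in the Lipschitz seminorm, which is the one that the energy sees. *)
Lemma C1_approx (e : R) : 0 < e -> exists p : {poly R},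
  [/\ forall x, `|x| < 1 -> `|phi^`()%classic x - p^`().[x]| <= e,
      forall x y, `|x| <= 1 -> `|y| <= 1 ->
        `|(phi x - p.[x]) - (phi y - p.[y])| <= e * `|x - y| &
      forall x, `|x| <= 1 -> `|phi x - p.[x]| <= 2 * e].
Proof.
move=> e0; have [g cg gE] := C1_derive_extension.
have [q gq] := weierstrass cg e0.
have [dphi _ _ _] := phi_C1; have [phi_der _ _] := dphi.
pose p := (phi (-1) - (antideriv q).[-1])%:P + antideriv q.
have p'E : p^`() = q by rewrite derivD derivC add0r antiderivK.
have d1 x : `|x| < 1 -> `|phi^`()%classic x - p^`().[x]| <= e.
  by move=> x1; rewrite p'E gE// gq// ltW.
pose f x := phi x - p.[x].
have cf : {within `[(-1)%R, 1%R], continuous f}.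
  move=> x; apply: cvgB; first exact: derivable_oo_LRcontinuous_within.
  apply: continuous_subspaceT => t; exact: continuous_horner.
have lip x y : `|x| <= 1 -> `|y| <= 1 -> x <= y -> `|f x - f y| <= e * `|x - y|.
  move=> + + ; rewrite !(ler_norml _ 1) => /andP[x1 x2] /andP[y1 y2].
  rewrite le_eqVlt => /predU1P[->|xy]; first by rewrite !subrr !normr0 mulr0.
  have sub : `[x, y]%classic `<=` `[(-1)%R, 1%R]%classic.
    by move=> t; rewrite /= !in_itv/= => /andP[xt ty]; rewrite (le_trans x1 xt) (le_trans ty y2).
  have der t : t \in `]x, y[%R -> is_derive t 1 f (phi^`()%classic t - p^`().[t]).
    rewrite in_itv/= => /andP[xt ty].
    have t1 : t \in `](-1)%R, 1%R[.
      by rewrite in_itv/= (le_lt_trans x1 xt) (lt_le_trans ty y2).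
    apply: is_deriveB.
      by rewrite derive1E; apply: derivableP; exact: phi_der.
  have [c cxy fE] := MVT xy der (continuous_subspaceW sub cf).
  rewrite distrC fE normrM [`|x - y|]distrC ler_wpM2r//; apply: d1.
  move: cxy; rewrite in_itv/= ltr_norml => /andP[xc cy].
  by rewrite (le_lt_trans x1 xc) (lt_le_trans cy y2).
exists p; split => //.
- move=> x y x1 y1; have [xy|/ltW yx] := leP x y; first exact: lip.
  by rewrite distrC [`|x - y|]distrC; exact: lip.
- move=> x x1; have fm1 : f (-1) = 0.
    by rewrite /f /p hornerD hornerC subrK subrr.
  have : `|f (-1) - f x| <= e * `|-1 - x|.
    have m1 : `|-1| <= 1 :> R by rewrite normrN normr1.
    by apply: (lip _ _ m1 x1); move: x1; rewrite ler_norml => /andP[].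
  rewrite fm1 sub0r normrN => /le_trans; apply; rewrite mulrC; apply: ler_wpM2r; first exact: ltW.
  by apply: (le_trans (ler_normB _ _)); rewrite normrN normr1; lra.
Qed.

End C1_approximation.

(** * Perturbation of quadratic forms *)

Section limit_comparison.
Context {R : realType}.

(** The cross term of (b + (a - b))^2 is at most e b^2 + (a - b)^2 / e. *)
Lemma sqr_le_perturb (a b e : R) : 0 < e ->
  a ^+ 2 <= (1 + e) * b ^+ 2 + (1 + e^-1) * (a - b) ^+ 2.
Proof.
move=> e0; rewrite -subr_ge0.
have -> : (1 + e) * b ^+ 2 + (1 + e^-1) * (a - b) ^+ 2 - a ^+ 2 =
    (e * b - (a - b)) ^+ 2 / e by field; rewrite gt_eqF.
by rewrite divr_ge0 ?sqr_ge0// ltW.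
Qed.

Lemma sqr_le_perturb_bound (a b e d : R) : 0 < e -> `|a - b| <= e * d ->
  a ^+ 2 <= (1 + e) * b ^+ 2 + (e ^+ 2 + e) * d ^+ 2.
Proof.
move=> e0 abd; apply: (le_trans (sqr_le_perturb a b e0)); rewrite lerD2l.
have -> : (e ^+ 2 + e) * d ^+ 2 = (1 + e^-1) * (e * d) ^+ 2.
  by field; rewrite gt_eqF.
apply: ler_wpM2l; first by rewrite addr_ge0// invr_ge0 ltW.
by rewrite -real_normK ?num_real// ler_sqr// ?nnegrE// (le_trans _ abd).
Qed.

(** The passage to the limit: y and y' are values of two quadratic forms at a polynomial that depends on e, while X and Z are their values at the function to be approximated. *)
Lemma lee_of_perturb (X Z : \bar R) (k1 k2 : R) :
  (0 <= Z)%E -> 0 <= k1 -> 0 <= k2 ->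
  (forall e, 0 < e <= 1 -> exists y y', [/\ y <= y',
     (X <= ((1 + e) * y + e * k1)%:E)%E &
     (y'%:E <= (1 + e)%:E * Z + (e * k2)%:E)%E]) ->
  (X <= Z)%E.
Proof.
case: Z => [z| |]// z0 k10 k20 H; last exact: leey.
move: z0; rewrite lee_fin => z0.
have X_le e : 0 < e <= 1 -> (X <= (z + e * (3 * z + k1 + 2 * k2))%:E)%E.
  move=> e01; have [y [y' [yy' Xy y'z]]] := H e e01.
  apply: (le_trans Xy); rewrite lee_fin.
  move: y'z; rewrite -EFinM -EFinD lee_fin => y'z.
  move/andP: e01 => [e0 e1].
  have : y <= (1 + e) * z + e * k2 by exact: le_trans yy' y'z.
  have ez : 0 <= e * z by rewrite mulr_ge0// ltW.
  have ek : 0 <= e * k2 by rewrite mulr_ge0// ltW.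
  have : e * (e * z) <= e * z by rewrite ler_piMl.
  have : e * (e * k2) <= e * k2 by rewrite ler_piMl.
  move=> a b c; have : (1 + e) * y <= (1 + e) * ((1 + e) * z + e * k2).
    by apply: ler_wpM2l => //; lra.
  move=> d; lra.
set K := 3 * z + k1 + 2 * k2 in X_le.
have K0 : 0 <= K by rewrite /K; lra.
apply/lee_addgt0Pr => d d0.
pose e := Num.min 1 (d / (K + 1)).
have e0 : 0 < e by rewrite /e lt_min ltr01/= divr_gt0//; lra.
have e1 : e <= 1 by rewrite /e ge_min lexx.
apply: (le_trans (X_le e _)); first by rewrite e0.
rewrite -EFinD lee_fin lerD2l.
have : e <= d / (K + 1) by rewrite /e ge_min lexx orbT.
rewrite ler_pdivlMr; last lra.
by move=> ed; rewrite (le_trans _ ed)// ler_wpM2l ?ltW// ltrDl.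
Qed.

End limit_comparison.

Section monotonicity.
Context {R : realType}.
Local Notation mu := (@lebesgue_measure R).
Local Notation D := (`](-1), 1[%classic : set R).
Variable l : R.
Hypothesis l0 : 0 <= l.

(** f1 and f2 are a function and its approximation, in either order, and f3 measures the error. *)
Lemma le_energy (V : R * R -> R) (f1 f2 f3 : R -> R) (c2 c3 : R) :
  energy_kernel l V ->
  measurable_fun setT f1 -> measurable_fun setT f2 -> measurable_fun setT f3 ->
  0 <= c2 -> 0 <= c3 ->
  (forall x y, `|x| < 1 -> `|y| < 1 -> (f1 x - f1 y) ^+ 2 <=
     c2 * (f2 x - f2 y) ^+ 2 + c3 * (f3 x - f3 y) ^+ 2) ->
  (energy V f1 <= c2%:E * energy V f2 + c3%:E * energy V f3)%E.
Proof.
move=> [mV V0 Vx Vy _] m1 m2 m3 c20 c30 le123.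
have mF := measurable_energy_integrand mV.
have F0 f t : 0 <= (f t.1 - f t.2) ^+ 2 * V t by rewrite mulr_ge0 ?sqr_ge0.
have mFy (f : R -> R) : measurable_fun setT f -> forall y,
    measurable_fun setT (fun x => (f x - f y) ^+ 2 * V (x, y)).
  move=> mf y; have := measurableT_comp (mF f mf) (measurable_pair2 y).
  exact.
have mG (f : R -> R) : measurable_fun setT f -> measurable_fun setT
    (fun y => \int[mu]_x ((f x - f y) ^+ 2 * V (x, y))%:E)%E.
  move=> mf; have mF' : measurable_fun setT (fun t => ((f t.1 - f t.2) ^+ 2 * V t)%:E).
    by apply/measurable_EFinP; exact: mF.
  have F0' t : (0 <= ((f t.1 - f t.2) ^+ 2 * V t)%:E)%E by rewrite lee_fin.
  exact: (@measurable_fun_fubini_tonelli_G _ _ _ _ _ mu _ mF' F0').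
have G0 (f : R -> R) y : (0 <= \int[mu]_x ((f x - f y) ^+ 2 * V (x, y))%:E)%E.
  by apply: integral_ge0 => x _; rewrite lee_fin (F0 f (x, y)).
rewrite /energy -!ge0_integralZl//; try exact: mG; try by move=> *; exact: G0.
rewrite -ge0_integralD//; last 4 first.
- by move=> y _; rewrite mule_ge0 ?lee_fin.
- by apply: emeasurable_funM => //; exact: mG.
- by move=> y _; rewrite mule_ge0 ?lee_fin.
- by apply: emeasurable_funM => //; exact: mG.
apply: ge0_le_integral => //; first exact: mG.
- by apply: emeasurable_funD; apply: emeasurable_funM => //; exact: mG.
move=> y _; rewrite !ge0_integralZ_fin//; try exact: mFy;
  try by move=> x; exact: (F0 _ (x, y)).
rewrite -ge0_integralD//; last 4 first.
- by move=> x _; rewrite lee_fin mulr_ge0// (F0 _ (x, y)).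
- by apply/measurable_EFinP/measurable_funM => //; exact: mFy.
- by move=> x _; rewrite lee_fin mulr_ge0// (F0 _ (x, y)).
- by apply/measurable_EFinP/measurable_funM => //; exact: mFy.
apply: ge0_le_integral => //.
- by move=> x _; rewrite lee_fin (F0 _ (x, y)).
- by apply/measurable_EFinP; exact: mFy.
- by apply: emeasurable_funD; apply/measurable_EFinP/measurable_funM => //; exact: mFy.
move=> x _; rewrite -EFinD lee_fin (mulrA c2) (mulrA c3) -mulrDl.
have [x1|x1] := ltP `|x| 1; last by rewrite Vx// !mulr0.
have [y1|y1] := ltP `|y| 1; last by rewrite Vy// !mulr0.
by rewrite ler_wpM2r// le123.
Qed.

Lemma le_integral_nu (f1 f2 f3 : R -> R) (c2 c3 : R) :
  measurable_fun D f1 -> measurable_fun D f2 -> measurable_fun D f3 ->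
  (forall x, -1 <= x <= 1 -> 0 <= f1 x) -> (forall x, -1 <= x <= 1 -> 0 <= f2 x) ->
  (forall x, -1 <= x <= 1 -> 0 <= f3 x) -> 0 <= c2 -> 0 <= c3 ->
  (forall x, `|x| < 1 -> f1 x <= c2 * f2 x + c3 * f3 x) ->
  (\int[nu l]_(x in `[(-1)%R, 1%R]) (f1 x)%:E <=
   c2%:E * \int[nu l]_(x in `[(-1)%R, 1%R]) (f2 x)%:E +
   c3%:E * \int[nu l]_(x in `[(-1)%R, 1%R]) (f3 x)%:E)%E.
Proof.
move=> m1 m2 m3 p1 p2 p3 c20 c30 le123.
have nuE (f : R -> R) : measurable_fun D f -> (forall x, -1 <= x <= 1 -> 0 <= f x) ->
    (\int[nu l]_(x in `[(-1)%R, 1%R]) (f x)%:E =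
     \int[mu]_x ((f \_ D) x * nu_wgt l x)%:E)%E.
  move=> mf f0; rewrite (@integral_nu R l (EFin \o f))//; first last.
    by apply/measurable_EFinP.
  by apply: eq_integral => x _; rewrite !patchE; case: ifPn.
have mR (f : R -> R) : measurable_fun D f -> measurable_fun setT (fun x => (f \_ D) x * nu_wgt l x).
  move=> mf; apply: measurable_funM; last exact: measurable_nu_wgt.
  exact/(measurable_restrictT f).
have R0 (f : R -> R) : (forall x, -1 <= x <= 1 -> 0 <= f x) -> forall x, 0 <= (f \_ D) x * nu_wgt l x.
  move=> f0 x; rewrite mulr_ge0// ?nu_wgt_ge0// patchE; case: ifPn => //.
  by rewrite inE/= in_itv/= => /andP[/ltW x1 /ltW x2]; apply: f0; rewrite x1.
rewrite !nuE// !ge0_integralZ_fin//; try exact: mR; try exact: R0.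
rewrite -ge0_integralD//; last 4 first.
- by move=> x _; rewrite lee_fin mulr_ge0// R0.
- by apply/measurable_EFinP/measurable_funM => //; exact: mR.
- by move=> x _; rewrite lee_fin mulr_ge0// R0.
- by apply/measurable_EFinP/measurable_funM => //; exact: mR.
apply: ge0_le_integral => //.
- by move=> x _; rewrite lee_fin R0.
- by apply/measurable_EFinP; exact: mR.
- by apply: emeasurable_funD; apply/measurable_EFinP/measurable_funM => //; exact: mR.
move=> x _; rewrite -EFinD lee_fin (mulrA c2) (mulrA c3) -mulrDl ler_wpM2r ?nu_wgt_ge0//.
rewrite !patchE; case: ifPn => [|_]; last by rewrite !mulr0 addr0.
by rewrite inE/= in_itv/= -ltr_norml; exact: le123.
Qed.

Lemma integral_nu_horner (p : {poly R}) : (forall x, -1 <= x <= 1 -> 0 <= p.[x]) ->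
  (\int[nu l]_(x in `[(-1)%R, 1%R]) (p.[x])%:E =
   (nu_const l * jint (l + 2^-1) (l + 2^-1) p)%:E)%E.
Proof.
move=> p0; have h0 : 0 < l + 2^-1 by have := l0; lra.
have mp : measurable_fun D (horner p).
  by apply: measurable_funTS; exact: measurable_horner.
rewrite (@integral_nu R l (EFin \o horner p))//; last exact/measurable_EFinP.
rewrite -(jintZ h0 h0) (EFin_jint h0 h0); apply: eq_integral => x _.
rewrite patchE; case: ifPn => [_|]; first by rewrite hornerZ/= -EFinM; congr EFin; ring.
rewrite notin_setE/= in_itv/= -ltr_norml => /negP; rewrite -leNgt => x1.
by rewrite wgt_out// !mulr0 mul0e.
Qed.

End monotonicity.

(** * The inequalities for polynomials *)

Section comparison.
Context {R : realType}.
Local Notation mu := (@lebesgue_measure R).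
Local Notation D := (`](-1), 1[%classic : set R).
Variable l : R.
Hypothesis l0 : 0 <= l.
Local Notation h := (l + 2^-1).
Local Notation C := (gegenbauer l).
Let h0 : 0 < h. Proof. by rewrite ltr_wpDl. Qed.

Lemma energy_kernel_gegenbauer : exists2 V, energy_kernel l V &
  forall n (c : nat -> R), energy V (horner (\sum_(i < n) c i *: C i)) =
    (2 * nu_const l * \sum_(i < n) i%:R * c i ^+ 2 * jint h h (C i * C i))%:E.
Proof.
have [l_eq0|l_neq0] := eqVneq l 0.
  by rewrite l_eq0; exists H_kernel0; [exact: H_kernel0P|exact: energy_chebyshev].
have lgt0 : 0 < l by rewrite lt_neqAle eq_sym l_neq0.
by exists (H_kernel l); [exact: H_kernelP|exact: energy_gegenbauer].
Qed.

(** Termwise (2 l + 1) i <= i (i + 2 l) and, once the coordinate m on C_0 is removed, 1 <= i. *)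
Lemma polynomial_inequalities : exists2 V, energy_kernel l V &
  forall p : {poly R}, exists m E, [/\ energy V (horner p) = E%:E,
    (2 * l + 1) / 2 * E <= nu_const l * jint h h ((1 - 'X ^+ 2) * p^`() ^+ 2) &
    2 * (nu_const l * jint h h ((p - m%:P) ^+ 2)) <= E].
Proof.
have [V VP VE] := energy_kernel_gegenbauer; exists V => // p.
have [c pE] := gegenbauer_expansion l0 (leqnSn (size p)).
set n := (size p).+1 in pE.
have w0 i : 0 <= jint h h (C i * C i) by exact: gegenbauer_norm_ge0.
have k0 : 0 <= nu_const l by rewrite ltW// nu_const_gt0.
exists (c 0%N), (2 * nu_const l * \sum_(i < n) i%:R * c i ^+ 2 * jint h h (C i * C i)).
split.
- by rewrite -VE -pE.
- rewrite [in leRHS]pE dirichlet_gegenbauer_sum//.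
  have -> : (2 * l + 1) / 2 * (2 * nu_const l * \sum_(i < n) i%:R * c i ^+ 2 * jint h h (C i * C i)) =
    nu_const l * ((2 * l + 1) * \sum_(i < n) i%:R * c i ^+ 2 * jint h h (C i * C i)).
    by move: (nu_const l) (\sum_(i < n) _) => a b; field.
  apply: ler_wpM2l => //; rewrite mulr_sumr; apply: ler_sum => i _.
  have ? : 0 <= c i ^+ 2 * jint h h (C i * C i) by rewrite mulr_ge0// sqr_ge0.
  suff : (2 * l + 1) * i%:R <= i%:R * (i%:R + 2 * l) by move=> ?; nra.
  case: (i : nat) => [|j]; first by rewrite !mul0r mulr0.
  rewrite mulrC; apply: ler_wpM2l => //.
  have : 1 <= j.+1%:R :> R by rewrite ler1n.
  by move: (j.+1%:R : R) => a; lra.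
- pose d i := if i is 0%N then 0 else c i.
  have dE : p - (c 0%N)%:P = \sum_(i < n) d i *: C i.
    rewrite {1}pE /n !big_ord_recl /= /bump/=.
    have -> : C 0 = 1 by [].
    rewrite scale0r add0r alg_polyC addrC addKr.
    exact: eq_bigr.
  rewrite dE expr2 jint_gegenbauer_mul// mulrA; apply: ler_wpM2l; first by rewrite mulr_ge0.
  apply: ler_sum => i _; apply: ler_wpM2r => //.
  rewrite /d; case: (i : nat) => [|j]; first by rewrite !mul0r.
  by rewrite -expr2 ler_peMl ?sqr_ge0// ler1n.
Qed.

Lemma nu_const_jint1 : nu_const l * jint h h 1 = 1.
Proof.
apply: EFin_inj; rewrite EFinM (EFin_jint h0 h0).
rewrite (_ : \int[mu]_x _ = (nu_const l)^-1%:E)%E.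
  by rewrite -EFinM divff// gt_eqF// nu_const_gt0.
rewrite -(integral_wgt_nu l0); apply: eq_integral => x _.
by rewrite hornerC mul1r.
Qed.

(** Since nu has mass 1, the mean square distance to m exceeds the variance by the square of the difference between m and the mean. *)
Lemma variance_nu_le (f : R -> R) (m : R) : {within `[(-1)%R, 1%R], continuous f} ->
  (variance_nu l f <= \int[nu l]_(x in `[(-1)%R, 1%R]) ((f x - m) ^+ 2)%:E)%E.
Proof.
move=> cf.
have nu1 : (nu l `[(-1)%R, 1%R]%classic = 1)%E.
  transitivity (\int[nu l]_(x in `[(-1)%R, 1%R]) (horner 1 x)%:E)%E.
    rewrite -[LHS]mul1e -integral_cst//.
    by apply: eq_integral => x _; rewrite hornerC.
  by rewrite integral_nu_horner ?nu_const_jint1// => x _; rewrite hornerC.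
have mI : measurable (`[(-1)%R, 1%R]%classic : set R) by [].
have nuI : (nu l `[(-1)%R, 1%R]%classic < +oo)%E by rewrite nu1 ltry.
have int (g : R -> R) : {within `[(-1)%R, 1%R], continuous g} ->
    (nu l).-integrable `[(-1)%R, 1%R]%classic (EFin \o g).
  move=> cg; apply: measurable_bounded_integrable => //.
    exact: subspace_continuous_measurable_fun.
  have le_N11 : -1 <= 1 :> R by lra.
  have [a _ amax] := EVT_max le_N11 cg.
  have [b _ bmin] := EVT_min le_N11 cg.
  exists (`|g a| + `|g b|); split => // M M0 x /= xI.
  apply: (le_trans _ (ltW M0)); rewrite ler_norml.
  have := amax x xI; have := bmin x xI.
  have := ler_norm (g a); have := ler_norm (- g b); rewrite normrN.
  have := normr_ge0 (g a); have := normr_ge0 (g b).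
  by move: `|g a| `|g b| => u v; lra.
have cf2 : {within `[(-1)%R, 1%R], continuous (fun x => f x ^+ 2)}.
  by move=> x; rewrite /continuous_at; apply: cvgM; exact: cf.
have int1 := int f cf; have int2 := int _ cf2.
rewrite /variance_nu.
set A := (\int[nu l]_(x in _) (f x ^+ 2)%:E)%E.
set B := (\int[nu l]_(x in _) (f x)%:E)%E.
have -> : (\int[nu l]_(x in `[(-1)%R, 1%R]) ((f x - m) ^+ 2)%:E =
    A + (- (2 * m))%:E * B + (m ^+ 2)%:E)%E.
  have int3 : (nu l).-integrable `[(-1)%R, 1%R]%classic (EFin \o cst (m ^+ 2)).
    by apply: int => x; exact: cvg_cst.
  have int4 := integrableZl mI (- (2 * m)) int1.
  have -> : ((m ^+ 2)%:E = \int[nu l]_(x in `[(-1)%R, 1%R]) (cst (m ^+ 2) x)%:E)%E.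
    by rewrite -[LHS]mule1 -nu1 -integral_cst.
  transitivity (\int[nu l]_(x in `[(-1)%R, 1%R])
      ((f x ^+ 2)%:E + (- (2 * m))%:E * (f x)%:E + (m ^+ 2)%:E))%E.
    apply: eq_integral => x _; rewrite -EFinM -!EFinD; congr EFin; ring.
  transitivity (\int[nu l]_(x in `[(-1)%R, 1%R])
      ((f x ^+ 2)%:E + (- (2 * m))%:E * (f x)%:E)
      + \int[nu l]_(x in `[(-1)%R, 1%R]) (cst (m ^+ 2) x)%:E)%E.
    exact: (integralD mI (integrableD mI int2 int4) int3).
  congr (_ + _)%E; transitivity (A + \int[nu l]_(x in `[(-1)%R, 1%R])
      ((- (2 * m))%:E * (f x)%:E))%E; first exact: (integralD mI int2 int4).
  by congr (_ + _)%E; exact: (integralZl mI int1).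
have Afin : A \is a fin_num by exact: integrable_fin_num int2.
have Bfin : B \is a fin_num by exact: integrable_fin_num int1.
rewrite -(fineK Afin) -(fineK Bfin) -EFinM -!EFinD lee_fin.
by have := sqr_ge0 (fine B - m); move: (fine A) (fine B) => a b ?; nra.
Qed.

End comparison.

(** * The inequalities for C^1 functions *)

Theorem theorem11 (R : realType) (lambda : R) (phi : R -> R)
    (lambda_ge0 : 0 <= lambda) (phi_C1 : C1_itv (-1) 1 phi) :
  ((\int[nu lambda]_(x in `[(-1)%R, 1%R]) (phi^`()%classic x ^+ 2 * (1 - x ^+ 2))%:E
     >= ((2 * lambda + 1) / 2)%:E * H_energy lambda phi)%E)
  /\ ((H_energy lambda phi >= 2%:E * variance_nu lambda phi)%E).
Proof.
have [V VP polyP] := polynomial_inequalities lambda_ge0.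
have [dphi cdphi _ _] := phi_C1.
have cphi := derivable_oo_LRcontinuous_within dphi.
set D := (`](-1), 1[%classic : set R).
have mD : measurable D by exact: measurable_itv.
have mphi : measurable_fun D phi.
  have : measurable_fun (`[(-1)%R, 1%R]%classic : set R) phi.
    exact: subspace_continuous_measurable_fun.
  by apply: measurable_funS => // x; rewrite /D /= !in_itv/= => /andP[/ltW -> /ltW ->].
have mdphi : measurable_fun D phi^`()%classic.
  by apply: open_continuous_measurable_fun => // x; rewrite inE; exact: cdphi.
set psi := phi \_ D.
have mpsi : measurable_fun setT psi by apply/(measurable_restrictT phi mD).
have psiE x : `|x| < 1 -> psi x = phi x.
  by move=> x1; rewrite /psi patchE mem_set// /D/= in_itv/= -ltr_norml.
rewrite (H_energyE lambda_ge0 VP mphi) -/psi.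
(* The finite energy M0 of the identity function controls the error terms. *)
have [_ [M0 [M0E _ _]]] := polyP 'X.
have V0 : forall t, 0 <= V t by case: VP.
have en0 f : (0 <= energy V f)%E.
  apply: integral_ge0 => y _; apply: integral_ge0 => x _.
  by rewrite lee_fin mulr_ge0// sqr_ge0.
have M00 : 0 <= M0 by rewrite -lee_fin -M0E.
set k := nu_const lambda in polyP *; set h := lambda + 2^-1 in polyP *.
have k0 : 0 <= k by rewrite ltW// nu_const_gt0.
have sq0 (x : R) : -1 <= x <= 1 -> 0 <= (1 - 'X ^+ 2).[x].
  by rewrite !hornerE => /andP[x1 x2]; nra.
have M10 : 0 <= k * jint h h (1 - 'X ^+ 2).
  by rewrite mulr_ge0//; apply: jint_ge0 => x /ltW; rewrite ler_norml; exact: sq0.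
have alpha0 : 0 <= (2 * lambda + 1) / 2 by have := lambda_ge0; lra.
have mhorner (p : {poly R}) : measurable_fun D (horner p).
  by apply: measurable_funTS; exact: measurable_horner.
(* One polynomial for the three forms: m is its coordinate on C_0 and E its energy. *)
have approx e : 0 < e <= 1 -> exists p : {poly R}, exists m E,
    [/\ [/\ (2 * lambda + 1) / 2 * E <= k * jint h h ((1 - 'X ^+ 2) * p^`() ^+ 2),
        2 * (k * jint h h ((p - m%:P) ^+ 2)) <= E,
        (energy V psi <= ((1 + e) * E + e * (2 * M0))%:E)%E &
        (E%:E <= (1 + e)%:E * energy V psi + (e * (2 * M0))%:E)%E],
      ((k * jint h h ((1 - 'X ^+ 2) * p^`() ^+ 2))%:E <= (1 + e)%:E *
        \int[nu lambda]_(x in `[(-1)%R, 1%R]) (phi^`()%classic x ^+ 2 * (1 - x ^+ 2))%:E +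
        (e * (2 * (k * jint h h (1 - 'X ^+ 2))))%:E)%E &
      (\int[nu lambda]_(x in `[(-1)%R, 1%R]) ((phi x - m) ^+ 2)%:E <=
        ((1 + e) * (k * jint h h ((p - m%:P) ^+ 2)) + e * 8)%:E)%E].
  move=> /andP[e0 e1]; have [p [pder plip pclose]] := C1_approx phi_C1 e0.
  have [m [E [EE pA pB]]] := polyP p.
  have e20 : 0 <= e ^+ 2 + e by rewrite addr_ge0 ?sqr_ge0// ltW.
  (* The error coefficient e^2 + e comes from sqr_le_perturb_bound. *)
  have e2e M : 0 <= M -> (e ^+ 2 + e) * M <= e * (2 * M).
    move=> M_ge0; have : e ^+ 2 <= e by rewrite expr2 ler_piMl// ltW.
    by rewrite mulrA => ?; rewrite ler_wpM2r//; lra.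
  have ee0 : 0 <= 1 + e by rewrite addr_ge0// ltW.
  have mp : measurable_fun setT (horner p) by exact: measurable_horner.
  have mX : measurable_fun setT (horner ('X : {poly R})) by exact: measurable_horner.
  have close x y : `|x| < 1 -> `|y| < 1 ->
      `|(psi x - psi y) - (p.[x] - p.[y])| <= e * `|x - y|.
    move=> x1 y1; have := plip x y (ltW x1) (ltW y1); rewrite !psiE//.
    by congr (`|_| <= _); ring.
  exists p, m, E; split; [split => //| | ].
  - apply: (@le_trans _ _ ((1 + e)%:E * energy V (horner p) +
        (e ^+ 2 + e)%:E * energy V (horner 'X))%E).
      apply: (le_energy VP) => // x y x1 y1; rewrite !hornerX -(real_normK (num_real (x - y))).
      by apply: sqr_le_perturb_bound => //; exact: close.
    by rewrite EE M0E -!EFinM -EFinD lee_fin lerD2l e2e.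
  - apply: (@le_trans _ _ ((1 + e)%:E * energy V psi +
        (e ^+ 2 + e)%:E * energy V (horner 'X))%E).
      rewrite -EE; apply: (le_energy VP) => // x y x1 y1.
      rewrite !hornerX -(real_normK (num_real (x - y))).
      by apply: sqr_le_perturb_bound => //; rewrite distrC; exact: close.
    by rewrite leeD2l// M0E -EFinM lee_fin e2e.
  - apply: (@le_trans _ _ ((1 + e)%:E *
        \int[nu lambda]_(x in `[(-1)%R, 1%R]) (phi^`()%classic x ^+ 2 * (1 - x ^+ 2))%:E +
        (e ^+ 2 + e)%:E * \int[nu lambda]_(x in `[(-1)%R, 1%R]) ((1 - 'X ^+ 2).[x])%:E)%E).
      rewrite -integral_nu_horner//; last first.
        by move=> x x1; rewrite hornerM mulr_ge0 ?sq0// horner_exp sqr_ge0.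
      apply: le_integral_nu => //.
      + by apply: measurable_funM; [exact: measurable_funX|apply: measurable_funB => //; exact: measurable_funX].
      + by move=> x x1; rewrite hornerM mulr_ge0 ?sq0// horner_exp sqr_ge0.
      + by move=> x x1; rewrite mulr_ge0 ?sqr_ge0//; move: (sq0 x x1); rewrite !hornerE.
      + move=> x x1; rewrite hornerM horner_exp.
        have -> : 1 - x ^+ 2 = (1 - 'X ^+ 2).[x] by rewrite !hornerE.
        have x0 : 0 <= (1 - 'X ^+ 2).[x].
          by apply: sq0; rewrite -ler_norml ltW.
        move: (_.[x]) x0 => s s0.
        have : p^`().[x] ^+ 2 <= (1 + e) * phi^`()%classic x ^+ 2 + (e ^+ 2 + e) * 1 ^+ 2.
          by apply: sqr_le_perturb_bound => //; rewrite mulr1 distrC pder.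
        rewrite expr1n mulr1 => le1; apply: (le_trans (ler_wpM2l s0 le1)).
        by rewrite le_eqVlt; apply/orP; left; apply/eqP; ring.
    by rewrite leeD2l// integral_nu_horner// -EFinM lee_fin e2e.
  - apply: (@le_trans _ _ ((1 + e)%:E *
        \int[nu lambda]_(x in `[(-1)%R, 1%R]) (((p - m%:P) ^+ 2).[x])%:E +
        ((e ^+ 2 + e) * 2 ^+ 2)%:E *
          \int[nu lambda]_(x in `[(-1)%R, 1%R]) (1%:P.[x])%:E)%E).
      apply: le_integral_nu => //.
      + by apply: measurable_funX; exact: measurable_funB.
      + by move=> x _; rewrite sqr_ge0.
      + by move=> x _; rewrite horner_exp sqr_ge0.
      + by move=> x _; rewrite hornerC.
      + by rewrite mulr_ge0.
      + move=> x x1; rewrite hornerC mulr1 horner_exp; apply: sqr_le_perturb_bound => //.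
        rewrite hornerD hornerN hornerC mulrC.
        by have := pclose x (ltW x1); congr (`|_| <= _); ring.
    rewrite !integral_nu_horner//; last 2 first.
    - by move=> x _; rewrite hornerC.
    - by move=> x _; rewrite horner_exp sqr_ge0.
    rewrite (nu_const_jint1 lambda_ge0) -!EFinM mulr1 -EFinD lee_fin lerD2l.
    have -> : 8 = 2 * 2 ^+ 2 :> R by ring.
    exact: e2e.
split.
- apply: (@lee_of_perturb _ _ _ ((2 * lambda + 1) / 2 * (2 * M0))
    (2 * (k * jint h h (1 - 'X ^+ 2)))) => //.
  + apply: integral_ge0 => x; rewrite /= in_itv/= => x1.
    by rewrite lee_fin mulr_ge0 ?sqr_ge0//; move: (sq0 x x1); rewrite !hornerE.
  + exact: (mulr_ge0 alpha0 (mulr_ge0 (ler0n R 2) M00)).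
  + exact: (mulr_ge0 (ler0n R 2) M10).
  move=> e e01; have [p [m [E [[pA pB en_le _] dir_le _]]]] := approx e e01.
  exists ((2 * lambda + 1) / 2 * E), (k * jint h h ((1 - 'X ^+ 2) * p^`() ^+ 2)).
  split => //.
  rewrite (_ : (1 + e) * _ + _ = (2 * lambda + 1) / 2 * ((1 + e) * E + e * (2 * M0))).
    by rewrite [leRHS]EFinM lee_wpmul2l// lee_fin.
  by move: (_ / 2) => a; ring.
- apply: (@lee_of_perturb _ _ _ 16 (2 * M0)) => //; first exact: mulr_ge0.
  move=> e e01; have [p [m [E [[_ pB _ E_le] _ var_le]]]] := approx e e01.
  exists (2 * (k * jint h h ((p - m%:P) ^+ 2))), E; split => //.
  rewrite (_ : (1 + e) * _ + _ =
      2 * ((1 + e) * (k * jint h h ((p - m%:P) ^+ 2)) + e * 8)); last by ring.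
  rewrite [leRHS]EFinM lee_wpmul2l// (le_trans _ var_le)//.
  exact: variance_nu_le.
Qed.
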